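(* Let $\Lambda$ be a finite-dimensional algebra over an algebraically closed field with an idempotent $e$, put $E=e\Lambda e$ and $\overline\Lambda=\Lambda/\Lambda e\Lambda$, and fix $k\ge1$. Let $$L_l(e)=\max\{\ell_\Lambda(T\otimes_E e\Lambda)\mid T\in\operatorname{simp}E\},\qquad L_r(e)=\max\{\ell_{\overline\Lambda}(Y'_S)\mid S\in\operatorname{simp}\Lambda\},$$ where $Y'_S$ is the cokernel (a right $\overline\Lambda$-module) of the canonical map $S\to\operatorname{Hom}_E(\Lambda e,Se)$. (a) If $\operatorname{pd}_E(\Lambda e)<\infty$, then $k\text{-}\operatorname{ddell}E\le\operatorname{pd}_E(\Lambda e)+L_l(e)\bigl(k\text{-}\operatorname{ddell}\Lambda+1\bigr)-1$. (b) If ${}_\Lambda\overline\Lambda$ is projective as a left $\Lambda$-module, then $k\text{-}\operatorname{ddell}\overline\Lambda\le k\text{-}\operatorname{ddell}\Lambda$. (c) Suppose that $(\Lambda e)_E$ is projective as a right $E$-module, $\operatorname{pd}_\Lambda\overline\Lambda<\infty$ and $\operatorname{pd}_\Lambda\operatorname{Hom}_E(\Lambda e,E)<\infty$. Then $$k\text{-}\operatorname{ddell}\Lambda\le\max\Bigl\{\operatorname{pd}_\Lambda\overline\Lambda+k\text{-}\operatorname{ddell}\overline\Lambda,\ \operatorname{pd}_\Lambda\overline\Lambda+\operatorname{pd}_\Lambda\operatorname{Hom}_E(\Lambda e,E)+k\text{-}\operatorname{ddell}E+L_r(e)\bigl(k\text{-}\operatorname{ddell}\overline\Lambda+1\bigr)\Bigr\}.$$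 (d) Assume that $\sup\{\operatorname{pd}_\Lambda S\mid S\text{ is a simple }\overline\Lambda\text{-module}\}\le1$. Then $$k\text{-}\operatorname{ddell}E\le L_l(e)\bigl(k\text{-}\operatorname{ddell}\Lambda+1\bigr)-1\quad\text{and}\quad k\text{-}\operatorname{ddell}\Lambda\le k\text{-}\operatorname{ddell}E+2L_r(e)+3.$$
   Context: All modules are finitely generated right modules unless a left structure is indicated; projective dimensions are those of right modules, $\overline\Lambda$ and $\operatorname{Hom}_E(\Lambda e,E)$ being right $\Lambda$-modules in the natural way (the latter via the left $\Lambda$-action on $\Lambda e$). $\ell$ denotes composition length and $\operatorname{simp}$ the simple modules. The idempotent $e$ induces a recollement of $\operatorname{mod}\text{-}\Lambda$ by $\operatorname{mod}\text{-}\overline\Lambda$ and $\operatorname{mod}\text{-}E$, with functors $i=$ inclusion, $\mathsf e(X)=\operatorname{Hom}_\Lambda(e\Lambda,X)\simeq Xe$, $q=-\otimes_\Lambda\overline\Lambda$, $l=-\otimes_E e\Lambda$ and $r=\operatorname{Hom}_E(\Lambda e,-)$; the map $S\to r\mathsf e(S)$ is the adjunction unit, and its cokernel is annihilated by $\Lambda e\Lambda$. For a finite-dimensional algebra $\Lambda$, $\Omega$ denotes the syzygy endofunctor of the stable category of $\operatorname{mod}\text{-}\Lambda$ (modulo morphisms factoring through projectives), $\Omega^0=\operatorname{id}$; $U$ is a stable retract of $V$ if it is a retract of $V$ in this stable category. For $k\ge1$ and $X\in\operatorname{mod}\text{-}\Lambda$ (with $\inf\emptyset=\infty$): - $k\text{-}\operatorname{dell}_\Lambda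 X=\inf\{n\ge0\mid \Omega^nX$ is a stable retract of $\Omega^{n+k}Y$ for some $Y\}$; - $k\text{-}\operatorname{ddell}_\Lambda X=\inf\{m\ge0\mid$ there exist $0\le t\le m$ and an exact sequence $0\to C_t\to\cdots\to C_0\to X\to0$ with $(i+k)\text{-}\operatorname{dell}_\Lambda C_i\le m-i$ for $0\le i\le t\}$. $k\text{-}\operatorname{ddell}\Lambda=\sup\{k\text{-}\operatorname{ddell}_\Lambda S\mid S$ a simple right $\Lambda$-module$\}$. An expression on the right-hand side of an inequality is understood to be $\infty$ whenever a derived delooping level occurring in it is infinite. *)

(* Defs.v *)
From HB Require Import structures.
From mathcomp Require Import all_boot all_order all_algebra all_field.
From mathcomp Require Import ring_quotient generic_quotient boolp.

Set Implicit Arguments.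
Unset Strict Implicit.
Unset Printing Implicit Defensive.

Import GRing.Theory.
Local Open Scope ring_scope.
Local Open Scope quotient_scope.

(* Values in N u {oo}; None is oo.  The lifted operations are absorbing at oo:
   in particular 0 * oo = oo, so that an expression in which some term is oo is
   itself oo.  Subtraction of finite values is that of nat (truncated at 0). *)
Definition enat := option nat.
Definition fin (n : nat) : enat := Some n.
Coercion fin : nat >-> enat.
Definition oo : enat := None.

Declare Scope enat_scope.
Delimit Scope enat_scope with enat.
Bind Scope enat_scope with enat.

Definition elift (op : nat -> nat -> nat) (x y : enat) : enat :=
  match x, y with Some m, Some n => Some (op m n) | _, _ => None end.

Definition ele (x y : enat) : bool :=
  match x, y with
  | _, None => true
  | None, Some _ => false
  | Some m, Some n => (m <= n)%N
  end.

Notation "x + y" := (elift addn x y) : enat_scope.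
Notation "x * y" := (elift muln x y) : enat_scope.
Notation "x - y" := (elift subn x y) : enat_scope.
Notation "x <= y" := (ele x y) : enat_scope.
Notation emax := (elift maxn).

Definition einf (P : nat -> Prop) : enat :=
  if pselect (exists n, `[< P n >]) is left exP then Some (ex_minn exP) else oo.

(* The least upper bound in N u {oo}; in particular esup of the empty set is 0. *)
Definition esup (A : enat -> Prop) : enat :=
  einf (fun n => forall v, A v -> (v <= n)%enat).

(* Everything in this section is about left modules over R; right R-modules are
   the objects of lmodType R^c. *)
Section Modules.
Variable R : pzRingType.
Implicit Types M N P X Y Z U V : lmodType R.

Definition fingen M : Prop :=
  exists n (g : 'I_n -> M), forall x, exists c : 'I_n -> R,
    x = \sum_i c i *: g i.

Definition surj (A B : Type) (f : A -> B) : Prop := forall y, exists x, f x = y.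

Definition projective P : Prop :=
  forall M N (g : {linear M -> N}) (f : {linear P -> N}), surj g ->
  exists h : {linear P -> M}, forall x, g (h x) = f x.

Definition short_exact Z P X : Prop :=
  exists (f : {linear Z -> P}) (g : {linear P -> X}),
    [/\ injective f, surj g & forall x, g x = 0 <-> exists z, f z = x].

(* 0 -> C t -> ... -> C 0 -> X -> 0 is exact, encoded as an infinite exact
   sequence whose terms beyond t are zero. *)
Definition resolves (t : nat) (C : nat -> lmodType R) X : Prop :=
  (forall i, (t < i)%N -> forall x : C i, x = 0) /\
  exists (d0 : {linear C 0%N -> X}) (d : forall i, {linear C i.+1 -> C i}),
    [/\ surj d0,
        forall x, d0 x = 0 <-> exists y, d 0%N y = x
      & forall i x, d i x = 0 <-> exists y, d i.+1 y = x].

Definition pd X : enat :=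
  einf (fun n => exists C : nat -> lmodType R,
    (forall i, fingen (C i) /\ projective (C i)) /\ resolves n C X).

(* U represents Omega^n X.  By Schanuel's lemma the representatives of
   Omega^n X are isomorphic in the stable category. *)
Fixpoint is_syzygy (n : nat) X U : Prop :=
  match n with
  | 0 => exists f : {linear X -> U}, bijective f
  | n.+1 => exists P Z, [/\ fingen P, projective P, short_exact Z P X
                          & is_syzygy n Z U]
  end.

(* id_U = g f modulo the morphisms factoring through a projective. *)
Definition stable_retract U V : Prop :=
  exists (f : {linear U -> V}) (g : {linear V -> U})
         (P : lmodType R) (a : {linear U -> P}) (b : {linear P -> U}),
    [/\ fingen P, projective P & forall x, x - g (f x) = b (a x)].

Definition dell (k : nat) X : enat :=
  einf (fun n => exists Y U V,
    [/\ fingen Y, is_syzygy n X U, is_syzygy (n + k)%N Y V & stable_retract U V]).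

Definition ddell (k : nat) X : enat :=
  einf (fun m => exists (t : nat) (C : nat -> lmodType R),
    [/\ (t <= m)%N, forall i, fingen (C i), resolves t C X
      & forall i, (i <= t)%N -> (dell (i + k)%N (C i) <= (m - i)%N)%enat]).

Definition simple_mod M : Prop :=
  (exists x : M, x != 0) /\
  forall S : {pred M}, submod_closed S ->
    (forall x, x \in S -> x = 0) \/ (forall x, x \in S).

Definition composition_series M (n : nat) (S : nat -> {pred M}) : Prop :=
  [/\ forall i, submod_closed (S i),
      forall x, x \in S 0%N -> x = 0,
      forall x, x \in S n
    & forall i, (i < n)%N ->
      [/\ {subset S i <= S i.+1}, ~ {subset S i.+1 <= S i}
        & forall Q : {pred M}, submod_closed Q ->
          {subset S i <= Q} -> {subset Q <= S i.+1} ->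
          {subset Q <= S i} \/ {subset S i.+1 <= Q}]].

Definition comp_length M : enat :=
  einf (fun n => exists S : nat -> {pred M}, composition_series n S).

End Modules.

Definition ddell_alg (k : nat) (R : pzRingType) : enat :=
  esup (fun v => exists2 S : lmodType R^c, simple_mod S & v = ddell k S).

(* Restriction of scalars along f. *)
Definition restr (A B : pzRingType) (f : {rmorphism A -> B}) (M : lmodType B)
  : Type := M.

Section Restriction.
Variables (A B : pzRingType) (f : {rmorphism A -> B}) (M : lmodType B).
Local Notation N := (restr f M).
HB.instance Definition _ := GRing.Zmodule.on N.

Let act (a : A) (x : N) : N := f a *: (x : M).

Fact restr_actA a b x : act a (act b x) = act (a * b) x.
Proof. by rewrite /act scalerA rmorphM. Qed.
Fact restr_act1 : left_id 1 act.
Proof. by move=> x; rewrite /act rmorph1 scale1r. Qed.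
Fact restr_actDr : right_distributive act +%R.
Proof. by move=> a x y; rewrite /act scalerDr. Qed.
Fact restr_actDl x : {morph act^~ x : a b / a + b}.
Proof. by move=> a b; rewrite /act rmorphD scalerDl. Qed.
HB.instance Definition _ := GRing.Zmodule_isLmodule.Build A N
  restr_actA restr_act1 restr_actDr restr_actDl.
End Restriction.

Section Cokernel.
Variables (R : pzRingType) (M N : lmodType R) (f : {linear M -> N}).

Definition im_pred : {pred N} := fun y => `[< exists x, f x = y >].

Lemma im_predP y : reflect (exists x, f x = y) (y \in im_pred).
Proof. exact: asboolP. Qed.

Fact im_zmod_closed : zmod_closed im_pred.
Proof.
split; first by apply/im_predP; exists 0; rewrite linear0.
move=> _ _ /im_predP[x <-] /im_predP[y <-].
by apply/im_predP; exists (x - y); rewrite linearB.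
Qed.
HB.instance Definition _ := GRing.isZmodClosed.Build N im_pred im_zmod_closed.

Definition coker : Type := Quotient.quot im_pred.
HB.instance Definition _ := Choice.on coker.
HB.instance Definition _ := GRing.Zmodule.on coker.

Definition to_coker (y : N) : coker := \pi_(Quotient.quot im_pred) y.
Definition of_coker (y : coker) : N := repr (y : Quotient.quot im_pred).

Lemma of_cokerK : cancel of_coker to_coker.
Proof. exact: reprK. Qed.

Lemma to_coker_eq x y : to_coker x = to_coker y <-> exists z, f z = x - y.
Proof.
rewrite /to_coker; split=> [/eqP|].
  by rewrite -Quotient.idealrBE => /im_predP.
by move=> /im_predP; rewrite Quotient.idealrBE => /eqP.
Qed.

Lemma to_cokerD : {morph to_coker : x y / x + y}.
Proof. by move=> x y; rewrite /to_coker raddfD. Qed.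

Definition coker_act (a : R) (y : coker) : coker := to_coker (a *: of_coker y).

Lemma coker_actE a y : coker_act a (to_coker y) = to_coker (a *: y).
Proof.
have /to_coker_eq[z fz] := of_cokerK (to_coker y).
by apply/to_coker_eq; exists (a *: z); rewrite linearZ /= fz scalerBr.
Qed.

Fact coker_actA a b y : coker_act a (coker_act b y) = coker_act (a * b) y.
Proof. by rewrite -(of_cokerK y) !coker_actE scalerA. Qed.
Fact coker_act1 : left_id 1 coker_act.
Proof. by move=> y; rewrite /coker_act scale1r of_cokerK. Qed.
Fact coker_actDr : right_distributive coker_act +%R.
Proof.
move=> a x y; rewrite -(of_cokerK x) -(of_cokerK y).
by rewrite -to_cokerD !coker_actE scalerDr to_cokerD.
Qed.
Fact coker_actDl y : {morph coker_act^~ y : a b / a + b}.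
Proof. by move=> a b; rewrite /coker_act scalerDl to_cokerD. Qed.
HB.instance Definition _ := GRing.Zmodule_isLmodule.Build R coker
  coker_actA coker_act1 coker_actDr coker_actDl.
End Cokernel.

Section Corner.
Variables (R : pzRingType) (e : R).

Definition corner_pred : {pred R} := fun x => e * x * e == x.

Fact corner_zmod_closed : zmod_closed corner_pred.
Proof.
split=> [|x y]; rewrite !unfold_in ?mulr0 ?mul0r //.
by move=> /eqP hx /eqP hy; rewrite mulrBr mulrBl hx hy.
Qed.

(* The ring E = e R e, with unit e. *)
Variable he : e * e = e.
Definition corner of e * e = e : Type := {x : R | x \in corner_pred}.
Local Notation E := (corner he).
HB.instance Definition _ := GRing.isZmodClosed.Build R corner_pred corner_zmod_closed.
HB.instance Definition _ := [isSub of E for @sval _ _].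
HB.instance Definition _ := [Choice of E by <:].
HB.instance Definition _ := [SubChoice_isSubZmodule of E by <:].

Lemma cornerE (x : E) : e * val x * e = val x.
Proof. exact/eqP/(valP x). Qed.
Lemma corner_el (x : E) : e * val x = val x.
Proof. by rewrite -cornerE !mulrA he. Qed.
Lemma corner_er (x : E) : val x * e = val x.
Proof. by rewrite -cornerE -!mulrA he. Qed.

Fact corner_one_subproof : e \in corner_pred.
Proof. by rewrite unfold_in !he. Qed.
Definition corner_one : E := Sub e corner_one_subproof.
Fact corner_mul_subproof (x y : E) : val x * val y \in corner_pred.
Proof. by rewrite unfold_in !mulrA corner_el -mulrA corner_er. Qed.
Definition corner_mul (x y : E) : E :=
  Sub (val x * val y) (corner_mul_subproof x y).

Fact corner_mulA : associative corner_mul.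
Proof. by move=> x y z; apply: val_inj; rewrite !SubK mulrA. Qed.
Fact corner_mul1 : left_id corner_one corner_mul.
Proof. by move=> x; apply: val_inj; rewrite !SubK corner_el. Qed.
Fact corner_1mul : right_id corner_one corner_mul.
Proof. by move=> x; apply: val_inj; rewrite !SubK corner_er. Qed.
Fact corner_mulDl : left_distributive corner_mul +%R.
Proof. by move=> x y z; apply: val_inj; rewrite !SubK /= mulrDl. Qed.
Fact corner_mulDr : right_distributive corner_mul +%R.
Proof. by move=> x y z; apply: val_inj; rewrite !SubK /= mulrDr. Qed.
HB.instance Definition _ := GRing.Zmodule_isPzRing.Build E
  corner_mulA corner_mul1 corner_1mul corner_mulDl corner_mulDr.

Lemma val_cornerM (x y : E) : val (x * y) = val x * val y. Proof. by []. Qed.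
Lemma val_corner1 : val (1 : E) = e. Proof. by []. Qed.

End Corner.

Section QuotientByIdempotent.
Variables (R : pzRingType) (e : R).

(* The two-sided ideal R e R. *)
Definition ideal_pred : {pred R} :=
  fun x => `[< exists s : seq (R * R), x = \sum_(p <- s) p.1 * e * p.2 >].

Lemma ideal_predP x : reflect
  (exists s : seq (R * R), x = \sum_(p <- s) p.1 * e * p.2) (x \in ideal_pred).
Proof. exact: asboolP. Qed.

Fact ideal_zmod_closed : zmod_closed ideal_pred.
Proof.
split; first by apply/ideal_predP; exists [::]; rewrite big_nil.
move=> _ _ /ideal_predP[s ->] /ideal_predP[t ->]; apply/ideal_predP.
exists (s ++ [seq (- p.1, p.2) | p <- t]); rewrite big_cat big_map /=.
by rewrite -sumrN; congr (_ + _); apply: eq_bigr => p _; rewrite !mulNr.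
Qed.
HB.instance Definition _ := GRing.isZmodClosed.Build R ideal_pred
  ideal_zmod_closed.

Lemma ideal_mull a x : x \in ideal_pred -> a * x \in ideal_pred.
Proof.
move=> /ideal_predP[s ->]; apply/ideal_predP; exists [seq (a * p.1, p.2) | p <- s].
by rewrite big_map mulr_sumr; apply: eq_bigr => p _; rewrite !mulrA.
Qed.

Lemma ideal_mulr a x : x \in ideal_pred -> x * a \in ideal_pred.
Proof.
move=> /ideal_predP[s ->]; apply/ideal_predP; exists [seq (p.1, p.2 * a) | p <- s].
by rewrite big_map mulr_suml; apply: eq_bigr => p _; rewrite !mulrA.
Qed.

(* The ring R / R e R, possibly zero. *)
Definition rquot : Type := Quotient.quot ideal_pred.
HB.instance Definition _ := Choice.on rquot.
HB.instance Definition _ := GRing.Zmodule.on rquot.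

Definition to_rquot (x : R) : rquot := \pi_(Quotient.quot ideal_pred) x.
Definition of_rquot (x : rquot) : R := repr (x : Quotient.quot ideal_pred).

Lemma of_rquotK : cancel of_rquot to_rquot.
Proof. exact: reprK. Qed.

Lemma to_rquot_eq x y : to_rquot x = to_rquot y <-> x - y \in ideal_pred.
Proof.
rewrite /to_rquot; split=> [/eqP|]; first by rewrite -Quotient.idealrBE.
by rewrite Quotient.idealrBE => /eqP.
Qed.

Lemma to_rquotB : {morph to_rquot : x y / x - y}.
Proof. by move=> x y; rewrite /to_rquot raddfB. Qed.

Lemma to_rquotD : {morph to_rquot : x y / x + y}.
Proof. by move=> x y; rewrite /to_rquot raddfD. Qed.

Definition rquot_mul (x y : rquot) : rquot := to_rquot (of_rquot x * of_rquot y).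

Lemma to_rquotM : {morph to_rquot : x y / x * y >-> rquot_mul x y}.
Proof.
move=> x y; apply/esym/to_rquot_eq.
have /to_rquot_eq hx := of_rquotK (to_rquot x).
have /to_rquot_eq hy := of_rquotK (to_rquot y).
rewrite -[_ * _](subrK (x * of_rquot (to_rquot y))) -mulrBl -addrA -mulrBr.
by apply: rpredD; [apply: ideal_mulr | apply: ideal_mull].
Qed.

Fact rquot_mulA : associative rquot_mul.
Proof.
move=> x y z; rewrite -(of_rquotK x) -(of_rquotK y) -(of_rquotK z).
by rewrite -!to_rquotM mulrA.
Qed.
Fact rquot_mul1 : left_id (to_rquot 1) rquot_mul.
Proof. by move=> x; rewrite -(of_rquotK x) -to_rquotM mul1r. Qed.
Fact rquot_1mul : right_id (to_rquot 1) rquot_mul.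
Proof. by move=> x; rewrite -(of_rquotK x) -to_rquotM mulr1. Qed.
Fact rquot_mulDl : left_distributive rquot_mul +%R.
Proof.
move=> x y z; rewrite -(of_rquotK x) -(of_rquotK y) -(of_rquotK z).
by rewrite -to_rquotD -!to_rquotM mulrDl to_rquotD.
Qed.
Fact rquot_mulDr : right_distributive rquot_mul +%R.
Proof.
move=> x y z; rewrite -(of_rquotK x) -(of_rquotK y) -(of_rquotK z).
by rewrite -to_rquotD -!to_rquotM mulrDr to_rquotD.
Qed.
HB.instance Definition _ := GRing.Zmodule_isPzRing.Build rquot
  rquot_mulA rquot_mul1 rquot_1mul rquot_mulDl rquot_mulDr.

HB.instance Definition _ :=
  GRing.isZmodMorphism.Build R rquot to_rquot to_rquotB.
HB.instance Definition _ := GRing.isMonoidMorphism.Build R rquot to_rquot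
  (erefl, to_rquotM).

(* The same projection, between the converse rings. *)
Definition to_rquotc (x : R^c) : rquot^c := to_rquot x.
HB.instance Definition _ :=
  GRing.isZmodMorphism.Build R^c rquot^c to_rquotc to_rquotB.
HB.instance Definition _ := GRing.isMonoidMorphism.Build R^c rquot^c to_rquotc
  (erefl, fun x y => to_rquotM y x).

(* R / R e R as a right, resp. left, R-module. *)
Definition rquot_right : lmodType R^c := restr to_rquotc (rquot^c)^o.
Definition rquot_left : lmodType R := restr to_rquot rquot^o.

(* A right R / R e R-module, regarded as a right R-module. *)
Definition rquot_incl (S : lmodType rquot^c) : lmodType R^c := restr to_rquotc S.

End QuotientByIdempotent.

Section Peirce.
Variables (R : pzRingType) (e : R) (he : e * e = e).
Local Notation E := (corner he).

(* For a right R-module M, the right E-module M e. *)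
Section RightTruncation.
Variable M : lmodType R^c.

Definition trunc_pred : {pred M} := fun x => (e : R^c) *: x == x.

Fact trunc_zmod_closed : zmod_closed trunc_pred.
Proof.
split=> [|x y]; rewrite !unfold_in ?scaler0 //.
by move=> /eqP hx /eqP hy; rewrite scalerBr hx hy.
Qed.

Definition trunc of e * e = e : Type := {x : M | x \in trunc_pred}.
Local Notation Me := (trunc he).
HB.instance Definition _ := GRing.isZmodClosed.Build M trunc_pred
  trunc_zmod_closed.
HB.instance Definition _ := [isSub of Me for @sval _ _].
HB.instance Definition _ := [Choice of Me by <:].
HB.instance Definition _ := [SubChoice_isSubZmodule of Me by <:].

Lemma truncE (x : Me) : (e : R^c) *: val x = val x.
Proof. exact/eqP/(valP x). Qed.

Fact trunc_act_subproof (a : E^c) (x : Me) :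
  (val (a : E) : R^c) *: val x \in trunc_pred.
Proof.
by rewrite unfold_in scalerA -[(e : R^c) * _]/(val (a : E) * e) corner_er.
Qed.
Definition trunc_act (a : E^c) (x : Me) : Me :=
  Sub ((val (a : E) : R^c) *: val x) (trunc_act_subproof a x).

Fact trunc_actA a b x : trunc_act a (trunc_act b x) = trunc_act (a * b) x.
Proof. by apply: val_inj; rewrite !SubK scalerA. Qed.
Fact trunc_act1 : left_id 1 trunc_act.
Proof. by move=> x; apply: val_inj; rewrite !SubK; apply: truncE. Qed.
Fact trunc_actDr : right_distributive trunc_act +%R.
Proof. by move=> a x y; apply: val_inj; rewrite !SubK /= scalerDr. Qed.
Fact trunc_actDl x : {morph trunc_act^~ x : a b / a + b}.
Proof. by move=> a b; apply: val_inj; rewrite !SubK /= scalerDl. Qed.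
HB.instance Definition _ := GRing.Zmodule_isLmodule.Build E^c Me
  trunc_actA trunc_act1 trunc_actDr trunc_actDl.
End RightTruncation.

(* R e as a right E-module, and its left R-action. *)
Definition Re : lmodType E^c := trunc (R^c)^o he.

Lemma Re_e (x : Re) : (val x : R) * e = val x.
Proof. exact: (truncE x). Qed.

Fact Re_act_subproof (a : R) (x : Re) :
  ((a * (val x : R) : R) : (R^c)^o) \in @trunc_pred (R^c)^o.
Proof.
by rewrite unfold_in; apply/eqP; rewrite -[LHS]/(a * (val x : R) * e) -mulrA Re_e.
Qed.
Definition Re_act (a : R) (x : Re) : Re :=
  Sub ((a * (val x : R) : R) : (R^c)^o) (Re_act_subproof a x).

Fact Re_act_linear a : linear (Re_act a).
Proof.
move=> b x y; apply: val_inj; rewrite !SubK.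
rewrite -[LHS]/(a * ((val x : R) * val (b : E) + (val y : R))).
by rewrite mulrDr mulrA.
Qed.
HB.instance Definition _ a := GRing.isLinear.Build _ _ _ _ (Re_act a)
  (Re_act_linear a).

(* Hom_E(R e, V), with (f . a)(x) = f (a x). *)
Section Hom.
Variable V : lmodType E^c.

Definition Hom_Re : Type := {linear Re -> V}.
HB.instance Definition _ := gen_eqMixin Hom_Re.
HB.instance Definition _ := gen_choiceMixin Hom_Re.

Definition hom_app (f : Hom_Re) : {linear Re -> V} := f.

Lemma hom_eqP (f g : Hom_Re) : hom_app f =1 hom_app g -> f = g.
Proof.
case: f g => [f [[f1] [f2]]] [g [[g1] [g2]]] /funext /= efg.
case: f1 f2 g1 g2 => f1 f1' f2 [g1 g1'] g2; move: f1 f1' f2 g1 g1' g2.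
rewrite efg => f1 f1' f2 g1 g1' g2.
by rewrite (Prop_irrelevance f1 g1) (Prop_irrelevance f1' g1') (Prop_irrelevance f2 g2).
Qed.

Definition hom_zero : Hom_Re := \0 : {linear Re -> V}.
Definition hom_add (f g : Hom_Re) : Hom_Re :=
  (hom_app f \+ hom_app g : {linear Re -> V}).
Definition hom_opp (f : Hom_Re) : Hom_Re := (\- hom_app f : {linear Re -> V}).

Fact hom_addA : associative hom_add.
Proof. by move=> f g h; apply: hom_eqP => x /=; rewrite addrA. Qed.
Fact hom_addC : commutative hom_add.
Proof. by move=> f g; apply: hom_eqP => x /=; rewrite addrC. Qed.
Fact hom_add0 : left_id hom_zero hom_add.
Proof. by move=> f; apply: hom_eqP => x /=; rewrite add0r. Qed.
Fact hom_addN : left_inverse hom_zero hom_opp hom_add.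
Proof. by move=> f; apply: hom_eqP => x /=; rewrite addNr. Qed.
HB.instance Definition _ := GRing.isZmodule.Build Hom_Re
  hom_addA hom_addC hom_add0 hom_addN.

Definition hom_act (a : R^c) (f : Hom_Re) : Hom_Re :=
  (hom_app f \o Re_act (a : R) : {linear Re -> V}).

Fact hom_actA a b f : hom_act a (hom_act b f) = hom_act (a * b) f.
Proof.
by apply: hom_eqP => x; congr (hom_app f _); apply: val_inj; rewrite !SubK mulrA.
Qed.
Fact hom_act1 : left_id 1 hom_act.
Proof.
by move=> f; apply: hom_eqP => x; congr (hom_app f _); apply: val_inj;
  rewrite !SubK; apply: (mul1r (val x : R)).
Qed.
Fact hom_actDr : right_distributive hom_act +%R.
Proof. by move=> a f g; apply: hom_eqP. Qed.
Fact hom_actDl f : {morph hom_act^~ f : a b / a + b}.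
Proof.
move=> a b; apply: hom_eqP => x.
rewrite -[RHS]/(hom_app f (Re_act (a : R) x) + hom_app f (Re_act (b : R) x)).
rewrite -raddfD; congr (hom_app f _); apply: val_inj; rewrite !SubK.
exact: (mulrDl (a : R)).
Qed.
HB.instance Definition _ := GRing.Zmodule_isLmodule.Build R^c Hom_Re
  hom_actA hom_act1 hom_actDr hom_actDl.

Lemma hom_appD f g x : hom_app (f + g) x = hom_app f x + hom_app g x.
Proof. by []. Qed.
Lemma hom_appZ (a : R^c) f x : hom_app (a *: f) x = hom_app f (Re_act (a : R) x).
Proof. by []. Qed.
End Hom.

(* The unit M -> Hom_E(R e, M e), which maps m to (x |-> m x). *)
Section Unit.
Variable M : lmodType R^c.
Local Notation Me := (trunc M he).

Fact unit_app_subproof (m : M) (x : Re) :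
  ((val x : R) : R^c) *: m \in @trunc_pred M.
Proof.
by rewrite unfold_in scalerA -[(e : R^c) * _]/((val x : R) * e) Re_e.
Qed.
Definition unit_app (m : M) (x : Re) : Me :=
  Sub (((val x : R) : R^c) *: m) (unit_app_subproof m x).

Fact unit_app_linear m : linear (unit_app m).
Proof.
move=> a x y; apply: val_inj; rewrite !SubK.
rewrite -[RHS]/((val (a : E) : R^c) *: (((val x : R) : R^c) *: m)
                + ((val y : R) : R^c) *: m).
by rewrite scalerA -scalerDl.
Qed.
HB.instance Definition _ m := GRing.isLinear.Build _ _ _ _ (unit_app m)
  (unit_app_linear m).

Definition adj_unit (m : M) : Hom_Re Me := (unit_app m : {linear Re -> Me}).

Fact adj_unit_linear : linear adj_unit.
Proof.
move=> a m n; apply: hom_eqP => x; apply: val_inj.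
rewrite hom_appD hom_appZ.
rewrite -[LHS]/(((val x : R) : R^c) *: (a *: m + n)).
rewrite -[RHS]/((((a : R) * (val x : R) : R) : R^c) *: m
                + ((val x : R) : R^c) *: n).
by rewrite scalerDr scalerA.
Qed.
HB.instance Definition _ := GRing.isLinear.Build _ _ _ _ adj_unit
  adj_unit_linear.

Fact Re_elt_subproof (b : R) : ((b * e : R) : (R^c)^o) \in @trunc_pred (R^c)^o.
Proof. by rewrite unfold_in; apply/eqP; rewrite -[LHS]/(b * e * e) -mulrA he. Qed.
Definition Re_elt (b : R) : Re := Sub ((b * e : R) : (R^c)^o) (Re_elt_subproof b).

Fact corner_elt_subproof (c : R) (x : Re) :
  e * c * (val x : R) \in corner_pred e.
Proof. by rewrite unfold_in -!mulrA Re_e !mulrA he. Qed.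
Definition corner_elt (c : R) (x : Re) : E :=
  Sub (e * c * (val x : R)) (corner_elt_subproof c x).

Lemma hom_act_ReR (b c : R) (f : Hom_Re Me) :
  ((b * e * c : R) : R^c) *: f =
  adj_unit (((e * c : R) : R^c) *: val (hom_app f (Re_elt b))).
Proof.
apply: hom_eqP => x; rewrite hom_appZ.
have -> : Re_act (b * e * c) x = ((corner_elt c x : E) : E^c) *: Re_elt b.
  apply: val_inj; rewrite SubK.
  rewrite -[RHS]/((b * e) * (e * c * (val x : R))).
  by rewrite !mulrA -(mulrA b e e) he.
rewrite linearZ /=; apply: val_inj.
rewrite -[LHS]/(((e * c * (val x : R) : R) : R^c) *: val (hom_app f (Re_elt b))).
by rewrite -[RHS]/(((val x : R) : R^c) *: (_ *: _)) scalerA.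
Qed.

(* The cokernel of the unit; it is a right R-module annihilated by R e R. *)
Definition Y' : lmodType R^c := coker adj_unit.

Lemma Y'_annih (a : R) (y : Y') : a \in ideal_pred e -> (a : R^c) *: y = 0.
Proof.
move=> /ideal_predP[s ->]; elim: s => [|[b c] s IHs].
  by rewrite big_nil scale0r.
rewrite big_cons -[LHS]/((((b * e * c : R) : R^c) + _) *: y) scalerDl IHs addr0.
rewrite -(of_cokerK y) -[LHS]/(coker_act _ _) coker_actE hom_act_ReR.
have -> : 0 = to_coker adj_unit 0 by rewrite /to_coker raddf0.
by apply/to_coker_eq; eexists; rewrite subr0.
Qed.

(* Y' as a right module over R / R e R. *)
Definition Y'_quot : Type := Y'.
Local Notation Q := Y'_quot.
HB.instance Definition _ := GRing.Zmodule.on Q.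

Definition Y'_act (a : (rquot e)^c) (y : Q) : Q :=
  (of_rquot (a : rquot e) : R^c) *: (y : Y').

Lemma Y'_actE (a : R) (y : Y') : Y'_act (to_rquot e a) y = (a : R^c) *: y.
Proof.
apply/eqP; rewrite -subr_eq0; apply/eqP; rewrite /Y'_act.
have /to_rquot_eq h := of_rquotK (to_rquot e a).
by rewrite -[RHS](Y'_annih y h) scalerBl.
Qed.

Fact Y'_actA a b y : Y'_act a (Y'_act b y) = Y'_act (a * b) y.
Proof.
rewrite -(of_rquotK a) -(of_rquotK b); set a' := of_rquot a; set b' := of_rquot b.
transitivity (Y'_act (to_rquot e (b' * a')) y); first by rewrite !Y'_actE scalerA.
by congr Y'_act; apply: (rmorphM (to_rquot e)).
Qed.
Fact Y'_act1 : left_id 1 Y'_act.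
Proof. by move=> y; rewrite -[1]/(to_rquot e 1) Y'_actE scale1r. Qed.
Fact Y'_actDr : right_distributive Y'_act +%R.
Proof. by move=> a x y; rewrite /Y'_act scalerDr. Qed.
Fact Y'_actDl y : {morph Y'_act^~ y : a b / a + b}.
Proof.
move=> a b; rewrite -(of_rquotK a) -(of_rquotK b).
set a' := of_rquot a; set b' := of_rquot b.
transitivity (Y'_act (to_rquot e (a' + b')) y).
  by congr Y'_act; apply/esym/(rmorphD (to_rquot e)).
by rewrite !Y'_actE -scalerDl.
Qed.
HB.instance Definition _ := GRing.Zmodule_isLmodule.Build (rquot e)^c Q
  Y'_actA Y'_act1 Y'_actDr Y'_actDl.
End Unit.

(* e R as a left E-module, and its right R-action. *)
Definition eR_pred : {pred R} := fun x => e * x == x.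

Fact eR_zmod_closed : zmod_closed eR_pred.
Proof.
split=> [|x y]; rewrite !unfold_in ?mulr0 //.
by move=> /eqP hx /eqP hy; rewrite mulrBr hx hy.
Qed.

Definition eR of e * e = e : Type := {x : R | x \in eR_pred}.
Local Notation eRm := (eR he).
HB.instance Definition _ := GRing.isZmodClosed.Build R eR_pred eR_zmod_closed.
HB.instance Definition _ := [isSub of eRm for @sval _ _].
HB.instance Definition _ := [Choice of eRm by <:].
HB.instance Definition _ := [SubChoice_isSubZmodule of eRm by <:].

Lemma eR_e (x : eRm) : e * val x = val x.
Proof. exact/eqP/(valP x). Qed.

Fact eR_lact_subproof (a : E) (x : eRm) : val a * val x \in eR_pred.
Proof. by rewrite unfold_in mulrA corner_el. Qed.
Definition eR_lact (a : E) (x : eRm) : eRm :=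
  Sub (val a * val x) (eR_lact_subproof a x).

Fact eR_lactA a b x : eR_lact a (eR_lact b x) = eR_lact (a * b) x.
Proof. by apply: val_inj; rewrite !SubK mulrA. Qed.
Fact eR_lact1 : left_id 1 eR_lact.
Proof. by move=> x; apply: val_inj; rewrite !SubK eR_e. Qed.
Fact eR_lactDr : right_distributive eR_lact +%R.
Proof. by move=> a x y; apply: val_inj; rewrite !SubK /= mulrDr. Qed.
Fact eR_lactDl x : {morph eR_lact^~ x : a b / a + b}.
Proof. by move=> a b; apply: val_inj; rewrite !SubK /= mulrDl. Qed.
HB.instance Definition _ := GRing.Zmodule_isLmodule.Build E eRm
  eR_lactA eR_lact1 eR_lactDr eR_lactDl.

Fact eR_ract_subproof (x : eRm) (a : R) : val x * a \in eR_pred.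
Proof. by rewrite unfold_in mulrA eR_e. Qed.
Definition eR_ract (x : eRm) (a : R) : eRm :=
  Sub (val x * a) (eR_ract_subproof x a).

Lemma eR_ractDl x y a : eR_ract (x + y) a = eR_ract x a + eR_ract y a.
Proof. by apply: val_inj; rewrite !SubK /= mulrDl. Qed.
Lemma eR_ractDr x a b : eR_ract x (a + b) = eR_ract x a + eR_ract x b.
Proof. by apply: val_inj; rewrite !SubK /= mulrDr. Qed.
Lemma eR_ractA x a b : eR_ract (eR_ract x a) b = eR_ract x (a * b).
Proof. by apply: val_inj; rewrite !SubK mulrA. Qed.
Lemma eR_ract1 x : eR_ract x 1 = x.
Proof. by apply: val_inj; rewrite !SubK mulr1. Qed.
Lemma eR_lractA b x a : eR_ract (b *: x) a = b *: eR_ract x a.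
Proof. by apply: val_inj; rewrite !SubK /= mulrA. Qed.

(* T (x)_E e R.  An element is a formal sum of pure tensors, represented by the
   list of its terms; two formal sums are identified when every E-balanced
   biadditive map takes the same value on both. *)
Section Tensor.
Variable T : lmodType E^c.

Definition balanced (A : zmodType) (beta : T -> eRm -> A) : Prop :=
  [/\ forall t t' u, beta (t + t') u = beta t u + beta t' u,
      forall t u u', beta t (u + u') = beta t u + beta t u'
    & forall t (a : E) u, beta ((a : E^c) *: t) u = beta t (a *: u)].

Definition tens_eval (A : zmodType) (beta : T -> eRm -> A)
    (s : seq (T * eRm)) : A := \sum_(p <- s) beta p.1 p.2.

Definition tens_rel (s s' : seq (T * eRm)) : bool :=
  `[< forall (A : zmodType) (beta : T -> eRm -> A), balanced beta ->
        tens_eval beta s = tens_eval beta s' >].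

Fact tens_rel_equiv : equiv_class_of tens_rel.
Proof.
split=> [s|s s'|s' s s''].
- exact/asboolP.
- by apply/asboolP/asboolP => h A beta /h.
- by move=> /asboolP h /asboolP h'; apply/asboolP => A beta b; rewrite h ?h'.
Qed.
Canonical tens_equiv := EquivRelPack tens_rel_equiv.
Canonical tens_encModRel := defaultEncModRel tens_rel.

Definition tens : Type := {eq_quot tens_rel}.
HB.instance Definition _ := Choice.on tens.

Definition tens_class (s : seq (T * eRm)) : tens := \pi_{eq_quot tens_rel} s.
Definition tens_repr (x : tens) : seq (T * eRm) :=
  repr (x : {eq_quot tens_rel}).

Lemma tens_reprK : cancel tens_repr tens_class.
Proof. exact: reprK. Qed.

Lemma tens_classP s s' : tens_class s = tens_class s' <->
  forall (A : zmodType) (beta : T -> eRm -> A), balanced beta ->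
    tens_eval beta s = tens_eval beta s'.
Proof.
split=> [/eqP|] h; last by apply/eqP; rewrite /tens_class piE; apply/asboolP.
by apply/asboolP; move: h; rewrite /tens_class piE.
Qed.

Definition tens_opp_seq (s : seq (T * eRm)) := [seq (- p.1, p.2) | p <- s].
Definition tens_act_seq (a : R) (s : seq (T * eRm)) :=
  [seq (p.1, eR_ract p.2 a) | p <- s].

Definition tens_zero : tens := tens_class [::].
Definition tens_add (x y : tens) : tens :=
  tens_class (tens_repr x ++ tens_repr y).
Definition tens_opp (x : tens) : tens := tens_class (tens_opp_seq (tens_repr x)).
Definition tens_act (a : R^c) (x : tens) : tens :=
  tens_class (tens_act_seq (a : R) (tens_repr x)).

Lemma tens_eval_nil (A : zmodType) (beta : T -> eRm -> A) : tens_eval beta [::] = 0.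
Proof. exact: big_nil. Qed.

Lemma tens_eval_cat (A : zmodType) (beta : T -> eRm -> A) s s' :
  tens_eval beta (s ++ s') = tens_eval beta s + tens_eval beta s'.
Proof. exact: big_cat. Qed.

Lemma tens_eval_opp (A : zmodType) (beta : T -> eRm -> A) s : balanced beta ->
  tens_eval beta (tens_opp_seq s) = - tens_eval beta s.
Proof.
move=> [bl _ _]; rewrite /tens_eval big_map -sumrN; apply: eq_bigr => p _ /=.
apply/eqP; rewrite -addr_eq0 -bl addNr; apply/eqP.
by apply: (addrI (beta 0 p.2)); rewrite -bl !addr0.
Qed.

Lemma tens_eval_act (A : zmodType) (beta : T -> eRm -> A) a s :
  tens_eval beta (tens_act_seq a s) =
  tens_eval (fun t u => beta t (eR_ract u a)) s.
Proof. by rewrite /tens_eval big_map. Qed.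

Lemma balanced_ract (A : zmodType) (beta : T -> eRm -> A) a : balanced beta ->
  balanced (fun t u => beta t (eR_ract u a)).
Proof.
move=> [bl br bm]; split=> [t t' u|t u u'|t b u].
- by rewrite bl.
- by rewrite eR_ractDl br.
- by rewrite bm eR_lractA.
Qed.

Lemma tens_eval_repr (A : zmodType) (beta : T -> eRm -> A) s : balanced beta ->
  tens_eval beta (tens_repr (tens_class s)) = tens_eval beta s.
Proof. by have /tens_classP := tens_reprK (tens_class s); apply. Qed.

Lemma tens_ext (x y : tens) :
  (forall (A : zmodType) (beta : T -> eRm -> A), balanced beta ->
    tens_eval beta (tens_repr x) = tens_eval beta (tens_repr y)) -> x = y.
Proof.
by move=> h; rewrite -(tens_reprK x) -(tens_reprK y); apply/tens_classP.
Qed.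

Fact tens_addA : associative tens_add.
Proof.
move=> x y z; apply: tens_ext => A beta b.
by rewrite !(tens_eval_repr _ b, tens_eval_cat) addrA.
Qed.
Fact tens_addC : commutative tens_add.
Proof.
move=> x y; apply: tens_ext => A beta b.
by rewrite !(tens_eval_repr _ b, tens_eval_cat) addrC.
Qed.
Fact tens_add0 : left_id tens_zero tens_add.
Proof.
move=> x; apply: tens_ext => A beta b.
by rewrite !(tens_eval_repr _ b, tens_eval_cat) tens_eval_nil add0r.
Qed.
Fact tens_addN : left_inverse tens_zero tens_opp tens_add.
Proof.
move=> x; apply: tens_ext => A beta b.
rewrite !(tens_eval_repr _ b, tens_eval_cat) tens_eval_nil.
by rewrite tens_eval_opp // addNr.
Qed.
HB.instance Definition _ := GRing.isZmodule.Build tens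
  tens_addA tens_addC tens_add0 tens_addN.

Lemma tens_eval_reprD (A : zmodType) (beta : T -> eRm -> A) (x y : tens) :
  balanced beta -> tens_eval beta (tens_repr (x + y)) =
  tens_eval beta (tens_repr x) + tens_eval beta (tens_repr y).
Proof. by move=> b; rewrite [x + y]/(tens_add x y) tens_eval_repr // tens_eval_cat. Qed.

Lemma tens_eval_reprZ (A : zmodType) (beta : T -> eRm -> A) a (x : tens) :
  balanced beta -> tens_eval beta (tens_repr (tens_act a x)) =
  tens_eval (fun t u => beta t (eR_ract u a)) (tens_repr x).
Proof. by move=> b; rewrite tens_eval_repr // tens_eval_act. Qed.

Fact tens_actA a b x : tens_act a (tens_act b x) = tens_act (a * b) x.
Proof.
apply: tens_ext => A beta bb; have ba := balanced_ract a bb.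
rewrite !tens_eval_reprZ //; apply: eq_bigr => p _.
by rewrite eR_ractA.
Qed.
Fact tens_act1 : left_id 1 tens_act.
Proof.
move=> x; apply: tens_ext => A beta b; rewrite tens_eval_reprZ //.
by apply: eq_bigr => p _; rewrite eR_ract1.
Qed.
Fact tens_actDr : right_distributive tens_act +%R.
Proof.
move=> a x y; apply: tens_ext => A beta b; have ba := balanced_ract a b.
by rewrite !(tens_eval_reprZ, tens_eval_reprD).
Qed.
Fact tens_actDl x : {morph tens_act^~ x : a b / a + b}.
Proof.
move=> a c; apply: tens_ext => A beta b.
rewrite !(tens_eval_reprZ, tens_eval_reprD) // -big_split.
by case: b => _ br _; apply: eq_bigr => p _ /=; rewrite eR_ractDr br.
Qed.
HB.instance Definition _ := GRing.Zmodule_isLmodule.Build R^c tens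
  tens_actA tens_act1 tens_actDr tens_actDl.
End Tensor.

(* If e <> 0 then Ll is at least 1, since T (x)_E e R restricts to T; hence no
   truncation takes place in Ll * (v + 1) - 1.  If e = 0 then E = 0 and Ll = 0. *)
Definition Ll : enat :=
  esup (fun v => exists2 T : lmodType E^c, simple_mod T & v = comp_length (tens T)).
Definition Lr : enat :=
  esup (fun v => exists2 S : lmodType R^c, simple_mod S & v = comp_length (Y'_quot S)).

Definition Re_dual : lmodType R^c := Hom_Re (E^c)^o.

End Peirce.

(* Main.v *)
(* Call U a stable retract of V when it is a retract of V up to a projective
   summand; syzygies preserve this relation, so every statement about syzygies
   is independent of the chosen covers.  A derived delooping level at most m
   unfolds recursively: either the k-delooping level of X is at most m, or there
   is an exact sequence 0 -> D -> C -> X -> 0 in which C has k-delooping level at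
   most m and D has (k+1)-derived delooping level at most m - 1.  By induction on
   this recursion, an exact sequence 0 -> A -> B -> C -> 0 gives
   ddell B <= ddell A + ddell C + 1 and ddell A <= ddell B + ddell C + 1, and an
   exact functor F with pd F(R) <= p gives ddell F(X) <= p + ddell X.

   (a) Truncate T (x)_E eR, whose length is at most Ll.  (b) The ideal ReR is
   generated by an idempotent 1 - u as a left ideal, so reduction modulo ReR is
   truncation by u.  (c) A simple S either is a module over the quotient or embeds
   in Hom_E(Re, Se) with cokernel Y', of length at most Lr.  (d) All modules over
   the quotient have projective dimension at most 1 over R, so ReR is projective
   on the right, which makes Re projective over E, and Hom_E(Re, E) has projective
   dimension at most 2. *)

Require Import Defs.
From HB Require Import structures.
From mathcomp Require Import all_boot all_order all_algebra all_field.
From mathcomp Require Import boolp zify.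

Set Implicit Arguments.
Unset Strict Implicit.
Unset Printing Implicit Defensive.

Import GRing.Theory.
Local Open Scope ring_scope.

(** The mechanism behind the two inequalities for exact sequences is that a syzygy raises the index
    at no cost: the (k+1)-level of [Omega X] is at most the k-level of [X]. The kernel term of the
    recursion must carry index k+1, so when a sequence is rotated and a module gives way to its
    syzygy, that syzygy already fits the next place of a resolution. Moving one place along is the
    [+ 1] of both inequalities. Hence n >= 1 composition factors of level at most D give n(D + 1) -
    1, the shape of the bounds; in (c) the embedding of S costs one more unit, which cancels the -
    1. An exact functor F need not preserve projectives. If F(R) has projective dimension at most p,
    the images of projectives become projective after p further syzygies, and from there on F
    commutes stably with syzygies; this is where the summand p comes from. In (d) the cokernel Y'
    has projective dimension at most 1 whatever its length, and Hom_E(Re, E) contributes 2, so S has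
    level at most m + 2 + 1 + 1 = m + 4, where m is the level of E. A nonzero Y' forces L_r >= 1, so
    this is below m + 2 L_r + 3. *)

Lemma einf_le (P : nat -> Prop) m :
  (einf P <= Some m)%enat <-> exists2 n, P n & (n <= m)%N.
Proof.
rewrite /einf; case: pselect => [exP|nP] /=; last first.
  by split=> // -[n Pn _]; case: nP; exists n; apply/asboolP.
case: ex_minnP => n /asboolP Pn min_n; split=> [le_nm|[i Pi le_im]].
  by exists n.
by apply: leq_trans le_im; apply: min_n; apply/asboolP.
Qed.

Lemma einfP (P : nat -> Prop) n : einf P = Some n -> P n.
Proof. by rewrite /einf; case: pselect => // ?; case: ex_minnP => ? /asboolP ? _ [<-]. Qed.

Lemma ele_trans x y z : (x <= y)%enat -> (y <= z)%enat -> (x <= z)%enat.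
Proof. by case: x y z => [x|] [y|] [z|] //=; apply: leq_trans. Qed.

Lemma esup_le (A : enat -> Prop) m :
  (esup A <= Some m)%enat <-> forall v, A v -> (v <= Some m)%enat.
Proof.
rewrite /esup einf_le; split=> [[n An le_nm] v /An le_vn|Am]; last by exists m.
exact: ele_trans le_vn _.
Qed.

Lemma esup_ub (A : enat -> Prop) m v :
  esup A = Some m -> A v -> exists2 n, v = Some n & (n <= m)%N.
Proof. by move=> /einfP + Av => /(_ v Av); case: v Av => // n _; exists n. Qed.

(** * Submodules, kernels and lifting of linear maps *)

Section Modules.
Variable R : pzRingType.
Implicit Types A B C D M N P Q U V W X Y Z : lmodType R.

Section MkLinear.
Variables (M N : lmodType R) (f : M -> N) (lin_f : linear f).

Let fun_of : M -> N := f.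
HB.instance Definition _ := GRing.isLinear.Build R M N *:%R fun_of lin_f.

(** Maps produced inside proofs, by choice or by a formula, are bundled through this existence
    statement, so that none of them needs a structure instance of its own. *)
Lemma linear_ex : exists g : {linear M -> N}, g =1 f.
Proof. by exists fun_of. Qed.

End MkLinear.

Section Submodule.
Variables (M : lmodType R) (S : {pred M}) (clS : submod_closed S).

(** The closure proof is a phantom argument, which lets the structure instances be attached to an
    arbitrary predicate. *)
Definition submod_pred of submod_closed S : {pred M} := S.

Fact submod_zmod_closed : zmod_closed (submod_pred clS).
Proof.
split=> [|x y Sx Sy]; first exact: clS.1.
by rewrite addrC -scaleN1r; apply: clS.2.
Qed.
HB.instance Definition _ :=
  GRing.isZmodClosed.Build M (submod_pred clS) submod_zmod_closed.

Definition submod : Type := {x : M | x \in submod_pred clS}.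
HB.instance Definition _ := [isSub of submod for @sval _ _].
HB.instance Definition _ := [Choice of submod by <:].
HB.instance Definition _ := [SubChoice_isSubZmodule of submod by <:].

Fact submodZ_subproof (a : R) (x : submod) : a *: val x \in submod_pred clS.
Proof. by rewrite -[_ *: _]addr0; apply: clS.2; [apply: valP | apply: clS.1]. Qed.
Definition submod_scale (a : R) (x : submod) : submod :=
  Sub (a *: val x) (submodZ_subproof a x).

Fact submod_scaleA a b x : submod_scale a (submod_scale b x) = submod_scale (a * b) x.
Proof. by apply: val_inj; rewrite !SubK scalerA. Qed.
Fact submod_scale1 : left_id 1 submod_scale.
Proof. by move=> x; apply: val_inj; rewrite !SubK scale1r. Qed.
Fact submod_scaleDr : right_distributive submod_scale +%R.
Proof. by move=> a x y; apply: val_inj; rewrite !SubK /= scalerDr. Qed.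
Fact submod_scaleDl x : {morph submod_scale^~ x : a b / a + b}.
Proof. by move=> a b; apply: val_inj; rewrite !SubK /= scalerDl. Qed.
HB.instance Definition _ := GRing.Zmodule_isLmodule.Build R submod
  submod_scaleA submod_scale1 submod_scaleDr submod_scaleDl.

Definition submod_val (x : submod) : M := val x.

Fact submod_val_linear : linear submod_val.
Proof. by []. Qed.
HB.instance Definition _ := GRing.isLinear.Build R submod M *:%R submod_val
  submod_val_linear.

Lemma submod_val_inj : injective submod_val.
Proof. exact: val_inj. Qed.

Lemma submod_valP x : submod_val x \in S.
Proof. exact: (valP x). Qed.

Lemma submod_valE y : y \in S -> exists x, submod_val x = y.
Proof. by move=> Sy; exists (Sub y Sy : submod). Qed.

End Submodule.

(** [short_exact] hides its maps behind existentials; naming them is necessary for functors to act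
    on them. *)
Definition exact3 Z P X (f : {linear Z -> P}) (g : {linear P -> X}) : Prop :=
  [/\ injective f, surj g & forall x, g x = 0 <-> exists z, f z = x].

Section Kernel.
Variables (M N : lmodType R) (g : {linear M -> N}).

Definition ker_pred : {pred M} := fun x => g x == 0.

Fact ker_submod_closed : submod_closed ker_pred.
Proof.
split; first by rewrite unfold_in linear0.
move=> a x y; rewrite !unfold_in => /eqP gx /eqP gy.
by rewrite linearP gx gy scaler0 addr0.
Qed.

Definition kermod : lmodType R := submod ker_submod_closed.
Definition ker_val : {linear kermod -> M} :=
  @submod_val _ _ ker_submod_closed.

Lemma ker_valP x : g (ker_val x) = 0.
Proof. exact/eqP/(submod_valP x). Qed.

Lemma ker_exact : surj g -> exact3 ker_val g.
Proof.
move=> g_surj; split=> // [|x]; first exact: submod_val_inj.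
split=> [gx0|[z <-]]; last exact: ker_valP.
by apply: submod_valE; rewrite unfold_in gx0.
Qed.

End Kernel.

(** Preimages under an injective map are unique, so the chosen ones depend linearly on [w]. Every
    factorization through a kernel below comes from here. *)
Lemma lift_inj Z P W (f : {linear Z -> P}) (h : {linear W -> P}) :
  injective f -> (forall w, exists z, f z = h w) ->
  exists h' : {linear W -> Z}, forall w, f (h' w) = h w.
Proof.
move=> f_inj fh; have [h' h'E] := choice fh.
have lin_h' : linear h'.
  by move=> a x y; apply: f_inj; rewrite h'E !linearP !h'E.
by have [k kE] := linear_ex lin_h'; exists k => w; rewrite kE.
Qed.

Lemma iso_inv X Y (f : {linear X -> Y}) : injective f -> surj f ->
  exists g : {linear Y -> X}, cancel f g /\ cancel g f.
Proof.
move=> f_inj f_surj; have [g gE] := @lift_inj _ _ _ f idfun f_inj f_surj.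
by exists g; split=> x; [apply: f_inj|]; rewrite gE.
Qed.

(** * Finite generation *)

Lemma fingen_fin M (I : finType) (g : I -> M) :
  (forall x, exists c : I -> R, x = \sum_i c i *: g i) -> fingen M.
Proof.
move=> genM; exists #|I|, (g \o enum_val) => x; have [c ->] := genM x.
exists (c \o enum_val).
by rewrite (reindex _ (onW_bij _ (@enum_val_bij I))).
Qed.

Lemma fingen_surj M N (f : {linear M -> N}) : surj f -> fingen M -> fingen N.
Proof.
move=> f_surj [n [g genM]]; exists n, (f \o g) => y.
have [x <-] := f_surj y; have [c ->] := genM x; exists c.
by rewrite linear_sum; apply: eq_bigr => i _; rewrite linearZ.
Qed.

Lemma fingen_ext Z P X : short_exact Z P X -> fingen Z -> fingen X -> fingen P.
Proof.
move=> [f [g [f_inj g_surj fg]]] [m [u genZ]] [n [v genX]].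
have [s sE] := choice g_surj.
apply: (@fingen_fin P ('I_m + 'I_n)%type
  (fun i => match i with inl i => f (u i) | inr j => s (v j) end)) => x.
have [c gx] := genX (g x).
have /fg[z fz] : g (x - \sum_j c j *: s (v j)) = 0.
  rewrite linearB linear_sum gx -sumrB big1 // => j _.
  by rewrite linearZ sE subrr.
have [b zE] := genZ z.
exists (fun i => match i with inl i => b i | inr j => c j end).
rewrite big_sumType /= -[LHS](subrK (\sum_j c j *: s (v j))) -fz zE linear_sum.
by congr (_ + _); apply: eq_bigr => i _; rewrite linearZ.
Qed.

Section Product.
Variables (M N : lmodType R).

Definition inl_lin (x : M) : (M * N)%type := (x, 0).
Definition inr_lin (y : N) : (M * N)%type := (0, y).

Fact inl_lin_linear : linear inl_lin.
Proof.
by move=> a x y; apply/pair_equal_spec; split=> //=; rewrite scaler0 addr0.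
Qed.
Fact inr_lin_linear : linear inr_lin.
Proof.
by move=> a x y; apply/pair_equal_spec; split=> //=; rewrite scaler0 addr0.
Qed.
HB.instance Definition _ :=
  GRing.isLinear.Build R M (M * N)%type *:%R inl_lin inl_lin_linear.
HB.instance Definition _ :=
  GRing.isLinear.Build R N (M * N)%type *:%R inr_lin inr_lin_linear.

Lemma prod_exact3 :
  exact3 (inl_lin : {linear M -> (M * N)%type}) (snd : {linear (M * N)%type -> N}).
Proof.
split=> [x y /(congr1 fst) //|y|[x y]]; first by exists (0, y).
by split=> [/= ->|[z /(congr1 snd) /= <-]]; first by exists x.
Qed.

Lemma inlrE (x : M) (y : N) : (x, y) = inl_lin x + inr_lin y.
Proof. by apply/pair_equal_spec; split; rewrite /= ?addr0 ?add0r. Qed.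

End Product.

Lemma fingen_prod M N : fingen M -> fingen N -> fingen (M * N)%type.
Proof. by apply: fingen_ext; do 2!eexists; apply: prod_exact3. Qed.

(** * Projective modules *)

Definition free_mod n : lmodType R := {ffun 'I_n -> R^o}.

Lemma free_fingen n : fingen (free_mod n).
Proof.
exists n, (fun i => [ffun j => (i == j)%:R]) => x; exists x.
apply/ffunP => j; rewrite sum_ffunE (bigD1 j) //= big1 ?addr0.
  by rewrite !ffunE eqxx; rewrite -[RHS]/(x j * 1) mulr1.
by move=> i /negPf ij; rewrite !ffunE ij; apply: mulr0.
Qed.

(** Half of the dual basis lemma: the lift sends [x] to the combination, with coefficients [a i x],
    of chosen preimages of [f (w i)]. Free modules and, in part (d), [Re he] are shown projective
    this way. *)
Lemma dual_basis_projective P n (w : 'I_n -> P) (a : 'I_n -> {linear P -> R^o}) :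
  (forall x, x = \sum_i (a i x : R) *: w i) -> projective P.
Proof.
move=> xE M N g f g_surj.
have [m mE] := choice (fun i => g_surj (f (w i))).
have lin_h : linear (fun x => \sum_i (a i x : R) *: m i).
  move=> c x y; rewrite scaler_sumr -big_split; apply: eq_bigr => i _.
  by rewrite linearP scalerDl scalerA.
have [h hE] := linear_ex lin_h; exists h => x.
rewrite hE [in RHS](xE x) !linear_sum; apply: eq_bigr => i _.
by rewrite !linearZ mE.
Qed.

Lemma free_projective n : projective (free_mod n).
Proof.
have lin_a i : linear (fun x : free_mod n => x i).
  by move=> a x y; rewrite !ffunE.
have [a aE] := choice (fun i => @linear_ex _ R^o _ (lin_a i)).
apply: (@dual_basis_projective (free_mod n) n
  (fun i => [ffun j => (i == j)%:R] : free_mod n) a) => x.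
apply/ffunP => j; rewrite sum_ffunE (bigD1 j) //= big1 ?addr0.
  by rewrite !ffunE eqxx aE; rewrite -[RHS]/(x j * 1) mulr1.
by move=> i /negPf ij; rewrite !ffunE ij; apply: mulr0.
Qed.

Lemma free_map M n (w : 'I_n -> M) : exists g : {linear free_mod n -> M},
  forall c, g c = \sum_i (c i : R) *: w i.
Proof.
apply: linear_ex => c x y; rewrite scaler_sumr -big_split.
by apply: eq_bigr => i _; rewrite !ffunE scalerDl scalerA.
Qed.

Lemma free_map_surj M n (w : 'I_n -> M) (g : {linear free_mod n -> M}) :
  (forall c, g c = \sum_i (c i : R) *: w i) ->
  (forall x, exists c : 'I_n -> R, x = \sum_i c i *: w i) -> surj g.
Proof.
move=> gE genM x; have [c ->] := genM x; exists [ffun i => c i]; rewrite gE.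
by apply: eq_bigr => i _; rewrite ffunE.
Qed.

Lemma free_cover M : fingen M ->
  exists n (g : {linear free_mod n -> M}), surj g.
Proof.
move=> [n [w genM]]; have [g gE] := free_map w.
by exists n, g; apply: free_map_surj gE genM.
Qed.

(** The other half: the functionals are the coordinates of a section of the free cover given by
    [w]. *)
Lemma projective_dual_basis P n (w : 'I_n -> P) :
  projective P -> (forall x, exists c : 'I_n -> R, x = \sum_i c i *: w i) ->
  exists a : 'I_n -> {linear P -> R^o}, forall x, x = \sum_i (a i x : R) *: w i.
Proof.
move=> P_proj genP; have [g gE] := free_map w.
have [s sE] := P_proj _ _ g idfun (free_map_surj gE genP).
have lin_a i : linear (fun x => s x i : R^o) by move=> a x y; rewrite linearP !ffunE.
have [a aE] := choice (fun i => linear_ex (lin_a i)); exists a => x.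
by rewrite -[LHS]sE gE; apply: eq_bigr => i _; rewrite aE.
Qed.

Lemma regular_fingen : fingen (R^o : lmodType R).
Proof.
exists 1%N, (fun=> 1) => x; exists (fun=> x).
by rewrite big_ord1; rewrite -[RHS]/(x * 1) mulr1.
Qed.

Lemma regular_projective : projective (R^o : lmodType R).
Proof.
apply: (@dual_basis_projective R^o 1 (fun=> 1) (fun=> idfun)) => x.
by rewrite big_ord1 /=; rewrite -[RHS]/(x * 1) mulr1.
Qed.

Lemma projective_retract P Q (f : {linear P -> Q}) (g : {linear Q -> P}) :
  cancel f g -> projective Q -> projective P.
Proof.
move=> fK Q_proj M N p h p_surj.
have [k kE] := Q_proj _ _ p (h \o g) p_surj.
by exists (k \o f) => x /=; rewrite kE /= fK.
Qed.

Lemma projective_prod P Q :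
  projective P -> projective Q -> projective (P * Q)%type.
Proof.
move=> P_proj Q_proj M N p h p_surj.
have [k kE] := P_proj _ _ p (h \o @inl_lin P Q) p_surj.
have [l lE] := Q_proj _ _ p (h \o @inr_lin P Q) p_surj.
have lin_m : linear (fun x : (P * Q)%type => k x.1 + l x.2).
  by move=> a x y; rewrite !linearP addrACA scalerDr.
have [m mE] := linear_ex lin_m; exists m => -[x y].
by rewrite mE linearD kE lE /= -linearD -inlrE.
Qed.

End Modules.

(** * Syzygies and the stable category *)

Section Stable.
Variable R : pzRingType.
Implicit Types A B C D M N P Q U V W X Y Z : lmodType R.

Lemma short_exact_iso Z P X Y (h : {linear X -> Y}) :
  injective h -> surj h -> short_exact Z P X -> short_exact Z P Y.
Proof.
move=> h_inj h_surj [f [g [f_inj g_surj fg]]]; exists f, (h \o g); split=> //.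
  by move=> y; have [x <-] := h_surj y; have [p <-] := g_surj x; exists p.
move=> x /=; rewrite -fg; split=> [hgx|->]; last exact: linear0.
by apply: h_inj; rewrite hgx linear0.
Qed.

Lemma sretract_split U V (f : {linear U -> V}) (g : {linear V -> U}) :
  cancel f g -> stable_retract U V.
Proof.
move=> fK; exists f, g, (free_mod R 0), \0, \0; split.
- exact: free_fingen.
- exact: free_projective.
- by move=> x /=; rewrite fK subrr.
Qed.

Lemma sretract_refl U : stable_retract U U.
Proof. exact: (@sretract_split _ _ idfun idfun). Qed.

(** [1 - g g' f' f = (1 - g f) + g (1 - g' f') f], and the two summands factor together through
    [P * P']. *)
Lemma sretract_trans U V W :
  stable_retract U V -> stable_retract V W -> stable_retract U W.
Proof.
move=> [f [g [P [a [b [P_fg P_proj fgE]]]]]] [f' [g' [P' [a' [b' [P'_fg P'_proj f'g'E]]]]]].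
have lin_c : linear (fun x => (a x, a' (f x))) by move=> c x y; rewrite !linearP.
have lin_d : linear (fun x : (P * P')%type => b x.1 + g (b' x.2)).
  by move=> c x y; rewrite !linearP scalerDr addrACA.
have [c cE] := @linear_ex _ U (P * P')%type _ lin_c.
have [d dE] := linear_ex lin_d.
exists (f' \o f), (g \o g'), (P * P')%type, c, d; split.
- exact: fingen_prod.
- exact: projective_prod.
- move=> x; rewrite dE cE /= -fgE -f'g'E linearB /=.
  by rewrite addrA subrK.
Qed.

Lemma sretract_prodP U P : fingen P -> projective P -> stable_retract (U * P)%type U.
Proof.
move=> P_fg P_proj.
exists fst, (@inl_lin _ U P), P, snd, (@inr_lin _ U P); split=> // -[x y].
by rewrite /= [(x, y)]inlrE addrAC subrr add0r.
Qed.

Lemma sretract_Uprod U V : stable_retract U (U * V)%type.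
Proof. exact: (@sretract_split _ _ (@inl_lin _ U V) fst). Qed.

(** The maps [(f, a)] and [g + b] split [U] off [V * P] on the nose. *)
Lemma sretract_projective U V :
  stable_retract U V -> projective V -> projective U.
Proof.
move=> [f [g [P [a [b [P_fg P_proj fgE]]]]]] V_proj.
have lin_c : linear (fun x => (f x, a x)) by move=> c x y; rewrite !linearP.
have lin_d : linear (fun x : (V * P)%type => g x.1 + b x.2).
  by move=> c x y; rewrite !linearP scalerDr addrACA.
have [c cE] := @linear_ex _ U (V * P)%type _ lin_c.
have [d dE] := linear_ex lin_d.
apply: (@projective_retract _ _ _ c d); last exact: projective_prod.
by move=> x; rewrite dE cE /= -fgE addrC subrK.
Qed.

Lemma projective_sretract U V : fingen U -> projective U -> stable_retract U V.
Proof.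
move=> U_fg U_proj; exists \0, \0, U, idfun, idfun; split=> // x.
by rewrite /= subr0.
Qed.

Definition syzygy1 X Z : Prop :=
  exists P, [/\ fingen P, projective P & short_exact Z P X].

Lemma is_syzygyS n X U :
  is_syzygy n.+1 X U <-> exists2 Z, syzygy1 X Z & is_syzygy n Z U.
Proof.
split=> [[P [Z [P_fg P_proj ex UZ]]]|[Z [P [P_fg P_proj ex]] UZ]].
  by exists Z => //; exists P.
by exists P, Z.
Qed.

Lemma is_syzygy0 X : is_syzygy 0 X X.
Proof. by exists idfun; exists id. Qed.

Lemma is_syzygy1 X Z : syzygy1 X Z -> is_syzygy 1 X Z.
Proof. by move=> ZX; apply/is_syzygyS; exists Z => //; apply: is_syzygy0. Qed.

(** [is_syzygy] peels off the cover of [X] first; here a cover is appended at the far end, and the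
    isomorphism closing the recursion is absorbed into it. *)
Lemma is_syzygy_rcons n X U W :
  is_syzygy n X U -> syzygy1 U W -> is_syzygy n.+1 X W.
Proof.
elim: n X => [|n IHn] X; last first.
  move=> /is_syzygyS[Z XZ /IHn h] /h WZ.
  by apply/is_syzygyS; exists Z.
move=> [f [g fK gK]] [P [P_fg P_proj ex]].
apply/is_syzygyS; exists W; last exact: is_syzygy0.
exists P; split=> //.
have [|u|h [fhK hfK]] := @iso_inv _ _ _ f; first exact: can_inj fK.
  by exists (g u); rewrite gK.
by apply: (@short_exact_iso _ _ _ _ h) ex; [apply: can_inj hfK | move=> x; exists (f x)].
Qed.

Lemma is_syzygy_cat n m X U W :
  is_syzygy n X U -> is_syzygy m U W -> is_syzygy (n + m) X W.
Proof.
elim: m n U => [|m IHm] n U XU; last first.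
  move=> /is_syzygyS[Z UZ ZW]; rewrite addnS -addSn.
  exact: IHm (is_syzygy_rcons XU UZ) ZW.
rewrite addn0; elim: n X XU => [|n IHn] X.
  move=> [f f_bij] [g g_bij]; exists (g \o f); exact: bij_comp.
by move=> /is_syzygyS[Z XZ ZU] UW; apply/is_syzygyS; exists Z => //; apply: IHn.
Qed.

Lemma is_syzygy_split n m X W :
  is_syzygy (n + m) X W -> exists2 U, is_syzygy n X U & is_syzygy m U W.
Proof.
elim: n X => [|n IHn] X; first by exists X => //; apply: is_syzygy0.
move=> /is_syzygyS[Z XZ /IHn[U ZU UW]]; exists U => //.
by apply/is_syzygyS; exists Z.
Qed.

(* The stable syzygy functor on a retraction: [f] and [g] lift to the
   projective covers, and [1 - g f - b a], being zero after the cover,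
   factors through the syzygy. *)
Lemma sretract_syzygy1 U V Z W :
  stable_retract U V -> syzygy1 U Z -> syzygy1 V W -> stable_retract Z W.
Proof.
move=> [f [g [P0 [a [b [P0_fg P0_proj fgE]]]]]].
move=> [P [P_fg P_proj [i [p [i_inj p_surj ip]]]]].
move=> [Q [Q_fg Q_proj [j [q [j_inj q_surj jq]]]]].
have [F FE] := P_proj _ _ q (f \o p) q_surj.
have [G GE] := Q_proj _ _ p (g \o q) p_surj.
have [B BE] := P0_proj _ _ p b p_surj.
have pi0 z : p (i z) = 0 by apply/ip; exists z.
have qj0 w : q (j w) = 0 by apply/jq; exists w.
have [F' F'E] := @lift_inj _ _ _ _ j (F \o i) j_inj
  (fun z => (jq (F (i z))).1 (etrans (FE (i z)) (etrans (congr1 f (pi0 z)) (linear0 f)))).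
have [G' G'E] := @lift_inj _ _ _ _ i (G \o j) i_inj
  (fun w => (ip (G (j w))).1 (etrans (GE (j w)) (etrans (congr1 g (qj0 w)) (linear0 g)))).
pose H : {linear P -> P} := (idfun \- (G \o F)) \- (B \o (a \o p)).
have HE x : H x = x - G (F x) - B (a (p x)) by [].
have [H' H'E] : exists H' : {linear P -> Z}, forall x, i (H' x) = H x.
  apply: lift_inj => // x; apply/ip.
  by rewrite HE !linearB GE /= FE BE /= -fgE subrr.
exists F', G', P, i, H'; split=> // z; apply: i_inj.
by rewrite H'E HE pi0 !linear0 addr0 linearB G'E /= F'E.
Qed.

Lemma sretract_syzygy n X Y U V : stable_retract X Y ->
  is_syzygy n X U -> is_syzygy n Y V -> stable_retract U V.
Proof.
elim: n X Y => [|n IHn] X Y XY; last first.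
  move=> /is_syzygyS[Z XZ ZU] /is_syzygyS[W YW WV].
  exact: IHn (sretract_syzygy1 XY XZ YW) ZU WV.
have isoP A B : is_syzygy 0 A B -> stable_retract A B /\ stable_retract B A.
  move=> [f [g fK gK]]; have [|b|h [fhK hfK]] := @iso_inv _ _ _ f.
  - exact: can_inj fK.
  - by exists (g b); rewrite gK.
  - by split; [apply: sretract_split fhK | apply: sretract_split hfK].
move=> /isoP[_ UX] /isoP[YV _].
exact: sretract_trans UX (sretract_trans XY YV).
Qed.

Lemma is_syzygy_uniq n X U V :
  is_syzygy n X U -> is_syzygy n X V -> stable_retract U V.
Proof. exact/sretract_syzygy/sretract_refl. Qed.

Lemma syzygy1_prod X Y U V : syzygy1 X U -> syzygy1 Y V ->
  syzygy1 (X * Y)%type (U * V)%type.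
Proof.
move=> [P [P_fg P_proj [i [p [i_inj p_surj ip]]]]].
move=> [Q [Q_fg Q_proj [j [q [j_inj q_surj jq]]]]].
exists (P * Q)%type; split; [exact: fingen_prod|exact: projective_prod|].
have lin_k : linear (fun x : (U * V)%type => (i x.1, j x.2)).
  by move=> c x y; rewrite !linearP.
have lin_r : linear (fun x : (P * Q)%type => (p x.1, q x.2)).
  by move=> c x y; rewrite !linearP.
have [k kE] := @linear_ex _ _ (P * Q)%type _ lin_k.
have [r rE] := @linear_ex _ _ (X * Y)%type _ lin_r.
exists k, r; split.
- by move=> [x y] [x' y']; rewrite !kE => -[/i_inj-> /j_inj->].
- move=> [x y]; have [x' <-] := p_surj x; have [y' <-] := q_surj y.
  by exists (x', y'); rewrite rE.
- move=> [x y]; rewrite rE /=; split.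
    move=> [/ip[u <-] /jq[v <-]]; by exists (u, v); rewrite kE.
  move=> [[u v]]; rewrite kE => -[<- <-].
  by congr (_, _); [apply/ip; exists u | apply/jq; exists v].
Qed.

Lemma is_syzygy_prod n X Y U V : is_syzygy n X U -> is_syzygy n Y V ->
  is_syzygy n (X * Y)%type (U * V)%type.
Proof.
elim: n X Y => [|n IHn] X Y; last first.
  move=> /is_syzygyS[Z XZ ZU] /is_syzygyS[W YW WV].
  apply/is_syzygyS; exists (Z * W)%type; first exact: syzygy1_prod.
  exact: IHn.
move=> [f [f' fK f'K]] [g [g' gK g'K]].
have lin_k : linear (fun x : (X * Y)%type => (f x.1, g x.2)).
  by move=> c x y; rewrite !linearP.
have [k kE] := @linear_ex _ _ (U * V)%type _ lin_k.
exists k; exists (fun x => (f' x.1, g' x.2)) => -[x y]; rewrite kE /=.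
  by rewrite fK gK.
by rewrite f'K g'K.
Qed.

(** The cover of [B] is [P * Q], acting by [f p] on [P] and by a lift [h] of the cover of [C] on
    [Q]; [B'] is its kernel. *)
Lemma horseshoe A B C A' C' :
  short_exact A B C -> syzygy1 A A' -> syzygy1 C C' ->
  exists2 B', syzygy1 B B' & short_exact A' B' C'.
Proof.
move=> [f [g [f_inj g_surj fg]]].
move=> [P [P_fg P_proj [i [p [i_inj p_surj ip]]]]].
move=> [Q [Q_fg Q_proj [j [q [j_inj q_surj jq]]]]].
have [h hE] := Q_proj _ _ g q g_surj.
have gf0 a : g (f a) = 0 by apply/fg; exists a.
have qj0 w : q (j w) = 0 by apply/jq; exists w.
have pi0 w : p (i w) = 0 by apply/ip; exists w.
have lin_r : linear (fun x : (P * Q)%type => f (p x.1) + h x.2).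
  by move=> c x y; rewrite !linearP scalerDr addrACA.
have [r rE] := linear_ex lin_r.
have r_surj : surj r.
  move=> b; have [y yE] := q_surj (g b).
  have /fg[a aE] : g (b - h y) = 0 by rewrite linearB hE yE subrr.
  by have [x xE] := p_surj a; exists (x, y); rewrite rE /= xE aE subrK.
have rker := ker_exact r_surj.
exists (kermod r).
  exists (P * Q)%type; split; [exact: fingen_prod|exact: projective_prod|].
  by exists (ker_val r), r.
have [v vE] : exists v : {linear A' -> kermod r}, forall a, ker_val r (v a) = inl_lin Q (i a).
  case: rker => kinj _ kE; apply: (lift_inj (h := inl_lin Q \o i)) => // a.
  by apply/kE; rewrite rE /= pi0 !linear0 addr0.
have qk0 (x : kermod r) : q (ker_val r x).2 = 0.
  have := ker_valP x; rewrite rE => /(congr1 g).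
  by rewrite linear0 linearD gf0 add0r hE.
have [w wE] : exists w : {linear kermod r -> C'}, forall x, j (w x) = (ker_val r x).2.
  by apply: (lift_inj (h := snd \o ker_val r)) => // x; apply/jq/qk0.
exists v, w; split.
- move=> x y /(congr1 (ker_val r)); rewrite !vE => /(congr1 fst) /=; exact: i_inj.
(* A preimage of [c] must have second component [j c]; since [h (j c)] lies in the image of [A], a
   first component [- x] cancels it. *)
- move=> c; have /fg[a aE] : g (h (j c)) = 0 by rewrite hE.
  have [x xE] := p_surj a.
  case: rker => _ _ /(_ (- x, j c))[+ _]; rewrite rE /= !linearN xE aE addNr.
  by move=> /(_ erefl)[z zE]; exists z; apply: j_inj; rewrite wE (congr1 snd zE).
- move=> x; split=> [wx|[a <-]]; last by apply: j_inj; rewrite wE vE linear0.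
  have x2 : (ker_val r x).2 = 0 by rewrite -wE wx linear0.
  have /ip[a aE] : p (ker_val r x).1 = 0.
    by apply: f_inj; have := ker_valP x; rewrite rE x2 !linear0 addr0.
  exists a; case: rker => kinj _ _; apply: kinj; rewrite vE /= aE.
  by rewrite [RHS]surjective_pairing x2.
Qed.

(* [Z] is the kernel of [A * Q -> B], where [Q] is the cover of [C]. *)
Lemma rotate A B C Z : short_exact A B C -> syzygy1 C Z ->
  exists Q, [/\ fingen Q, projective Q & short_exact Z (A * Q)%type B].
Proof.
move=> [f [g [f_inj g_surj fg]]].
move=> [Q [Q_fg Q_proj [j [q [j_inj q_surj jq]]]]]; exists Q; split=> //.
have [h hE] := Q_proj _ _ g q g_surj.
have gf0 a : g (f a) = 0 by apply/fg; exists a.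
have qj0 w : q (j w) = 0 by apply/jq; exists w.
have lin_r : linear (fun x : (A * Q)%type => f x.1 + h x.2).
  by move=> c x y; rewrite !linearP scalerDr addrACA.
have [r rE] := linear_ex lin_r.
have [t tE] : exists t : {linear Z -> A}, forall z, f (t z) = h (j z).
  by apply: (lift_inj (h := h \o j)) => // z; apply/fg; rewrite /= hE.
have lin_u : linear (fun z => (- t z, j z)).
  by move=> c x y; rewrite !linearP.
have [u uE] := @linear_ex _ _ (A * Q)%type _ lin_u.
exists u, r; split.
- by move=> x y; rewrite !uE => -[_ /j_inj].
- move=> b; have [y yE] := q_surj (g b).
  have /fg[a aE] : g (b - h y) = 0 by rewrite linearB hE yE subrr.
  by exists (a, y); rewrite rE /= aE subrK.
- move=> [a y]; rewrite rE /=; split=> [ay0|[z]]; last first.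
    by rewrite uE => -[<- <-]; rewrite linearN tE addNr.
  have /jq[z zE] : q y = 0.
    by move/(congr1 g): ay0; rewrite linearD gf0 add0r hE linear0.
  exists z; rewrite uE zE; congr (_, _); apply: f_inj.
  by rewrite linearN tE zE; apply/esym/eqP; rewrite -addr_eq0 ay0.
Qed.

(** The kernel of the composite [C -> D -> A] is the pullback of [C -> D] along [Z -> D], so it maps
    onto [Z] with the kernel of [C -> D]. *)
Lemma exact_comp D' C D Z A : short_exact D' C D -> short_exact Z D A ->
  exists2 K, short_exact K C A & short_exact D' K Z.
Proof.
move=> [f [g [f_inj g_surj fg]]] [i [p [i_inj p_surj ip]]].
have pg_surj : surj (p \o g).
  by move=> a; have [d <-] := p_surj a; have [c <-] := g_surj d; exists c.
have kE := @ker_exact _ _ _ (p \o g) pg_surj.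
exists (kermod (p \o g)); first by exists (ker_val (p \o g)), (p \o g).
case: kE => kinj _ kE.
have gf0 a : g (f a) = 0 by apply/fg; exists a.
have [v vE] : exists v : {linear D' -> kermod (p \o g)}, forall x, ker_val _ (v x) = f x.
  by apply: lift_inj => // x; apply/kE; rewrite /= gf0 linear0.
have [w wE] : exists w : {linear kermod (p \o g) -> Z}, forall x, i (w x) = g (ker_val _ x).
  by apply: (lift_inj (h := g \o ker_val _)) => // x; apply/ip; apply: (ker_valP x).
exists v, w; split.
- by move=> x y /(congr1 (ker_val _)); rewrite !vE => /f_inj.
- move=> z; have [c cE] := g_surj (i z).
  have /kE[x xE] : (p \o g) c = 0 by rewrite /= cE; apply/ip; exists z.
  by exists x; apply: i_inj; rewrite wE xE.
- move=> x; split=> [wx|[a <-]]; last by apply: i_inj; rewrite wE vE gf0 linear0.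
  have /fg[a aE] : g (ker_val _ x) = 0 by rewrite -wE wx linear0.
  by exists a; apply: kinj; rewrite vE.
Qed.

Lemma short_exact_prod D' C D P : short_exact D' C D ->
  short_exact D' (C * P)%type (D * P)%type.
Proof.
move=> [f [g [f_inj g_surj fg]]].
have lin_r : linear (fun x : (C * P)%type => (g x.1, x.2)).
  by move=> c x y; rewrite !linearP.
have [r rE] := @linear_ex _ _ (D * P)%type _ lin_r.
exists (inl_lin P \o f), r; split.
- by move=> x y /(congr1 fst) /= /f_inj.
- by move=> [d y]; have [c <-] := g_surj d; exists (c, y); rewrite rE.
- move=> [c y]; rewrite rE /=; split=> [[/fg[a <-] ->]|[a /= [<- <-]]].
    by exists a.
  by congr (_, _); apply/fg; exists a.
Qed.

End Stable.

(** * Derived delooping levels *)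

Section Levels.
Variable R : pzRingType.
Implicit Types A B C D M N P Q U V W X Y Z : lmodType R.

(** The form in which finiteness enters the homological part: it keeps kernels and syzygies finitely
    generated. It is derived later from finite dimension over the ground field. *)
Definition noetherian : Prop :=
  forall M N (f : {linear N -> M}), injective f -> fingen M -> fingen N.

(** The condition whose infimum over [n] is [dell]. Being monotone in [n], it amounts to a bound on
    [dell]. *)
Definition dell_le k n X : Prop := exists Y U V,
  [/\ fingen Y, is_syzygy n X U, is_syzygy (n + k) Y V & stable_retract U V].

Fixpoint ddell_le m k X : Prop :=
  dell_le k m X \/
  if m is m'.+1 then exists D C,
    [/\ fingen D, fingen C, short_exact D C X, dell_le k m C & ddell_le m' k.+1 D]
  else False.

Definition pd_le p X : Prop := exists2 U, is_syzygy p X U & projective U.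

Hypothesis noethR : noetherian.

Lemma short_exact_fingen A B C :
  short_exact A B C -> fingen B -> fingen A /\ fingen C.
Proof.
move=> [f [g [f_inj g_surj _]]] B_fg; split; first exact: noethR f_inj B_fg.
exact: fingen_surj g_surj B_fg.
Qed.

Lemma syzygy1_ex X : fingen X -> exists2 Z, syzygy1 X Z & fingen Z.
Proof.
move=> /free_cover[n [g g_surj]]; have ex := ker_exact g_surj.
have sex : short_exact (kermod g) (free_mod R n) X by exists (ker_val g), g.
exists (kermod g); last exact: (short_exact_fingen sex (free_fingen R n)).1.
by exists (free_mod R n); split=> //; [apply: free_fingen | apply: free_projective].
Qed.

Lemma syzygy1_fingen X Z : syzygy1 X Z -> fingen Z.
Proof. by move=> [P [P_fg _ /short_exact_fingen[]]]. Qed.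

Lemma is_syzygy_fingen n X U : fingen X -> is_syzygy n X U -> fingen U.
Proof.
elim: n X => [|n IHn] X X_fg; last first.
  by move=> /is_syzygyS[Z /syzygy1_fingen Z_fg /(IHn _ Z_fg)].
move=> [f [g fK gK]]; apply: (@fingen_surj _ _ _ f) X_fg => u.
by exists (g u); rewrite gK.
Qed.

Lemma is_syzygy_ex n X : fingen X -> exists U, is_syzygy n X U.
Proof.
elim: n X => [|n IHn] X X_fg; first by exists X; apply: is_syzygy0.
have [Z XZ /IHn[U ZU]] := syzygy1_ex X_fg.
by exists U; apply/is_syzygyS; exists Z.
Qed.

Lemma dell_leS k n X : fingen X -> dell_le k n X -> dell_le k n.+1 X.
Proof.
move=> X_fg [Y [U [V [Y_fg XU YV UV]]]].
have [U' UU' _] := syzygy1_ex (is_syzygy_fingen X_fg XU).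
have [V' VV' _] := syzygy1_ex (is_syzygy_fingen Y_fg YV).
exists Y, U', V'; split=> //; last exact: sretract_syzygy1 UV UU' VV'.
  exact: is_syzygy_rcons XU UU'.
exact: is_syzygy_rcons YV VV'.
Qed.

Lemma dell_le_leq k n n' X :
  fingen X -> (n <= n')%N -> dell_le k n X -> dell_le k n' X.
Proof.
move=> X_fg /subnK <-; elim: (n' - n)%N => // i IHi /IHi.
exact: dell_leS.
Qed.

Lemma dell_leP k n X : fingen X -> (dell k X <= Some n)%enat <-> dell_le k n X.
Proof.
move=> X_fg; rewrite einf_le; split=> [[i Xi le_in]|Xn]; last by exists n.
exact: dell_le_leq le_in Xi.
Qed.

Lemma dell_le_sretract k n X X' :
  fingen X -> stable_retract X X' -> dell_le k n X' -> dell_le k n X.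
Proof.
move=> X_fg XX' [Y [U' [V [Y_fg X'U' YV UV]]]].
have [U XU] := is_syzygy_ex n X_fg; exists Y, U, V; split=> //.
exact: sretract_trans (sretract_syzygy XX' XU X'U') UV.
Qed.

(** [Omega^(n+k+1) Y] is [Omega^(n+k)] of a first syzygy of [Y], which becomes the new witness. *)
Lemma dell_le_pred k n X : dell_le k.+1 n X -> dell_le k n X.
Proof.
move=> [Y [U [V [Y_fg XU + UV]]]]; rewrite addnS => /is_syzygyS[Z YZ ZV].
by exists Z, U, V; split=> //; apply: syzygy1_fingen YZ.
Qed.

(** The gain in the index: [Omega^n Z] is stably [Omega^(n+1) X], hence a stable retract of
    [Omega^(n+k+1) Y], while [n] stays the same. *)
Lemma dell_le_syzygy1 k n X Z :
  fingen X -> dell_le k n X -> syzygy1 X Z -> dell_le k.+1 n Z.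
Proof.
move=> X_fg [Y [U [V [Y_fg XU YV UV]]]] XZ.
have [W ZW] := is_syzygy_ex n (syzygy1_fingen XZ).
have [U' UU' _] := syzygy1_ex (is_syzygy_fingen X_fg XU).
have [V' VV' _] := syzygy1_ex (is_syzygy_fingen Y_fg YV).
exists Y, W, V'; split=> //; first by rewrite addnS; apply: is_syzygy_rcons VV'.
apply: sretract_trans (sretract_syzygy1 UV UU' VV').
apply: (@is_syzygy_uniq _ n.+1 X); last exact: is_syzygy_rcons XU UU'.
by apply/is_syzygyS; exists Z.
Qed.

Lemma dell_le_ddell_le m k X : dell_le k m X -> ddell_le m k X.
Proof. by case: m => [|m]; left. Qed.

Lemma ddell_leS m k X : fingen X -> ddell_le m k X -> ddell_le m.+1 k X.
Proof.
elim: m k X => [|m IHm] k X X_fg [dX|] //.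
- by apply/dell_le_ddell_le/dell_leS.
- by apply/dell_le_ddell_le/dell_leS.
move=> [D [C [D_fg C_fg ex dC dD]]]; right; exists D, C; split=> //.
  exact: dell_leS.
exact: IHm.
Qed.

Lemma ddell_le_leq m m' k X :
  fingen X -> (m <= m')%N -> ddell_le m k X -> ddell_le m' k X.
Proof.
move=> X_fg /subnK <-; elim: (m' - m)%N => // i IHi /IHi.
exact: ddell_leS.
Qed.

Lemma ddell_le_pred m k X : ddell_le m k.+1 X -> ddell_le m k X.
Proof.
elim: m k X => [|m IHm] k X [/dell_le_pred dX|] //; [by left|by left|].
move=> [D [C [D_fg C_fg ex /dell_le_pred dC /IHm dD]]].
by right; exists D, C.
Qed.

Lemma ddell_le_iso m k X Y (h : {linear X -> Y}) : injective h -> surj h ->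
  fingen X -> ddell_le m k X -> ddell_le m k Y.
Proof.
move=> h_inj h_surj X_fg; have [g [hK gK]] := iso_inv h_inj h_surj.
have Y_fg := fingen_surj h_surj X_fg.
case: m => [|m] [dX|] //.
- by left; apply: dell_le_sretract (sretract_split gK) dX.
- by left; apply: dell_le_sretract (sretract_split gK) dX.
move=> [D [C [D_fg C_fg ex dC dD]]]; right; exists D, C; split=> //.
exact: short_exact_iso h_inj h_surj ex.
Qed.

Lemma ddell_le_prod m k X P : fingen X -> fingen P -> projective P ->
  ddell_le m k X -> ddell_le m k (X * P)%type.
Proof.
move=> X_fg P_fg P_proj; have XP_fg := fingen_prod X_fg P_fg.
case: m => [|m] [dX|] //.
- by left; apply: dell_le_sretract dX => //; apply: sretract_prodP.
- by left; apply: dell_le_sretract dX => //; apply: sretract_prodP.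
move=> [D [C [D_fg C_fg ex dC dD]]]; right; exists D, (C * P)%type.
split=> //; [exact: fingen_prod | exact: short_exact_prod|].
apply: dell_le_sretract dC; last exact: sretract_prodP.
exact: fingen_prod.
Qed.

(** The horseshoe lemma takes syzygies of a whole step [0 -> D -> C -> X -> 0], so the index gain of
    [dell] propagates along the recursion. *)
Lemma ddell_le_syzygy1 m k X Z :
  fingen X -> ddell_le m k X -> syzygy1 X Z -> ddell_le m k.+1 Z.
Proof.
elim: m k X Z => [|m IHm] k X Z X_fg [dX|] // => [XZ|XZ|].
- by left; apply: dell_le_syzygy1 dX XZ.
- by left; apply: dell_le_syzygy1 dX XZ.
move=> [D [C [D_fg C_fg ex dC dD]]] XZ; right.
have [D' DD' D'_fg] := syzygy1_ex D_fg.
have [C' CC' ex'] := horseshoe ex DD' XZ.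
exists D', C'; split=> //; first exact: syzygy1_fingen CC'.
  exact: dell_le_syzygy1 dC CC'.
exact: IHm dD DD'.
Qed.

(* Induction along the resolution of [D]: each kernel is an extension of a
   syzygy of [B] by the corresponding kernel of that resolution. *)
Lemma ddell_le_cone d b k B Z D A : fingen B -> fingen D -> syzygy1 B Z ->
  short_exact Z D A -> ddell_le d k D -> ddell_le b k B ->
  ddell_le (d + b).+1 k A.
Proof.
elim: d k B Z D A => [|d IHd] k B Z D A B_fg D_fg BZ ex dD dB.
  case: dD => // dD; right; exists Z, D; split=> //; first exact: syzygy1_fingen BZ.
    exact: dell_le_leq dD.
  exact: ddell_le_syzygy1 dB BZ.
case: dD => [dD|[D' [C [D'_fg C_fg ex' dC dD']]]].
  right; exists Z, D; split=> //; first exact: syzygy1_fingen BZ.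
    by apply: dell_le_leq dD => //; rewrite addSn ltnW // !ltnS leq_addr.
  apply: (@ddell_le_leq b); [exact: syzygy1_fingen BZ|exact: leq_addl|].
  exact: ddell_le_syzygy1 dB BZ.
have [K exK exK'] := exact_comp ex' ex.
have Z_fg := syzygy1_fingen BZ.
right; exists K, C; split=> //; first exact: (short_exact_fingen exK C_fg).1.
  by apply: dell_le_leq dC => //; rewrite addSn ltnW // !ltnS leq_addr.
have [W ZW W_fg] := syzygy1_ex Z_fg.
(* [K] is an extension of [Z] by [D']. Rotated, it is the cokernel of [W -> D' * Q] with [W] a
   syzygy of [Z], which is the original situation with [Z] for [B] and index [k.+1]. *)
have [Q [Q_fg Q_proj exQ]] := rotate exK' ZW.
rewrite addSn; apply: IHd exQ _ _ => //; [exact: Z_fg|exact: fingen_prod|exact: ZW| |].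
  exact: ddell_le_prod.
exact: ddell_le_syzygy1 dB BZ.
Qed.

(** Rotation presents [B] as the cokernel of [Z -> A * Q] with [Z] a syzygy of [C]; the cone lemma
    applies, since a projective summand keeps the bound on the level of [A]. *)
Lemma ddell_le_ext a c k A B C : fingen A -> fingen C -> short_exact A B C ->
  ddell_le a k A -> ddell_le c k C -> ddell_le (a + c).+1 k B.
Proof.
move=> A_fg C_fg ex dA dC; have [Z CZ Z_fg] := syzygy1_ex C_fg.
have [Q [Q_fg Q_proj exQ]] := rotate ex CZ.
apply: ddell_le_cone exQ _ dC => //; [exact: fingen_prod|].
exact: ddell_le_prod.
Qed.

(** In a step [0 -> D -> C -> A * Q -> 0] the map [C -> Q] splits. Its kernel is therefore a retract
    of [C], and it maps onto [A] with the same kernel [D]. *)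
Lemma ddell_le_prod_inv m k A Q : fingen A -> projective Q ->
  ddell_le m k (A * Q)%type -> ddell_le m k A.
Proof.
move=> A_fg Q_proj; have AQ := sretract_Uprod A Q.
case: m => [|m] [dX|] //.
- by left; apply: dell_le_sretract dX.
- by left; apply: dell_le_sretract dX.
move=> [D [C [D_fg C_fg [f [g [f_inj g_surj fg]]] dC dD]]].
have sg_surj : surj (snd \o g).
  by move=> q; have [c cE] := g_surj (0, q); exists c; rewrite /= cE.
have [s sE] := Q_proj _ _ (snd \o g) idfun sg_surj.
have [kinj _ kE] := ker_exact sg_surj.
have [v vE] : exists v : {linear D -> kermod (snd \o g)}, forall x, ker_val _ (v x) = f x.
  apply: lift_inj => // x; apply/kE; rewrite /=.
  by rewrite (_ : g (f x) = 0) //; apply/fg; exists x.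
have [r rE] : exists r : {linear C -> kermod (snd \o g)},
    forall x, ker_val _ (r x) = x - s (g x).2.
  apply: (lift_inj (h := idfun \- (s \o (snd \o g)))) => // x; apply/kE.
  rewrite -[LHS]/((snd \o g) (x - s (g x).2)) linearB.
  by rewrite (sE (g x).2) /= subrr.
have fst_surj : surj (fst \o (g \o ker_val (snd \o g))).
  move=> a; have [c cE] := g_surj (a, 0).
  have /kE[x xE] : (snd \o g) c = 0 by rewrite /= cE.
  by exists x; rewrite /= xE cE.
have gk2 (x : kermod (snd \o g)) : (g (ker_val _ x)).2 = 0 by apply: (ker_valP x).
have K_fg : fingen (kermod (snd \o g)) by apply: noethR kinj C_fg.
right; exists D, (kermod (snd \o g)); split=> //; last first.
  apply: dell_le_sretract dC => //.
  apply: (@sretract_split _ _ _ (ker_val (snd \o g)) r) => x.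
  by apply: kinj; rewrite rE gk2 linear0; apply: subr0.
exists v, (fst \o (g \o ker_val (snd \o g))); split=> //.
  by move=> x y /(congr1 (ker_val _)); rewrite !vE => /f_inj.
move=> x; split=> [gx|[z <-]].
  have /fg[z zE] : g (ker_val _ x) = 0.
    by rewrite [LHS]surjective_pairing gk2; congr (_, _).
  by exists z; apply: kinj; rewrite vE.
by rewrite /= vE (_ : g (f z) = 0) //; apply/fg; exists z.
Qed.

(** Two rotations: [0 -> Z -> A * Q -> B -> 0] with [Z] a syzygy of [C], then
    [0 -> W -> Z * P -> A * Q -> 0] with [W] a syzygy of [B]. The second has the shape of the cone
    lemma; the summand [Q] is then removed. *)
Lemma ddell_le_sub b c k A B C : fingen B -> short_exact A B C ->
  ddell_le b k B -> ddell_le c k C -> ddell_le (c + b).+1 k A.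
Proof.
move=> B_fg ex dB dC; have [A_fg C_fg] := short_exact_fingen ex B_fg.
have [Z CZ Z_fg] := syzygy1_ex C_fg.
have [Q [Q_fg Q_proj exQ]] := rotate ex CZ.
have [W BW W_fg] := syzygy1_ex B_fg.
have [P [P_fg P_proj exP]] := rotate exQ BW.
have dZ : ddell_le c k Z by apply/ddell_le_pred/(ddell_le_syzygy1 C_fg dC CZ).
have dAQ : ddell_le (c + b).+1 k (A * Q)%type.
  apply: ddell_le_cone exP _ dB => //; [exact: fingen_prod|].
  exact: ddell_le_prod.
exact: ddell_le_prod_inv dAQ.
Qed.

End Levels.

(** * Resolutions against the recursive form of the level *)

Section Resolutions.
Variable R : pzRingType.
Implicit Types A B C D M N P Q U V W X Y Z : lmodType R.
Hypothesis noethR : noetherian R.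

Lemma free0 (x : free_mod R 0) : x = 0.
Proof. by apply/ffunP => -[]. Qed.

Lemma zero_fingen X : (forall x : X, x = 0) -> fingen X.
Proof. by move=> X0; exists 0%N, (fun=> 0) => x; exists (fun=> 0); rewrite big_ord0. Qed.

Lemma zero_projective X : (forall x : X, x = 0) -> projective X.
Proof.
move=> X0; apply: (@dual_basis_projective _ X 0 (fun=> 0) (fun=> \0)) => x.
by rewrite big_ord0.
Qed.

Lemma resolves_uncons t (C : nat -> lmodType R) X : resolves t.+1 C X ->
  exists K, short_exact K (C 0%N) X /\ resolves t (fun i => C i.+1) K.
Proof.
move=> [C0 [d0 [d [d0_surj d0E dE]]]].
have kE := ker_exact d0_surj; exists (kermod d0).
split; first by exists (ker_val d0), d0.
split=> [i lt_ti|]; first exact: C0.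
case: kE => kinj _ kE.
have [d0' d0'E] : exists d0' : {linear C 1%N -> kermod d0},
    forall x, ker_val d0 (d0' x) = d 0%N x.
  by apply: lift_inj => // x; apply/kE/d0E; exists x.
exists d0', (fun i => d i.+1); split=> // [y|x].
  have /d0E[x xE] : d0 (ker_val d0 y) = 0 by apply: ker_valP.
  by exists x; apply: kinj; rewrite d0'E.
rewrite -dE -d0'E; split=> [->|]; first exact: linear0.
by rewrite -(linear0 (ker_val d0)) => /kinj.
Qed.

Lemma resolves0_iso (C : nat -> lmodType R) X : resolves 0 C X ->
  exists f : {linear C 0%N -> X}, injective f /\ surj f.
Proof.
move=> [C0 [d0 [d [d0_surj d0E dE]]]]; exists d0; split=> // x y xy.
apply/eqP; rewrite -subr_eq0; apply/eqP.
have /d0E[z <-] : d0 (x - y) = 0 by rewrite linearB xy subrr.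
by rewrite (C0 1%N _ z) // linear0.
Qed.

Lemma resolves_cons t (C : nat -> lmodType R) D B X :
  short_exact D B X -> resolves t C D ->
  resolves t.+1 (fun i => if i is i'.+1 then C i' else B) X.
Proof.
move=> [f [g [f_inj g_surj fg]]] [C0 [d0 [d [d0_surj d0E dE]]]].
set C' := fun i => _; split=> [[|i] //|]; first exact: C0.
exists g, (fun i => match i return {linear C' i.+1 -> C' i} with
                    | 0 => f \o d0 | i'.+1 => d i' end).
split=> // [x|[|i] x /=]; rewrite ?fg.
- split=> [[z <-]|[y <-]]; last by exists (d0 y).
  by have [y <-] := d0_surj z; exists y.
- rewrite -d0E; split=> [fd0|d0x]; last by rewrite /= d0x linear0.
  by apply: f_inj; rewrite linear0.
- exact: dE.
Qed.

Lemma resolves_self X : resolves 0 (fun i => if i is _.+1 then free_mod R 0 else X) X.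
Proof.
set C := fun i => _; split=> [[|i] //|]; first by move=> _ x; apply: free0.
exists idfun, (fun=> \0); split=> [x|x|[|i] x]; first by exists x.
- by split=> [/= ->|[y <-]//]; exists 0.
- by split=> // _; exists 0; rewrite [x]free0.
- by split=> // _; exists 0; rewrite [x]free0.
Qed.

(** Peeling off the first term shifts both parameters consistently: [i.+1 + k = i + k.+1] and
    [m.+1 - i.+1 = m - i]. *)
Lemma resolves_ddell_le t m k (C : nat -> lmodType R) X :
  (t <= m)%N -> (forall i, fingen (C i)) -> resolves t C X ->
  (forall i, (i <= t)%N -> dell_le (i + k) (m - i) (C i)) -> ddell_le m k X.
Proof.
elim: t m k C X => [|t IHt] m k C X le_tm C_fg res dC.
  have [f [f_inj f_surj]] := resolves0_iso res.
  apply: (ddell_le_iso noethR f_inj f_surj) => //.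
  by apply: dell_le_ddell_le; have := dC 0%N isT; rewrite subn0.
have [K [ex res']] := resolves_uncons res.
case: m le_tm dC => // m le_tm dC; right; exists K, (C 0%N); split=> //.
- exact: (short_exact_fingen noethR ex _).1.
- by have := dC 0%N isT; rewrite subn0.
- by apply: IHt res' _ => // i le_it; have := dC i.+1 le_it; rewrite addSnnS subSS.
Qed.

Lemma ddell_le_resolves m k X : fingen X -> ddell_le m k X ->
  exists t (C : nat -> lmodType R),
    [/\ (t <= m)%N, forall i, fingen (C i), resolves t C X
      & forall i, (i <= t)%N -> dell_le (i + k) (m - i) (C i)].
Proof.
elim: m k X => [|m IHm] k X X_fg.
  case=> // dX; exists 0%N, (fun i => if i is _.+1 then free_mod R 0 else X).
  split=> [//|[|i]||[|i]//]; [by []|exact: free_fingen|exact: resolves_self].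
case=> [dX|[D [B [D_fg B_fg ex dB /(IHm _ _ D_fg)[t [C [le_tm C_fg res dC]]]]]]].
  exists 0%N, (fun i => if i is _.+1 then free_mod R 0 else X).
  split=> [//|[|i]||[|i]//]; [by []|exact: free_fingen|exact: resolves_self].
exists t.+1, (fun i => if i is i'.+1 then C i' else B); split=> //.
- by case.
- exact: resolves_cons ex res.
- by case=> [|i] //= le_it; rewrite addSnnS subSS; apply: dC.
Qed.

Lemma ddell_leP m k X : fingen X ->
  (ddell k X <= Some m)%enat <-> ddell_le m k X.
Proof.
move=> X_fg; rewrite einf_le; split=> [[n [t [C [le_tn C_fg res dC]]] le_nm]|].
  apply: ddell_le_leq le_nm _ => //.
  apply: (@resolves_ddell_le t n k C) => // i /dC.
  by move/(dell_leP noethR _ _ (C_fg i)).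
move=> /(ddell_le_resolves X_fg)[t [C [le_tm C_fg res dC]]].
exists m => //; exists t, C; split=> // i /dC.
by move/(dell_leP noethR _ _ (C_fg i)).
Qed.

(** * Projective dimension *)

Lemma is_syzygy0_sretract X U : is_syzygy 0 X U -> stable_retract X U.
Proof.
move=> XU; apply: (@is_syzygy_uniq _ 0 X) => //; exact: is_syzygy0.
Qed.

Lemma pd_leP0 X : pd_le 0 X <-> projective X.
Proof.
split=> [[U /is_syzygy0_sretract XU U_proj]|]; first exact: sretract_projective XU _.
by exists X => //; apply: is_syzygy0.
Qed.

Lemma pd_le_syzygy n X U : pd_le n X -> is_syzygy n X U -> projective U.
Proof.
move=> [V XV V_proj] XU; apply: sretract_projective V_proj.
exact: is_syzygy_uniq XU XV.
Qed.

Lemma pd_leS n X : fingen X -> pd_le n X -> pd_le n.+1 X.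
Proof.
move=> X_fg [U XU U_proj]; have U_fg := is_syzygy_fingen noethR X_fg XU.
(* The identity of the projective [U] serves as a cover with zero kernel. *)
exists (free_mod R 0); last exact: free_projective.
apply: is_syzygy_rcons XU _; exists U; split=> //.
exists \0, idfun; split=> [x y _|x|x]; first by rewrite [x]free0 [y]free0.
  by exists x.
by split=> [/= ->|[z <-]//]; exists 0.
Qed.

Lemma pd_le_leq n m X : fingen X -> (n <= m)%N -> pd_le n X -> pd_le m X.
Proof.
move=> X_fg /subnK <-; elim: (m - n)%N => // i IHi /IHi.
exact: pd_leS.
Qed.

Lemma resolves_pd_le n (C : nat -> lmodType R) X :
  (forall i, fingen (C i) /\ projective (C i)) -> resolves n C X -> pd_le n X.
Proof.
elim: n C X => [|n IHn] C X CP res.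
  have [f [f_inj f_surj]] := resolves0_iso res.
  have [g [fK gK]] := iso_inv f_inj f_surj.
  by apply/pd_leP0; apply: (projective_retract gK); have [] := CP 0%N.
have [K [ex /IHn[|U KU U_proj]]] := resolves_uncons res; first by move=> i; apply: CP.
exists U => //; apply/is_syzygyS; exists K => //.
by exists (C 0%N); split=> //; have [] := CP 0%N.
Qed.

Lemma pd_leP n X : fingen X -> (pd X <= Some n)%enat -> pd_le n X.
Proof.
move=> X_fg /einf_le[m [C [CP res]] le_mn].
exact: pd_le_leq X_fg le_mn (resolves_pd_le CP res).
Qed.

Lemma pd_fingen n X : pd X = Some n -> fingen X.
Proof.
move=> /einfP[C [CP [_ [d0 [d [d0_surj _ _]]]]]].
by apply: fingen_surj d0_surj _; have [] := CP 0%N.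
Qed.

(** A finitely generated projective [Omega^p X] is a stable retract of anything, so the zero module
    can be taken for [Y]. *)
Lemma pd_le_ddell_le p k X : fingen X -> pd_le p X -> ddell_le p k X.
Proof.
move=> X_fg [U XU U_proj]; apply: dell_le_ddell_le.
have [V YV] := is_syzygy_ex noethR (p + k) (free_fingen R 0).
exists (free_mod R 0), U, V; split=> //; first exact: free_fingen.
exact: projective_sretract (is_syzygy_fingen noethR X_fg XU) U_proj.
Qed.

Lemma pd_le_sretract p X Y :
  fingen X -> stable_retract X Y -> pd_le p Y -> pd_le p X.
Proof.
move=> X_fg XY [V YV V_proj]; have [U XU] := is_syzygy_ex noethR p X_fg.
by exists U => //; apply: sretract_projective (sretract_syzygy XY XU YV) _.
Qed.

Lemma pd_le_prod p X Y : pd_le p X -> pd_le p Y -> pd_le p (X * Y)%type.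
Proof.
move=> [U XU U_proj] [V YV V_proj]; exists (U * V)%type.
  exact: is_syzygy_prod.
exact: projective_prod.
Qed.

Lemma pd_le_ext p A B C : fingen A -> fingen C -> short_exact A B C ->
  pd_le p A -> pd_le p C -> pd_le p B.
Proof.
elim: p A B C => [|p IHp] A B C A_fg C_fg ex.
  move=> /pd_leP0 A_proj /pd_leP0 C_proj; apply/pd_leP0.
  case: ex => [f [g [f_inj g_surj fg]]].
  have [s sE] := C_proj _ _ g idfun g_surj.
  have [r rE] : exists r : {linear B -> A}, forall x, f (r x) = x - s (g x).
    apply: (lift_inj (h := idfun \- (s \o g))) => // x; apply/fg.
    by rewrite -[LHS]/(g (x - s (g x))) linearB sE subrr.
  have lin_u : linear (fun x => (r x, g x)) by move=> c x y; rewrite !linearP.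
  have lin_v : linear (fun x : (A * C)%type => f x.1 + s x.2).
    by move=> c x y; rewrite !linearP scalerDr addrACA.
  have [u uE] := @linear_ex _ _ (A * C)%type _ lin_u.
  have [v vE] := linear_ex lin_v.
  apply: (@projective_retract _ _ _ u v); last exact: projective_prod.
  by move=> x; rewrite vE uE /= rE subrK.
move=> [U /is_syzygyS[A' AA' A'U] U_proj] [V /is_syzygyS[C' CC' C'V] V_proj].
have [B' BB' ex'] := horseshoe ex AA' CC'.
have [] := IHp A' B' C' (syzygy1_fingen noethR AA') (syzygy1_fingen noethR CC') ex'.
- by exists U.
- by exists V.
by move=> W B'W W_proj; exists W => //; apply/is_syzygyS; exists B'.
Qed.

(** The horseshoe lemma carries the sequence through [p] syzygies. Its middle term is then
    projective, so the left term is a first syzygy of the right one. *)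
Lemma syzygy_shift p Z Q X U V : fingen Q -> short_exact Z Q X -> pd_le p Q ->
  is_syzygy p Z U -> is_syzygy p.+1 X V ->
  stable_retract U V /\ stable_retract V U.
Proof.
elim: p Z Q X => [|p IHp] Z Q X Q_fg ex.
  move=> /pd_leP0 Q_proj ZU XV.
  have XU : is_syzygy 1 X U.
    apply: (@is_syzygy_cat _ 1 0 _ Z) => //.
    by apply: is_syzygy1; exists Q.
  by split; [apply: is_syzygy_uniq XU XV | apply: is_syzygy_uniq XV XU].
move=> pdQ /is_syzygyS[Z' ZZ' Z'U] /is_syzygyS[X' XX' X'V].
have [Q' QQ' ex'] := horseshoe ex ZZ' XX'.
have Q'_fg := syzygy1_fingen noethR QQ'.
apply: (IHp _ _ _ Q'_fg ex') => //.
have [W Q'W] := is_syzygy_ex noethR p Q'_fg; exists W => //.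
by apply: (pd_le_syzygy pdQ); apply/is_syzygyS; exists Q'.
Qed.

Lemma pd_le_quot p A B C : fingen B -> short_exact A B C ->
  pd_le p A -> pd_le p B -> pd_le p.+1 C.
Proof.
move=> B_fg ex [U AU U_proj] pdB; have [A_fg C_fg] := short_exact_fingen noethR ex B_fg.
have [V CV] := is_syzygy_ex noethR p.+1 C_fg; exists V => //.
exact: sretract_projective (syzygy_shift B_fg ex pdB AU CV).2 U_proj.
Qed.

End Resolutions.

(** * Exact functors *)

Section Functor.
Variables A B : pzRingType.

(** The laws are stated up to pointwise equality, because two bundled linear maps with the same
    values need not be convertible. *)
Record exact_functor := ExactFunctor {
  fun_ob :> lmodType A -> lmodType B;
  fun_mor : forall X Y : lmodType A, {linear X -> Y} ->
    {linear fun_ob X -> fun_ob Y};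
  fun_id : forall (X : lmodType A) (f : {linear X -> X}),
    f =1 id -> fun_mor f =1 id;
  fun_comp : forall (X Y Z : lmodType A) (f : {linear X -> Y})
      (g : {linear Y -> Z}) (h : {linear X -> Z}),
    h =1 g \o f -> fun_mor h =1 fun_mor g \o fun_mor f;
  fun_add : forall (X Y : lmodType A) (f g h : {linear X -> Y}),
    h =1 f \+ g -> fun_mor h =1 fun_mor f \+ fun_mor g;
  fun_exact : forall (X Y Z : lmodType A) (f : {linear X -> Y})
      (g : {linear Y -> Z}),
    exact3 f g -> exact3 (fun_mor f) (fun_mor g);
  fun_fingen : forall X : lmodType A, fingen X -> fingen (fun_ob X)
}.

Variable F : exact_functor.
Hypotheses (noethA : noetherian A) (noethB : noetherian B).
Implicit Types (P U V X Y Z : lmodType A).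

Lemma fun_short_exact X Y Z : short_exact X Y Z -> short_exact (F X) (F Y) (F Z).
Proof.
by move=> [f [g fg]]; exists (fun_mor F f), (fun_mor F g); apply: fun_exact fg.
Qed.

Lemma fun_zero X Y (f : {linear X -> Y}) : f =1 (fun=> 0) -> fun_mor F f =1 (fun=> 0).
Proof.
move=> f0 x; apply: (addrI (fun_mor F f x)); rewrite addr0.
apply/esym/(@fun_add F _ _ f f f).
by move=> y /=; rewrite f0 addr0.
Qed.

(** A dual basis writes the identity of [P] as a finite sum of maps [P -> A -> P]. By additivity the
    identity of [F P] factors through a finite product of copies of [F A]. *)
Lemma fun_pd p P : fingen P -> projective P ->
  pd_le p (F (A^o : lmodType A)) -> pd_le p (F P).
Proof.
move=> P_fg P_proj pdFA; have [n [w genP]] := P_fg.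
have [a aE] := projective_dual_basis P_proj genP.
have lin_b i : linear (fun c : A^o => (c : A) *: w i).
  by move=> c x y; rewrite scalerDl scalerA.
have [b bE] := choice (fun i => @linear_ex _ (A^o : lmodType A) P _ (lin_b i)).
(* Arbitrary partial sums [h] are factored, so that the induction can remove one term at a time. *)
suff factor m (c : 'I_m -> 'I_n) (h : {linear P -> P}) :
    (forall x, h x = \sum_i b (c i) (a (c i) x)) ->
    exists (Q : lmodType B) (u : {linear F P -> Q}) (v : {linear Q -> F P}),
      pd_le p Q /\ forall x, fun_mor F h x = v (u x).
  have [|Q [u [v [pdQ uv]]]] := factor n id idfun.
    by move=> x; rewrite {1}(aE x); apply: eq_bigr => i _; rewrite bE.
  apply: (pd_le_sretract noethB _ _ pdQ); first exact: fun_fingen.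
  by apply: (@sretract_split _ _ _ u v) => x; rewrite -uv (fun_id).
elim: m c h => [|m IHm] c h hE.
  exists (free_mod B 0), \0, \0; split; last first.
    by move=> x; rewrite fun_zero // => y; rewrite hE big_ord0.
  apply: (pd_le_leq noethB (free_fingen B 0) (leq0n p)).
  exact/pd_leP0/free_projective.
pose h1 : {linear P -> P} := b (c ord0) \o a (c ord0).
pose h2 : {linear P -> P} := h \- h1.
have [|Q [u [v [pdQ uv]]]] := IHm (c \o lift ord0) h2.
  move=> x; rewrite -[LHS]/(h x - h1 x) hE big_ord_recl addrAC subrr add0r.
  by [].
have lin_u' : linear (fun x => (fun_mor F (a (c ord0)) x, u x)).
  by move=> k x y; rewrite !linearP.
have lin_v' : linear (fun x : (F (A^o : lmodType A) * Q)%type =>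
    fun_mor F (b (c ord0)) x.1 + v x.2).
  by move=> k x y; rewrite !linearP scalerDr addrACA.
have [u' u'E] := @linear_ex _ _ (F (A^o : lmodType A) * Q)%type _ lin_u'.
have [v' v'E] := linear_ex lin_v'.
exists (F (A^o : lmodType A) * Q)%type, u', v'; split; first exact: pd_le_prod.
move=> x; rewrite v'E u'E /= -uv.
have /(_ x) /= <- : fun_mor F h1 =1 fun_mor F (b (c ord0)) \o fun_mor F (a (c ord0)).
  exact: fun_comp.
by apply: fun_add => y /=; rewrite addrC subrK.
Qed.

Variable p : nat.
Hypothesis pdFA : pd_le p (F (A^o : lmodType A)).

Lemma fun_split U V (f : {linear U -> V}) (g : {linear V -> U}) :
  cancel f g -> cancel (fun_mor F f) (fun_mor F g).
Proof.
move=> fK x.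
have /(_ x) /= <- : fun_mor F idfun =1 fun_mor F g \o fun_mor F f.
  by apply: fun_comp => y /=; rewrite fK.
by rewrite fun_id.
Qed.

(** [F] may turn a cover into a sequence whose middle term is only of projective dimension at most
    [p]; [syzygy_shift] corrects this at every step, once [p] syzygies have been taken. *)
Lemma fun_syzygy n X U W W' : fingen X -> is_syzygy n X U ->
  is_syzygy p (F U) W -> is_syzygy (p + n) (F X) W' ->
  stable_retract W W' /\ stable_retract W' W.
Proof.
elim: n X W W' => [|n IHn] X W W' X_fg.
  rewrite addn0 => -[f [g fK gK]] UW XW'.
  have [|u|h [fhK hfK]] := @iso_inv _ _ _ f; first exact: can_inj fK.
    by exists (g u); rewrite gK.
  split.
    exact: sretract_syzygy (sretract_split (fun_split hfK)) UW XW'.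
  exact: sretract_syzygy (sretract_split (fun_split fhK)) XW' UW.
move=> /is_syzygyS[Z XZ ZU] UW; rewrite addnS -addSn => /is_syzygy_split[V' FXV' V'W'].
have Z_fg := syzygy1_fingen noethA XZ.
have [V FZV] := is_syzygy_ex noethB p (fun_fingen F Z_fg).
have [W1 VW1] := is_syzygy_ex noethB n (is_syzygy_fingen noethB (fun_fingen F Z_fg) FZV).
have [WW1 W1W] := IHn _ _ _ Z_fg ZU UW (is_syzygy_cat FZV VW1).
have [P [P_fg P_proj /fun_short_exact ex]] := XZ.
have [VV' V'V] := syzygy_shift noethB (fun_fingen F P_fg) ex
  (fun_pd P_fg P_proj pdFA) FZV FXV'.
split; first exact: sretract_trans WW1 (sretract_syzygy VV' VW1 V'W').
exact: sretract_trans (sretract_syzygy V'V V'W' VW1) W1W.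
Qed.

(** [F U] is a summand of [F V * F P], and the [p]-th syzygy of [F P] is projective, hence invisible
    stably. *)
Lemma fun_sretract U V W W' : stable_retract U V -> 
  is_syzygy p (F U) W -> is_syzygy p (F V) W' -> stable_retract W W'.
Proof.
move=> [f [g [P [a [b [P_fg P_proj fgE]]]]]] UW VW'.
have lin_c : linear (fun x => (fun_mor F f x, fun_mor F a x)).
  by move=> c x y; rewrite !linearP.
have lin_d : linear (fun x : (F V * F P)%type => fun_mor F g x.1 + fun_mor F b x.2).
  by move=> c x y; rewrite !linearP scalerDr addrACA.
have [c cE] := @linear_ex _ _ (F V * F P)%type _ lin_c.
have [d dE] := linear_ex lin_d.
have cK : cancel c d.
  move=> x; rewrite dE cE /=.
  pose gf : {linear U -> U} := g \o f; pose ba : {linear U -> U} := b \o a.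
  have /(_ x) /= <- : fun_mor F gf =1 fun_mor F g \o fun_mor F f by apply: fun_comp.
  have /(_ x) /= <- : fun_mor F ba =1 fun_mor F b \o fun_mor F a by apply: fun_comp.
  have /(_ x) /= <- : fun_mor F idfun =1 fun_mor F gf \+ fun_mor F ba.
    by apply: fun_add => y /=; rewrite -fgE addrC subrK.
  by rewrite fun_id.
have FP_fg := fun_fingen F P_fg; have pdFP := fun_pd P_fg P_proj pdFA.
have [Q FPQ] := is_syzygy_ex noethB p FP_fg.
apply: sretract_trans (sretract_syzygy (sretract_split cK) UW (is_syzygy_prod VW' FPQ)) _.
apply: sretract_prodP; last exact: pd_le_syzygy pdFP FPQ.
exact: is_syzygy_fingen FPQ.
Qed.

Lemma fun_dell_le k n X : fingen X -> dell_le k n X -> dell_le k (p + n) (F X).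
Proof.
move=> X_fg [Y [U [V [Y_fg XU YV UV]]]].
have FX_fg := fun_fingen F X_fg; have FY_fg := fun_fingen F Y_fg.
have FU_fg := fun_fingen F (is_syzygy_fingen noethA X_fg XU).
have FV_fg := fun_fingen F (is_syzygy_fingen noethA Y_fg YV).
have [X' FXX'] := is_syzygy_ex noethB (p + n) FX_fg.
have [Y' FYY'] := is_syzygy_ex noethB (p + (n + k)) FY_fg.
have [W FUW] := is_syzygy_ex noethB p FU_fg.
have [W' FVW'] := is_syzygy_ex noethB p FV_fg.
exists (F Y), X', Y'; split=> //; first by rewrite -addnA.
apply: sretract_trans (fun_syzygy X_fg XU FUW FXX').2 _.
apply: sretract_trans (fun_sretract UV FUW FVW') _.
exact: (fun_syzygy Y_fg YV FVW' FYY').1.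
Qed.

Lemma fun_ddell_le m k X : fingen X -> ddell_le m k X -> ddell_le (p + m) k (F X).
Proof.
elim: m k X => [|m IHm] k X X_fg [dX|] //.
- by apply: dell_le_ddell_le; apply: fun_dell_le.
- by apply: dell_le_ddell_le; apply: fun_dell_le.
move=> [D [C [D_fg C_fg ex dC dD]]]; rewrite addnS; right; exists (F D), (F C).
split; [exact: fun_fingen|exact: fun_fingen|exact: fun_short_exact| |exact: IHm].
by rewrite -addnS; apply: fun_dell_le.
Qed.

End Functor.

(** * Modules of finite length *)

Section Length.
Variable R : pzRingType.
Implicit Types A B C D M N P Q U V W X Y Z : lmodType R.

Lemma submodB M (S : {pred M}) x y :
  submod_closed S -> x \in S -> y \in S -> x - y \in S.
Proof. by move=> clS Sx Sy; rewrite addrC -scaleN1r; apply: clS.2. Qed.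

Lemma submodZ M (S : {pred M}) a x : submod_closed S -> x \in S -> a *: x \in S.
Proof. by move=> clS Sx; rewrite -[_ *: _]addr0; apply: clS.2 => //; apply: clS.1. Qed.

Lemma submod_sum M (S : {pred M}) (I : Type) (r : seq I) (F : I -> M) :
  submod_closed S -> (forall i, F i \in S) -> \sum_(i <- r) F i \in S.
Proof.
move=> clS SF; elim/big_ind: _ => [|x y Sx Sy|//]; first exact: clS.1.
by rewrite -[x]scale1r; apply: clS.2.
Qed.

Lemma cyclic_submod_closed M (x : M) :
  submod_closed (fun y : M => `[< exists a, y = a *: x >]).
Proof.
split; first by apply/asboolP; exists 0; rewrite scale0r.
move=> c y z /asboolP[a ->] /asboolP[b ->]; apply/asboolP.
by exists (c * a + b); rewrite scalerDl scalerA.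
Qed.

Lemma simple_cyclic M (x : M) : simple_mod M -> x != 0 ->
  forall y, exists a, y = a *: x.
Proof.
move=> [_ /(_ _ (cyclic_submod_closed x))[Sx x_neq0|Sx _ y]]; last exact/asboolP/Sx.
by case/eqP: x_neq0; apply: Sx; apply/asboolP; exists 1; rewrite scale1r.
Qed.

Lemma simple_fingen M : simple_mod M -> fingen M.
Proof.
move=> Msimp; have [[x x_neq0] _] := Msimp; exists 1%N, (fun=> x) => y.
have [a ->] := simple_cyclic Msimp x_neq0 y.
by exists (fun=> a); rewrite big_ord1.
Qed.

Lemma simple_iso M N (f : {linear M -> N}) :
  injective f -> surj f -> simple_mod M -> simple_mod N.
Proof.
move=> f_inj f_surj [[x x_neq0] Msimp]; split.
  by exists (f x); rewrite -(linear0 f) (inj_eq f_inj).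
move=> S clS; have clT : submod_closed (fun x => f x \in S).
  split; first by rewrite unfold_in linear0; apply: clS.1.
  by move=> a u v; rewrite !unfold_in linearP; apply: clS.2.
case: (Msimp _ clT) => [T0|T1]; [left|right] => y; have [u <-] := f_surj y.
  by move=> Sfu; rewrite (T0 u Sfu) linear0.
exact: T1.
Qed.

Lemma to_coker_linear M N (f : {linear M -> N}) : linear (to_coker f).
Proof. by move=> a x y; rewrite to_cokerD -coker_actE. Qed.

Lemma coker_exact M N (f : {linear M -> N}) : injective f ->
  exists2 g : {linear N -> coker f}, exact3 f g & g =1 to_coker f.
Proof.
move=> f_inj; have [g gE] := linear_ex (@to_coker_linear _ _ f); exists g => //.
split=> // [y|x]; first by exists (of_coker y); rewrite gE of_cokerK.
have -> : 0 = to_coker f 0 by rewrite -gE linear0.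
rewrite gE; split=> [/to_coker_eq|[z fz]]; first by rewrite subr0.
by apply/to_coker_eq; exists z; rewrite subr0.
Qed.

Lemma submod_incl M (S T : {pred M}) (clS : submod_closed S) (clT : submod_closed T) :
  {subset S <= T} -> exists2 f : {linear submod clS -> submod clT},
    injective f & forall x, submod_val (f x) = submod_val x.
Proof.
move=> ST; have [|f fE] := @lift_inj _ _ _ _ (@submod_val _ _ _ clT)
  (@submod_val _ _ _ clS) (@submod_val_inj _ _ _ clT).
  by move=> x; apply/submod_valE/ST/submod_valP.
exists f => // x y /(congr1 (@submod_val _ _ _ clT)); rewrite !fE.
exact: submod_val_inj.
Qed.

Lemma submod_setT_iso M (S : {pred M}) (clS : submod_closed S) :
  (forall x, x \in S) ->
  exists2 f : {linear submod clS -> M}, injective f & surj f.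
Proof.
move=> ST; exists (@submod_val _ _ _ clS); first exact: submod_val_inj.
by move=> x; apply: submod_valE.
Qed.

(** A submodule of the quotient pulls back to a submodule between [S] and [T], to which maximality
    applies. *)
Lemma submod_quot_simple M (S T : {pred M}) (clS : submod_closed S)
    (clT : submod_closed T) (f : {linear submod clS -> submod clT}) :
  (forall x, submod_val (f x) = submod_val x) -> ~ {subset T <= S} ->
  (forall Q : {pred M}, submod_closed Q -> {subset S <= Q} -> {subset Q <= T} ->
    {subset Q <= S} \/ {subset T <= Q}) ->
  simple_mod (coker f).
Proof.
move=> fE nTS max_S.
have f_inj : injective f.
  by move=> x y /(congr1 (@submod_val _ _ _ clT)); rewrite !fE; apply: submod_val_inj.
have [g [_ g_surj fg] _] := coker_exact f_inj.
have in_S x : submod_val x \in S -> g x = 0.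
  by move=> /(@submod_valE _ _ _ clS)[z zE]; apply/fg; exists z;
     apply: submod_val_inj; rewrite fE.
split.
  apply: contra_notP nTS => /forallNP g0 y Ty.
  have [x <-] := @submod_valE _ _ _ clT _ Ty.
  have /negP/negPn/eqP/fg[z <-] := g0 (g x).
  by rewrite fE; apply: submod_valP.
move=> U clU; pose Q : {pred M} := fun x => `[< exists2 y, submod_val y = x & g y \in U >].
have clQ : submod_closed Q.
  split; first by apply/asboolP; exists 0; [rewrite linear0 | rewrite linear0; apply: clU.1].
  move=> a _ _ /asboolP[x <- Ux] /asboolP[y <- Uy]; apply/asboolP.
  by exists (a *: x + y); rewrite linearP //; apply: clU.2.
have SQ : {subset S <= Q}.
  move=> x Sx; have [z zE] := @submod_valE _ _ _ clS _ Sx.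
  apply/asboolP; exists (f z); first by rewrite fE.
  by rewrite in_S ?fE ?zE //; apply: clU.1.
have QT : {subset Q <= T} by move=> _ /asboolP[x <- _]; apply: submod_valP.
case: (max_S Q clQ SQ QT) => [QS|TQ]; [left|right] => y; have [x <-] := g_surj y.
  by move=> Ugx; apply/in_S/QS/asboolP; exists x.
have /TQ/asboolP[x' /submod_val_inj -> //] := submod_valP x.
Qed.

(** The induction starts at length one: a bound [n * D.+1 - 1] obtained from the zero module by
    extensions would be one unit too large. *)
Lemma composition_ind (Pr : nat -> lmodType R -> Prop) M n S :
  (forall i X Y (f : {linear X -> Y}), injective f -> surj f -> Pr i X -> Pr i Y) ->
  (forall X, simple_mod X -> Pr 1%N X) ->
  (forall i A B C, short_exact A B C -> simple_mod C -> Pr i.+1 A -> Pr i.+2 B) ->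
  @composition_series R M n S -> (0 < n)%N -> Pr n M.
Proof.
move=> Pr_iso Pr1 PrS [clS S0 Sn max_S] n_gt0.
suff PrSi i : (0 < i <= n)%N -> Pr i (submod (clS i)).
  have [f f_inj f_surj] := submod_setT_iso (clS n) Sn.
  by apply: Pr_iso f_inj f_surj _; apply: PrSi; rewrite n_gt0 leqnn.
elim: i => // i IHi /= lt_in; have [Sii nSii maxSi] := max_S i lt_in.
have [f f_inj fE] := submod_incl (clS i) (clS i.+1) Sii.
have simpC := submod_quot_simple fE nSii maxSi.
have [g fg _] := coker_exact f_inj.
case: (posnP i) => [i0|i_gt0]; last first.
  have PrS' j A B C : (0 < j)%N -> short_exact A B C -> simple_mod C -> Pr j A -> Pr j.+1 B.
    by case: j => // j _; apply: PrS.
  apply: (PrS' _ _ _ _ i_gt0 _ simpC); first by exists f, g.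
  by apply: IHi; rewrite i_gt0 ltnW.
(* For the first layer the submodule divided out is zero, so the quotient map is an isomorphism. *)
have [_ g_surj gE] := fg.
have g_inj : injective g.
  move=> x y gxy; apply/eqP; rewrite -subr_eq0; apply/eqP.
  have /gE[z <-] : g (x - y) = 0 by rewrite linearB gxy subrr.
  suff -> : z = 0 by rewrite linear0.
  by apply: submod_val_inj; rewrite linear0; apply: S0; rewrite -i0; apply: submod_valP.
have [h [gK hK]] := iso_inv g_inj g_surj.
have := Pr_iso 1%N _ _ h (can_inj hK) (fun x => ex_intro _ (g x) (gK x)) (Pr1 _ simpC).
by rewrite i0.
Qed.

Lemma comp_length0 M : comp_length M = Some 0%N -> forall x : M, x = 0.
Proof. by move=> /einfP[S [_ S0 Sn _]] x; apply: S0. Qed.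

Lemma comp_length_ind (Pr : nat -> lmodType R -> Prop) M n :
  (forall i X Y (f : {linear X -> Y}), injective f -> surj f -> Pr i X -> Pr i Y) ->
  (forall X, simple_mod X -> Pr 1%N X) ->
  (forall i A B C, short_exact A B C -> simple_mod C -> Pr i.+1 A -> Pr i.+2 B) ->
  comp_length M = Some n -> (0 < n)%N -> Pr n M.
Proof. by move=> Pr_iso Pr1 PrS /einfP[S MS]; apply: composition_ind MS. Qed.

Lemma comp_length_ddell_le (D k n : nat) M : noetherian R ->
  (forall X, simple_mod X -> ddell_le D k X) -> comp_length M = Some n ->
  (0 < n)%N -> fingen M /\ ddell_le (n * D.+1).-1 k M.
Proof.
move=> noethR simpD; apply: (comp_length_ind
  (Pr := fun n M => fingen M /\ ddell_le (n * D.+1).-1 k M)).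
- move=> i X Y f f_inj f_surj [X_fg dX]; split; first exact: fingen_surj f_surj X_fg.
  by apply: (ddell_le_iso noethR f_inj f_surj) dX.
- by move=> X Xsimp; rewrite mul1n; split; [apply: simple_fingen | apply: simpD].
move=> i A B C ex Csimp [A_fg dA]; have C_fg := simple_fingen Csimp.
split; first exact: fingen_ext ex A_fg C_fg.
have := ddell_le_ext noethR A_fg C_fg ex dA (simpD _ Csimp).
by rewrite [(i.+2 * _)%N]mulSn [(i.+1 * _)%N]mulSn !addSn /= !addnS addnC addnA.
Qed.

End Length.

(** * Linear algebra over the ground field and devissage *)

Section Field.
Variable K : fieldType.

Definition span_by (M : lmodType K) n (g : 'I_n -> M) (x : M) : Prop :=
  exists c : 'I_n -> K, x = \sum_i c i *: g i.

Lemma span_by_closed (M : lmodType K) n (g : 'I_n -> M) :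
  submod_closed (fun x => `[< span_by g x >] : bool).
Proof.
split; first by apply/asboolP; exists (fun=> 0); rewrite big1 // => i _; rewrite scale0r.
move=> a _ _ /asboolP[c ->] /asboolP[d ->]; apply/asboolP.
exists (fun i => a * c i + d i); rewrite scaler_sumr -big_split.
by apply: eq_bigr => i _; rewrite scalerDl scalerA.
Qed.

Lemma subspace_span (M : lmodType K) n (g : 'I_n -> M) (S : {pred M}) :
  submod_closed S -> (forall x, x \in S -> span_by g x) ->
  exists m (h : 'I_m -> M), [/\ (m <= n)%N, forall i, h i \in S,
    forall x, x \in S -> span_by h x & m = n -> forall i, g i \in S].
Proof.
elim: n g S => [|n IHn] g S clS Sg; first by exists 0%N, g; split=> // [[]|_ []].
pose g' := g \o lift ord0.
have [Sg'|] := pselect (forall x, x \in S -> span_by g' x).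
  have [m [h [le_mn hS Sh _]]] := IHn g' S clS Sg'.
  by exists m, h; split=> // [|mE]; [apply: leqW | rewrite mE ltnn in le_mn].
move=> /existsNP[x0 /not_implyP[Sx0 nx0]].
have [c0 x0E] := Sg _ Sx0.
have c0_neq0 : c0 ord0 != 0.
  apply/eqP => c00; case: nx0; exists (c0 \o lift ord0).
  by rewrite x0E big_ord_recl c00 scale0r add0r.
pose S' : {pred M} := fun x => (x \in S) && `[< span_by g' x >].
have clS' : submod_closed S'.
  have [sp0 spD] := span_by_closed g'.
  split; first by apply/andP; split; [apply: clS.1 | apply: sp0].
  move=> a x y /andP[Sx gx] /andP[Sy gy]; apply/andP; split.
    exact: clS.2.
  exact: spD.
have [|m [h [le_mn hS Sh hE]]] := IHn g' S' clS'.
  by move=> x /andP[_ /asboolP].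
pose h' (i : 'I_m.+1) := if unlift ord0 i is Some j then h j else x0.
have h'0 : h' ord0 = x0 by rewrite /h' unlift_none.
have h'S j : h' (lift ord0 j) = h j by rewrite /h' liftK.
exists m.+1, h'; split=> // [i|x Sx|[mn] i].
- case: (unliftP ord0 i) => [j ->|->]; rewrite ?h'0 ?h'S //.
  by have /andP[] := hS j.
- have [c xE] := Sg _ Sx; pose a := c ord0 / c0 ord0.
  have /Sh[d dE] : x - a *: x0 \in S'.
    apply/andP; split; first by rewrite submodB // submodZ.
    apply/asboolP; exists (fun i => c (lift ord0 i) - a * c0 (lift ord0 i)).
    rewrite xE x0E !big_ord_recl scalerDr scalerA divfK // opprD addrACA subrr add0r.
    rewrite scaler_sumr -sumrB; apply: eq_bigr => i _.
    by rewrite scalerBl scalerA.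
  exists (fun i => if unlift ord0 i is Some j then d j else a).
  rewrite big_ord_recl h'0 unlift_none.
  under eq_bigr do rewrite liftK h'S.
  by rewrite -dE addrC subrK.
have gS j : g (lift ord0 j) \in S by have /andP[] := hE mn j.
case: (unliftP ord0 i) => [j ->|->] //.
have -> : g ord0 = (c0 ord0)^-1 *: (x0 - \sum_j c0 (lift ord0 j) *: g (lift ord0 j)).
  by rewrite [in RHS]x0E big_ord_recl addrK scalerA mulVf // scale1r.
apply: submodZ => //; apply: submodB => //; apply: submod_sum => // j.
exact: submodZ.
Qed.

(** A nonzero element of the kernel has a nonzero coefficient, and the corresponding generator can
    be eliminated. *)
Lemma quotient_span (M N : lmodType K) (g : {linear M -> N}) n (w : 'I_n.+1 -> M) x :
  surj g -> (forall y, span_by w y) -> x != 0 -> g x = 0 ->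
  exists v : 'I_n -> N, forall y, span_by v y.
Proof.
move=> g_surj genM x_neq0 gx0; have [c xE] := genM x.
have [j cj] : exists j, c j != 0.
  apply: contra_neqP x_neq0 => /forallNP c0; rewrite xE big1 // => i _.
  by have /negP/negPn/eqP-> := c0 i; rewrite scale0r.
exists (g \o (w \o lift j)) => y; have [z <-] := g_surj y.
have [b zE] := genM z; pose a := b j / c j.
exists (fun i => b (lift j i) - a * c (lift j i)).
have -> : g z = g (z - a *: x) by rewrite linearB linearZ /= gx0 scaler0 subr0.
rewrite zE xE scaler_sumr -sumrB linear_sum (bigD1_ord j) //=.
rewrite scalerA divfK // subrr linear0 add0r; apply: eq_bigr => i _.
by rewrite scalerA -scalerBl linearZ.
Qed.

Variable R : pzRingType.
Implicit Types M N : lmodType R.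

Variable iota : {rmorphism K -> R}.
Hypothesis R_fin : fingen (restr iota R^o : lmodType K).

Definition Kmod M : lmodType K := restr iota M.

Lemma fingen_Kmod M : fingen M -> fingen (Kmod M).
Proof.
move=> [n [g genM]]; have [m [r genR]] := R_fin.
apply: (@fingen_fin K (Kmod M) ('I_n * 'I_m)%type
  (fun ij => (r ij.2 : R) *: (g ij.1 : M))).
move=> x; have [c ->] := genM x; have [d dE] := choice (fun i => genR (c i)).
exists (fun ij => d ij.1 ij.2); 
rewrite -(pair_bigA _ (fun i j => d i j *: ((r j : R) *: (g i : M) : Kmod M))) /=.
apply: eq_bigr => i _; rewrite {1}dE scaler_suml; apply: eq_bigr => j _.
by rewrite -[LHS]/((iota (d i j) * (r j : R)) *: g i) -scalerA.
Qed.

Lemma Kmod_fingen M : fingen (Kmod M) -> fingen M.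
Proof.
move=> [n [g genM]]; exists n, g => x; have [c ->] := genM x.
by exists (iota \o c).
Qed.

Lemma Kmod_submod_closed M (S : {pred M}) :
  submod_closed S -> @submod_closed K (Kmod M) S.
Proof. by move=> clS; split; [apply: clS.1 | move=> c x y; apply: clS.2]. Qed.

Lemma finite_noetherian : noetherian R.
Proof.
move=> M N f f_inj /fingen_Kmod[n [g genM]].
have clI : submod_closed (im_pred f).
  split; first by apply/im_predP; exists 0; rewrite linear0.
  move=> a _ _ /im_predP[x <-] /im_predP[y <-]; apply/im_predP.
  by exists (a *: x + y); rewrite linearP.
have [m [h [_ hI Ih _]]] := subspace_span (Kmod_submod_closed clI) (fun x _ => genM x).
have [u uE] := choice (fun i => elimT (im_predP f (h i)) (hI i)).
exists m, u => x; have [|c cE] := Ih (f x); first by apply/im_predP; exists x.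
exists (iota \o c); apply: f_inj; rewrite cE linear_sum.
by apply: eq_bigr => i _; rewrite linearZ uE.
Qed.

(* Induction on the dimension over [K]. *)
Lemma finite_length_ind (Pr : lmodType R -> Prop) M :
  (forall X : lmodType R, (forall x : X, x = 0) -> Pr X) ->
  (forall X : lmodType R, simple_mod X -> Pr X) ->
  (forall A B C : lmodType R, fingen A -> fingen C -> short_exact A B C -> Pr A -> Pr C -> Pr B) ->
  fingen M -> Pr M.
Proof.
move=> Pr0 Pr1 PrE /fingen_Kmod[n]; elim/ltn_ind: n M => n IHn M [w genM].
have [Msimp|] := pselect (simple_mod M); first exact: Pr1.
have [M0 _|] := pselect (forall x : M, x = 0); first exact: Pr0.
move=> /existsNP[x0 /eqP x0_neq0] /not_andP[|/existsNP[S]]; first by case; exists x0.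
move=> /not_implyP[clS /not_orP[/existsNP[x /not_implyP[Sx /eqP x_neq0]] nST]].
have [m [h [le_mn hS Sh mnE]]] := subspace_span (Kmod_submod_closed clS) (fun x _ => genM x).
have lt_mn : (m < n)%N.
  (* A family of full size would put every generator of [M] into the proper submodule [S]. *)
  rewrite ltn_neqAle le_mn andbT; apply/eqP => /mnE wS; apply: nST => y.
  have [c ->] := genM y; apply: (@submod_sum K (Kmod M) S _ _ _ (Kmod_submod_closed clS)) => i.
  exact: (@submodZ K (Kmod M) S _ _ (Kmod_submod_closed clS)).
case: n => [|n] in w genM IHn le_mn mnE lt_mn * => //.
have [g [sinj g_surj sg] _] := coker_exact (@submod_val_inj _ _ _ clS).
have [v genQ] : exists v : 'I_n -> Kmod (coker (@submod_val _ _ _ clS)),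
    forall y, span_by v y.
  have [g' g'E] := @linear_ex K (Kmod M) (Kmod (coker (@submod_val _ _ _ clS))) g
    (fun c y z => linearP g (iota c) y z).
  apply: (@quotient_span _ _ g' n w x) => //; last first.
    rewrite g'E; apply/sg; exact: submod_valE.
  by move=> y; have [z <-] := g_surj y; exists z; rewrite g'E.
have [u uE] := choice (fun i => @submod_valE _ _ _ clS _ (hS i)).
have genS : forall y : Kmod (submod clS), exists c : 'I_m -> K, y = \sum_i c i *: (u i : Kmod _).
  move=> y; have [c cE] := Sh _ (submod_valP y); exists c.
  apply: submod_val_inj; rewrite cE (linear_sum (@submod_val _ _ _ clS)).
  by apply: eq_bigr => i _; rewrite -[in LHS]uE.
apply: (PrE (submod clS) M (coker (@submod_val _ _ _ clS))).
- by apply: Kmod_fingen; exists m, u.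
- by apply: Kmod_fingen; exists n, v.
- by exists (@submod_val _ _ _ clS), g.
- by apply: (IHn m) => //; exists u.
- by apply: (IHn n) => //; exists v.
Qed.

End Field.

(** * Restriction of scalars *)

Section RestrFunctor.
Variables (A B : pzRingType) (f : {rmorphism A -> B}).
Hypothesis f_surj : surj f.

Definition restr_mor (X Y : lmodType B) (g : {linear X -> Y}) : restr f X -> restr f Y := g.

Fact restr_mor_linear X Y g : linear (@restr_mor X Y g).
Proof. by move=> a x y; apply: (linearP g (f a)). Qed.
HB.instance Definition _ X Y g := GRing.isLinear.Build A (restr f X) (restr f Y)
  *:%R (@restr_mor X Y g) (@restr_mor_linear X Y g).

Lemma restr_fingen (X : lmodType B) : fingen X -> fingen (restr f X : lmodType A).
Proof.
move=> [n [g genX]]; exists n, g => x; have [c ->] := genX x.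
have [d dE] := choice (fun i => f_surj (c i)); exists d.
by apply: eq_bigr => i _; rewrite -dE.
Qed.

Definition restr_functor : exact_functor B A.
Proof.
exists (fun X => restr f X : lmodType A) (fun X Y g => @restr_mor X Y g).
- by move=> X g gE x; apply: gE.
- by move=> X Y Z g h k kE x; apply: kE.
- by move=> X Y g h k kE x; apply: kE.
- by move=> X Y Z g h [g_inj h_surj gh]; split.
- exact: restr_fingen.
Defined.

End RestrFunctor.

(** * Truncation by an idempotent and its right adjoint *)

Section Peirce.
Variables (R : pzRingType) (e : R) (he : e * e = e).
Local Notation E := (corner he).
Implicit Types X Y Z : lmodType R^c.

Fact trunc_mor_subproof X Y (f : {linear X -> Y}) (x : trunc X he) :
  f (val x) \in @trunc_pred R e Y.
Proof. by rewrite unfold_in -linearZ truncE. Qed.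
Definition trunc_mor X Y (f : {linear X -> Y}) (x : trunc X he) : trunc Y he :=
  Sub (f (val x)) (trunc_mor_subproof f x).

Fact trunc_mor_linear X Y f : linear (@trunc_mor X Y f).
Proof. by move=> a x y; apply: val_inj; rewrite SubK; apply: (linearP f). Qed.
HB.instance Definition _ X Y f := GRing.isLinear.Build E^c (trunc X he)
  (trunc Y he) *:%R (@trunc_mor X Y f) (@trunc_mor_linear X Y f).

Lemma val_trunc_mor X Y (f : {linear X -> Y}) x : val (trunc_mor f x) = f (val x).
Proof. by []. Qed.

Lemma trunc_exact X Y Z (f : {linear X -> Y}) (g : {linear Y -> Z}) :
  exact3 f g -> exact3 (trunc_mor f : {linear _ -> _}) (trunc_mor g : {linear _ -> _}).
Proof.
move=> [f_inj g_surj fg]; split.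
- by move=> x y /(congr1 val) /f_inj /val_inj.
- move=> z; have [y yE] := g_surj (val z).
  have ye : (e : R^c) *: y \in @trunc_pred R e Y.
    by rewrite unfold_in scalerA -[(e : R^c) * e]/(e * e : R) he.
  exists (Sub ((e : R^c) *: y) ye : trunc Y he); apply: val_inj.
  by rewrite val_trunc_mor SubK linearZ /= yE truncE.
move=> y; split=> [/(congr1 val) /fg[x xE]|[x <-]]; last first.
  by apply: val_inj; apply/fg; exists (val x).
have xe : x \in @trunc_pred R e X.
  by rewrite unfold_in; apply/eqP/f_inj; rewrite linearZ /= xE truncE.
by exists (Sub x xe : trunc X he); apply: val_inj.
Qed.

Hypothesis Re_fg : fingen (Re he).

(** As [x = x e], the coefficients of [x] may be taken in [Re], where they are combinations of the
    generators [w j]; the products of [m i] by [w j] thus generate. *)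
Lemma trunc_fingen X : fingen X -> fingen (trunc X he : lmodType E^c).
Proof.
move=> [n [m genX]]; have [r [w genRe]] := Re_fg.
apply: (@fingen_fin E^c (trunc X he) ('I_n * 'I_r)%type
  (fun ij => unit_app (m ij.1) (w ij.2))) => x.
 have [b xE] := genX (val x).
have [c cE] := choice (fun i => genRe (Re_elt he (b i))).
exists (fun ij => c ij.1 ij.2).
rewrite -(pair_bigA _ (fun i j => c i j *: unit_app (m i) (w j))) /=.
transitivity (\sum_i unit_app (m i) (Re_elt he (b i))).
  apply: val_inj; rewrite (raddf_sum (val : {additive trunc X he -> X})) /=.
  rewrite -(truncE x) xE scaler_sumr; apply: eq_bigr => i _.
  by rewrite scalerA.
by apply: eq_bigr => i _; rewrite {1}cE linear_sum; apply: eq_bigr => j _; rewrite linearZ.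
Qed.

Definition trunc_functor : exact_functor R^c E^c.
Proof.
exists (fun X => trunc X he : lmodType E^c) (fun X Y f => @trunc_mor X Y f).
- by move=> X f fE x; apply: val_inj; apply: fE.
- by move=> X Y Z f g h hE x; apply: val_inj; apply: hE.
- by move=> X Y f g h hE x; apply: val_inj; apply: hE.
- exact: trunc_exact.
- exact: trunc_fingen.
Defined.

(** * The functor Hom_E(Re, -) *)

Section Hom.
Implicit Types U V W : lmodType E^c.

Definition hom_mor U V (g : {linear U -> V}) (f : Hom_Re U) : Hom_Re V :=
  g \o hom_app f : {linear Re he -> V}.

Fact hom_mor_linear U V g : linear (@hom_mor U V g).
Proof.
move=> a f f'; apply: hom_eqP => x; rewrite hom_appD hom_appZ.
by rewrite -[LHS]/(g (hom_app f (Re_act (a : R) x) + hom_app f' x)) linearD.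
Qed.
HB.instance Definition _ U V g := GRing.isLinear.Build R^c (Hom_Re U)
  (Hom_Re V) *:%R (@hom_mor U V g) (@hom_mor_linear U V g).

Lemma hom_morE U V (g : {linear U -> V}) f x : hom_app (hom_mor g f) x = g (hom_app f x).
Proof. by []. Qed.

Lemma hom_exact U V W (f : {linear U -> V}) (g : {linear V -> W}) :
  projective (Re he) -> exact3 f g ->
  exact3 (hom_mor f : {linear _ -> _}) (hom_mor g : {linear _ -> _}).
Proof.
move=> Re_proj [f_inj g_surj fg]; split.
- move=> u v uv; apply: hom_eqP => x; apply: f_inj.
  by rewrite -!hom_morE uv.
- move=> w; have [v vE] := Re_proj _ _ g (hom_app w) g_surj.
  by exists v; apply: hom_eqP => x; rewrite hom_morE -vE.
move=> v; split=> [gv|[u <-]]; last first.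
  by apply: hom_eqP => x; rewrite !hom_morE; apply/fg; eexists.
have [x|u uE] := @lift_inj _ _ _ _ f (hom_app v) f_inj.
  by apply/fg; rewrite -hom_morE gv.
by exists u; apply: hom_eqP => x; rewrite hom_morE -uE.
Qed.

Hypothesis Re_proj : projective (Re he).
Hypothesis hom_fingen : forall U, fingen U -> fingen (Hom_Re U : lmodType R^c).

Definition hom_functor : exact_functor E^c R^c.
Proof.
exists (fun U => Hom_Re U : lmodType R^c) (fun U V f => @hom_mor U V f).
- by move=> U f fE x; apply: hom_eqP => y; apply: fE.
- by move=> U V W f g h hE x; apply: hom_eqP => y; apply: hE.
- by move=> U V f g h hE x; apply: hom_eqP => y; apply: hE.
- by move=> U V W f g; apply: hom_exact.
- exact: hom_fingen.
Defined.

End Hom.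

(** If [y = x a] and [e] fixes both [x] and [y], then [y = x (e a e)]; every nonzero element of the
    truncation therefore generates it. *)
Lemma trunc_simple S : simple_mod S -> (exists x : trunc S he, x != 0) ->
  simple_mod (trunc S he : lmodType E^c).
Proof.
move=> Ssimp nz; split=> // T clT.
have [|/existsNP[x /not_implyP[Tx /eqP x_neq0]]] := pselect (forall x, x \in T -> x = 0).
  by left.
right=> y; have [|a yE] := simple_cyclic Ssimp (_ : val x != 0) (val y).
  by rewrite -(raddf0 (val : {additive trunc S he -> S})) (inj_eq val_inj).
have ae : e * (a : R) * e \in corner_pred e.
  by rewrite unfold_in !mulrA he -!mulrA he.
have -> : y = ((Sub (e * (a : R) * e) ae : E) : E^c) *: x.
  apply: val_inj; rewrite -[RHS]/(((e * (a : R) * e : R) : R^c) *: val x).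
  rewrite -[((e * (a : R) * e : R) : R^c)]/((e : R^c) * (a * (e : R^c))).
  by rewrite -!scalerA truncE -yE truncE.
by apply: submodZ.
Qed.

(** The kernel is a submodule of a simple module and is not everything, since evaluating the image
    of an [e]-fixed [x] at [e] gives back [x]. *)
Lemma adj_unit_inj S : simple_mod S -> (exists x : trunc S he, x != 0) ->
  injective (adj_unit he (M := S)).
Proof.
move=> [_ Ssimp] [x x_neq0] y z yz.
apply/eqP; rewrite -subr_eq0; apply/eqP.
have w0 : adj_unit he (y - z) = 0 by rewrite raddfB /= yz subrr.
case: (Ssimp _ (ker_submod_closed (adj_unit he (M := S) : {linear _ -> _}))) => [|all0].
  by apply; apply/eqP.
have /eqP x0 := all0 (val x).
have {}x0 : ((1 * e : R) : R^c) *: val x = 0.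
  exact: (congr1 (fun f : Hom_Re (trunc S he) => val (hom_app f (Re_elt he 1))) x0).
rewrite mul1r in x0; case/eqP: x_neq0; apply: val_inj.
exact: etrans (esym (truncE x)) x0.
Qed.

Section TensorTrunc.
Variable T : lmodType E^c.
Implicit Types (t : T) (u : eR he).

Fact eR_unit_subproof : e \in eR_pred e.
Proof. by rewrite unfold_in he. Qed.
Definition eR_unit : eR he := Sub e eR_unit_subproof.

Fact eR_corner_subproof u : val u * e \in corner_pred e.
Proof. by rewrite unfold_in mulrA eR_e -mulrA he. Qed.
Definition eR_corner u : E := Sub (val u * e) (eR_corner_subproof u).

Lemma eR_cornerE u : eR_corner u *: eR_unit = eR_ract u e.
Proof. by apply: val_inj; rewrite !SubK -mulrA he. Qed.

Lemma balanced_corner : balanced (fun t u => (eR_corner u : E^c) *: t).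
Proof.
split=> [t t' u|t u u'|t a u]; first by rewrite scalerDr.
  rewrite -scalerDl; congr (_ *: _); apply: val_inj; exact: mulrDl.
rewrite scalerA; congr (_ *: _); apply: val_inj => /=.
by rewrite mulrA.
Qed.

Lemma balanced0 (A : zmodType) (beta : T -> eR he -> A) u :
  balanced beta -> beta 0 u = 0.
Proof. by move=> [bl _ _]; apply: (addrI (beta 0 u)); rewrite -bl !addr0. Qed.

Definition pure t : tens T := tens_class [:: (t, eR_unit)].

Lemma tens_eval1 (A : zmodType) (beta : T -> eR he -> A) t u :
  tens_eval beta [:: (t, u)] = beta t u.
Proof. exact: big_seq1. Qed.

Lemma tens_actE (a : R^c) s : a *: tens_class s = tens_class (tens_act_seq (a : R) s) :> tens T.
Proof.
apply: tens_ext => A beta b; rewrite tens_eval_reprZ // tens_eval_repr; last first.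
  exact: balanced_ract.
by rewrite tens_eval_repr // tens_eval_act.
Qed.

Fact pure_subproof t : pure t \in @trunc_pred R e (tens T).
Proof.
rewrite unfold_in /pure tens_actE; apply/eqP; congr tens_class.
by congr [:: (_, _)]; apply: val_inj; rewrite SubK /= he.
Qed.
Definition to_trunc_tens t : trunc (tens T) he := Sub (pure t) (pure_subproof t).

Lemma to_trunc_tens_linear : linear to_trunc_tens.
Proof.
move=> a t t'; apply: val_inj.
rewrite -[RHS]/(((val (a : E) : R) : R^c) *: pure t + pure t') /pure.
rewrite tens_actE; apply: tens_ext => A beta b.
rewrite tens_eval_reprD // !tens_eval_repr // tens_eval_act !tens_eval1.
case: (b) => bl _ bm; rewrite bl bm; congr (beta _ _ + _); apply: val_inj.
by rewrite !SubK /= corner_er corner_el.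
Qed.

(** The inverse sends [t] to the tensor of [t] and [e]. It is injective because the balanced map
    taking [(t, u)] to [t (u e)] recovers [t]; it is surjective because multiplying the tensor of
    [t] and [u] by [e] gives that of [t (u e)] and [e]. *)
Lemma to_trunc_tens_iso : exists2 f : {linear trunc (tens T) he -> T}, injective f & surj f.
Proof.
have [h hE] := linear_ex to_trunc_tens_linear.
have h_inj : injective h.
  move=> t t'; rewrite !hE => /(congr1 val) /tens_classP /(_ _ _ balanced_corner).
  have e1 : (eR_corner eR_unit : E^c) = 1 by apply: val_inj; rewrite /= he.
  by rewrite !tens_eval1 e1 !scale1r.
have h_surj : surj h.
  move=> y; pose s := tens_repr (val y).
  exists (\sum_(p <- s) (eR_corner p.2 : E^c) *: p.1); rewrite hE; apply: val_inj.
  rewrite -[RHS]truncE -(tens_reprK (val y)) tens_actE.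
  apply/tens_classP => A beta b; rewrite tens_eval1 tens_eval_act.
  case: (b) => bl _ bm.
  rewrite (big_morph (beta^~ eR_unit) (fun t t' => bl t t' _) (balanced0 _ b)).
  by apply: eq_bigr => p _; rewrite bm eR_cornerE.
have [g [hK gK]] := iso_inv h_inj h_surj.
by exists g; [apply: can_inj gK | move=> t; exists (h t); rewrite hK].
Qed.

End TensorTrunc.

(** * Modules annihilated by the idempotent *)

Section Annihilated.
Variable M : lmodType R^c.
Hypothesis annM : forall (a : R) (y : M), a \in ideal_pred e -> (a : R^c) *: y = 0.

(** The annihilation proof is recorded in the type because the action of the quotient ring, defined
    through representatives, depends on it. *)
Definition annih_mod of (forall (a : R) (y : M), a \in ideal_pred e -> (a : R^c) *: y = 0) :
  Type := M.
Local Notation Q := (annih_mod annM).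
HB.instance Definition _ := GRing.Zmodule.on Q.

Definition annih_act (a : (rquot e)^c) (y : Q) : Q :=
  (of_rquot (a : rquot e) : R^c) *: (y : M).

Lemma annih_actE (a : R) (y : Q) : annih_act (to_rquot e a) y = (a : R^c) *: (y : M).
Proof.
apply/eqP; rewrite -subr_eq0; apply/eqP; rewrite /annih_act.
have /to_rquot_eq h := of_rquotK (to_rquot e a).
by rewrite -[RHS](annM y h) scalerBl.
Qed.

Fact annih_actA a b y : annih_act a (annih_act b y) = annih_act (a * b) y.
Proof.
rewrite -(of_rquotK a) -(of_rquotK b); set a' := of_rquot a; set b' := of_rquot b.
transitivity (annih_act (to_rquot e (b' * a')) y); first by rewrite !annih_actE scalerA.
by congr annih_act; apply: (rmorphM (to_rquot e)).
Qed.
Fact annih_act1 : left_id 1 annih_act.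
Proof. by move=> y; rewrite -[1]/(to_rquot e 1) annih_actE scale1r. Qed.
Fact annih_actDr : right_distributive annih_act +%R.
Proof. by move=> a x y; apply: scalerDr. Qed.
Fact annih_actDl y : {morph annih_act^~ y : a b / a + b}.
Proof.
move=> a b; rewrite -(of_rquotK a) -(of_rquotK b).
set a' := of_rquot a; set b' := of_rquot b.
transitivity (annih_act (to_rquot e (a' + b')) y).
  by congr annih_act; apply/esym/(rmorphD (to_rquot e)).
by rewrite !annih_actE -scalerDl.
Qed.
HB.instance Definition _ := GRing.Zmodule_isLmodule.Build (rquot e)^c Q
  annih_actA annih_act1 annih_actDr annih_actDl.

Lemma annih_iso : exists2 f : {linear rquot_incl (Q : lmodType (rquot e)^c) -> M},
  injective f & surj f.
Proof.
have lin_id : linear (fun x : rquot_incl (Q : lmodType (rquot e)^c) => (x : M)).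
  move=> a x y; rewrite -[LHS]/(annih_act (to_rquot e (a : R)) x + y).
  by rewrite annih_actE.
have [f fE] := linear_ex lin_id.
by exists f => [x y|x]; [rewrite !fE | exists x; rewrite fE].
Qed.

End Annihilated.

Lemma Y'_quot_iso X : exists2 f : {linear rquot_incl (Y'_quot he X) -> Y' he X},
  injective f & surj f.
Proof.
have lin_id : linear (fun x : rquot_incl (Y'_quot he X) => (x : Y' he X)).
  move=> a x y; rewrite -[LHS]/(Y'_act (to_rquot e (a : R)) x + y).
  by rewrite Y'_actE.
have [f fE] := linear_ex lin_id.
by exists f => [x y|x]; [rewrite !fE | exists x; rewrite fE].
Qed.

(** A generator [b e c] of the ideal acts through [y (b e)], which lies in the truncation. *)
Lemma annih_of_trunc0 X : (forall x : trunc X he, x = 0) ->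
  forall (a : R) (y : X), a \in ideal_pred e -> (a : R^c) *: y = 0.
Proof.
move=> X0 a y /ideal_predP[s ->]; elim: s => [|[b c] s IHs].
  by rewrite big_nil scale0r.
rewrite big_cons -[LHS]/((((b * e * c : R) : R^c) + _) *: y) scalerDl IHs addr0.
rewrite -[((b * e * c : R) : R^c)]/((c : R^c) * ((b * e : R) : R^c)) -scalerA.
have -> : ((b * e : R) : R^c) *: y = 0.
  exact: (congr1 val (X0 (unit_app y (Re_elt he b)))).
exact: scaler0.
Qed.

End Peirce.

(** * Finite-dimensional algebras *)

Section FiniteDimensional.
Variables (K : fieldType) (L : falgType K) (e : L) (he : e * e = e).
Local Notation E := (corner he).

Lemma basis_span : exists n (v : 'I_n -> L),
  forall x, exists c : 'I_n -> K, x = \sum_i c i *: v i.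
Proof.
exists (\dim {:L}), (fun i => (vbasis {:L})`_i) => x.
by exists (fun i => coord (vbasis {:L}) i x); apply/coord_vbasis/memvf.
Qed.

(** With its analogues for the corner and the quotient, this makes modules into vector spaces over
    [K]. *)
Definition scal (c : K) : L^c := (c%:A : L).

Fact scal_zmod : zmod_morphism scal.
Proof. by move=> c d; apply: (@scalerBl _ L). Qed.
Fact scal_monoid : monoid_morphism scal.
Proof.
split=> [|c d]; first exact: (@scale1r _ L).
by rewrite -[RHS]/((d%:A * c%:A) : L) -scalerAl mul1r scalerA mulrC.
Qed.
HB.instance Definition _ := GRing.isZmodMorphism.Build K L^c scal scal_zmod.
HB.instance Definition _ := GRing.isMonoidMorphism.Build K L^c scal scal_monoid.

Lemma scalE (c : K) (x : L) : (scal c : L) * x = c *: x.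
Proof. exact: mulr_algl. Qed.

Lemma scalEr (c : K) (x : L) : x * (scal c : L) = c *: x.
Proof. exact: mulr_algr. Qed.

Lemma noetherian_alg : noetherian L^c.
Proof.
apply: (@finite_noetherian K _ scal); have [n [v spanL]] := basis_span.
exists n, v => x; have [c ->] := spanL x; exists c; apply: eq_bigr => i _.
by rewrite -[RHS]/(v i * (scal (c i) : L)) scalEr.
Qed.

Fact scal_corner_subproof (c : K) : c *: e \in corner_pred e.
Proof. by rewrite unfold_in -scalerAr -scalerAl !he. Qed.
Definition scal_corner (c : K) : E^c := (Sub (c *: e) (scal_corner_subproof c) : E).

Fact scal_corner_zmod : zmod_morphism scal_corner.
Proof. by move=> c d; apply: val_inj; apply: scalerBl. Qed.
Fact scal_corner_monoid : monoid_morphism scal_corner.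
Proof.
split=> [|c d]; apply: val_inj; first exact: scale1r.
by rewrite -[RHS]/((d *: e) * (c *: e)) -scalerAr -scalerAl he scalerA.
Qed.
HB.instance Definition _ :=
  GRing.isZmodMorphism.Build K E^c scal_corner scal_corner_zmod.
HB.instance Definition _ :=
  GRing.isMonoidMorphism.Build K E^c scal_corner scal_corner_monoid.

Fact corner_of_subproof (x : L) : e * x * e \in corner_pred e.
Proof. by rewrite unfold_in !mulrA he -!mulrA he. Qed.
Definition corner_of (x : L) : E := Sub (e * x * e) (corner_of_subproof x).

Lemma corner_of_linear (c : E) (x y : L) :
  corner_of (x * val c + y) = corner_of x * c + corner_of y.
Proof.
apply: val_inj; rewrite -[RHS]/(e * x * e * val c + e * y * e) /= mulrDr mulrDl.
by rewrite !mulrA -(mulrA _ (val c) e) corner_er -(mulrA _ e) corner_el.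
Qed.

Lemma corner_fin : fingen (restr scal_corner (E^c)^o : lmodType K).
Proof.
have [n [v spanL]] := basis_span; exists n, (fun i => corner_of (v i)) => x.
have [c xE] := spanL (val (x : E)); exists c; apply: val_inj.
rewrite (raddf_sum (val : {additive E -> L})) -(cornerE (x : E)) xE.
rewrite mulr_sumr mulr_suml; apply: eq_bigr => i _.
rewrite -[RHS]/((e * v i * e) * (c i *: e)) -!scalerAr -!scalerAl.
by rewrite -!mulrA he.
Qed.

Lemma noetherian_corner : noetherian E^c.
Proof. exact: finite_noetherian corner_fin. Qed.

Definition scal_rquot : K -> (rquot e)^c := to_rquotc e \o scal.
HB.instance Definition _ := GRing.RMorphism.on scal_rquot.

Lemma rquot_fin : fingen (restr scal_rquot ((rquot e)^c)^o : lmodType K).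
Proof.
have [n [v spanL]] := basis_span; exists n, (fun i => to_rquot e (v i)) => x.
have [c xE] := spanL (of_rquot x); exists c; rewrite -[LHS]of_rquotK xE.
rewrite (raddf_sum (to_rquot e)); apply: eq_bigr => i _.
by rewrite -scalEr; apply: to_rquotM.
Qed.

Lemma noetherian_rquot : noetherian (rquot e)^c.
Proof. exact: finite_noetherian rquot_fin. Qed.

Lemma Re_fingen : fingen (Re he).
Proof.
have [n [v spanL]] := basis_span; exists n, (fun i => Re_elt he (v i)) => x.
have [c xE] := spanL (val x); exists (fun i => scal_corner (c i)); apply: val_inj.
rewrite (raddf_sum (val : {additive Re he -> _})) -(Re_e x) xE mulr_suml.
apply: eq_bigr => i _; rewrite -[RHS]/((v i * e) * (c i *: e)).
by rewrite -scalerAr -scalerAl -mulrA he.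
Qed.

Lemma scal_hom (V : lmodType E^c) (c : K) (f : Hom_Re V) x :
  hom_app (scal c *: f) x = scal_corner c *: hom_app f x.
Proof.
rewrite hom_appZ -linearZ; congr (hom_app f _); apply: val_inj.
rewrite -[LHS]/((scal c : L) * (val x : L)) scalE.
by rewrite -[RHS]/((val x : L) * (c *: e)) -scalerAr Re_e.
Qed.

(** For a dual basis [(w, a)] of [Re] one has [f x = sum_i f(w i) (a i x)]. Expanding [f (w i)] over
    [K]-generators [s j] of [V] shows that the maps sending [x] to [s j (a i x)] generate, already
    over [K]. *)
Lemma hom_Re_fingen (V : lmodType E^c) : projective (Re he) -> fingen V ->
  fingen (Hom_Re V : lmodType L^c).
Proof.
move=> Re_proj /(fingen_Kmod corner_fin)[m [s genV]].
have [n [w genRe]] := Re_fingen.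
have [a aE] := projective_dual_basis Re_proj genRe.
have lin_F i j : linear (fun x : Re he => (a i x : E^c) *: (s j : V)).
  by move=> c x y; rewrite linearP scalerDl scalerA.
have [F FE] := choice (fun ij => linear_ex (lin_F ij.1 ij.2)).
apply: (@fingen_fin L^c (Hom_Re V) ('I_n * 'I_m)%type
  (fun ij => F (ij.1, ij.2))) => f.
have [d dE] := choice (fun i => genV (hom_app f (w i))).
exists (fun ij => scal (d ij.1 ij.2)); apply: hom_eqP => x.
have appM : {morph (fun g : Hom_Re V => hom_app g x) : g h / g + h} by [].
rewrite (big_morph (fun g : Hom_Re V => hom_app g x) appM erefl).
rewrite -(pair_bigA _ (fun i j => hom_app (scal (d i j) *: (F (i, j) : Hom_Re V)) x)) /=.
rewrite {1}(aE x) linear_sum; apply: eq_bigr => i _.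
rewrite linearZ /= dE scaler_sumr; apply: eq_bigr => j _.
apply: etrans _ (esym (scal_hom (d i j) (F (i, j) : Hom_Re V) x)).
rewrite -[hom_app _ x]/(F (i, j) x) FE.
rewrite -[d i j *: s j]/((scal_corner (d i j) : E^c) *: (s j : V)) !scalerA.
congr (_ *: _); apply: val_inj.
rewrite -[LHS]/((d i j *: e) * val (a i x : E)).
rewrite -[RHS]/(val (a i x : E) * (d i j *: e)).
by rewrite -scalerAl -scalerAr corner_el corner_er.
Qed.

End FiniteDimensional.

(** * The four inequalities *)

Section RestrSimple.
Variables (A B : pzRingType) (f : {rmorphism A -> B}).
Hypothesis f_surj : surj f.

(** Along a surjective ring morphism both rings have the same submodules. *)
Lemma restr_simple (X : lmodType B) :
  simple_mod (restr f X : lmodType A) <-> simple_mod X.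
Proof.
suff eqcl (S : {pred X}) :
    @submod_closed A (restr f X) S <-> @submod_closed B X S.
  by split=> -[nz simpX]; split=> // S /eqcl; apply: simpX.
split=> -[S0 SD]; split=> // a x y Sx Sy; last exact: (SD (f a)).
by have [b <-] := f_surj a; apply: (SD b).
Qed.

Lemma restr_fingen_inv (X : lmodType B) :
  fingen (restr f X : lmodType A) -> fingen X.
Proof.
move=> [n [g genX]]; exists n, g => x; have [c ->] := genX x.
by exists (f \o c).
Qed.

End RestrSimple.

Lemma ddell_alg_simple (R : pzRingType) k D (S : lmodType R^c) :
  noetherian R^c -> ddell_alg k R = Some D -> simple_mod S -> ddell_le D k S.
Proof.
move=> noethR kR Ssimp; have [|n nE le_nD] := esup_ub kR (v := ddell k S).
  by exists S.
by apply/(ddell_leP noethR); [apply: simple_fingen | rewrite nE].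
Qed.

Lemma ddell_alg_le (R : pzRingType) k m : noetherian R^c ->
  (forall S : lmodType R^c, simple_mod S -> ddell_le m k S) ->
  (ddell_alg k R <= Some m)%enat.
Proof.
move=> noethR mS; apply/esup_le => _ [S Ssimp ->].
by apply/(ddell_leP noethR); [apply: simple_fingen | apply: mS].
Qed.

Lemma to_rquotc_surj (R : pzRingType) (e : R) : surj (to_rquotc e).
Proof. by move=> x; exists (of_rquot x); apply: of_rquotK. Qed.

(** * A quotient that is projective on the left is a corner ring *)

Section IdempotentIdeal.
Variables (R : pzRingType) (e : R).

(** [u] is the value at 1 of a section [s] of the projection; for [a] in the ideal,
    [a u = s (a . 1) = s 0]. *)
Lemma ideal_idempotent : projective (rquot_left e) ->
  exists u : R, (forall a, a \in ideal_pred e -> a * u = 0) /\ to_rquot e u = 1.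
Proof.
have lin_pi : linear (fun x : R^o => to_rquot e x : rquot_left e).
  by move=> a x y; rewrite raddfD; congr (_ + _); apply: to_rquotM.
have [p pE] := linear_ex lin_pi.
move=> /(_ _ _ p idfun)[|s sE].
  by move=> x; exists (of_rquot x); rewrite pE; apply: of_rquotK.
exists (s 1); split=> [a Ia|]; last by rewrite -[RHS](sE 1) pE.
rewrite -[_ * _]/(a *: (s 1 : R^o)) -linearZ.
suff -> : a *: (1 : rquot_left e) = 0 by rewrite linear0.
rewrite -[LHS]/(to_rquot e a * 1) mulr1 -[RHS](raddf0 (to_rquot e)).
by apply/to_rquot_eq; rewrite subr0.
Qed.

Variable u : R.
Hypotheses (Iu : forall a, a \in ideal_pred e -> a * u = 0)
  (u1 : to_rquot e u = 1).

Lemma ideal_1B : 1 - u \in ideal_pred e.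
Proof. by apply/to_rquot_eq; rewrite u1. Qed.

Lemma ideal_uu : u * u = u.
Proof. by have /eqP := Iu ideal_1B; rewrite mulrBl mul1r subr_eq0 => /eqP. Qed.

(** [(1 - u) b] lies in the ideal, so [u] kills it from the right. It follows that [R u = u R u]. *)
Lemma ideal_ubu b : u * b * u = b * u.
Proof.
have /eqP := Iu (ideal_mulr b ideal_1B).
by rewrite !mulrBl mul1r subr_eq0 => /eqP->.
Qed.

Local Notation Eu := (corner ideal_uu).

Fact rquot_corner_subproof (x : rquot e) : of_rquot x * u \in corner_pred u.
Proof. by rewrite unfold_in !ideal_ubu -mulrA ideal_uu. Qed.
(** The ring isomorphism from [R / R e R] to [u R u], up to passing to converse rings; the choice of
    representative is harmless because [u] kills the ideal. *)
Definition rquot_corner (x : (rquot e)^c) : Eu^c :=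
  (Sub (of_rquot (x : rquot e) * u) (rquot_corner_subproof x) : Eu).

Lemma rquot_cornerE b : val (rquot_corner (to_rquot e b) : Eu) = b * u.
Proof.
have /to_rquot_eq/Iu := of_rquotK (to_rquot e b).
by rewrite mulrBl => /eqP; rewrite subr_eq0 => /eqP.
Qed.

Lemma rquot_cornerK x : to_rquot e (val (rquot_corner x : Eu)) = x.
Proof.
rewrite -[x in RHS]of_rquotK -[RHS]mulr1 -u1.
exact: to_rquotM.
Qed.

Fact rquot_corner_zmod : zmod_morphism rquot_corner.
Proof.
move=> x y; apply: val_inj; rewrite -(of_rquotK x) -(of_rquotK y).
set a := of_rquot x; set b := of_rquot y.
transitivity (val (rquot_corner (to_rquot e (a - b)) : Eu)).
  by congr (val (rquot_corner _ : Eu)); apply/esym/(raddfB (to_rquot e)).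
by rewrite rquot_cornerE mulrBl -!rquot_cornerE.
Qed.
Fact rquot_corner_monoid : monoid_morphism rquot_corner.
Proof.
split=> [|x y]; apply: val_inj.
  by rewrite -[1]/(to_rquot e 1) rquot_cornerE mul1r.
rewrite -(of_rquotK x) -(of_rquotK y); set a := of_rquot x; set b := of_rquot y.
transitivity (val (rquot_corner (to_rquot e (b * a)) : Eu)).
  by congr (val (rquot_corner _ : Eu)); apply/esym/to_rquotM.
rewrite -[RHS]/(val (rquot_corner (to_rquot e b) : Eu) * val (rquot_corner (to_rquot e a) : Eu)).
by rewrite !rquot_cornerE -!mulrA (mulrA u a u) ideal_ubu.
Qed.
HB.instance Definition _ :=
  GRing.isZmodMorphism.Build (rquot e)^c Eu^c rquot_corner rquot_corner_zmod.
HB.instance Definition _ :=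
  GRing.isMonoidMorphism.Build (rquot e)^c Eu^c rquot_corner rquot_corner_monoid.

Lemma rquot_corner_to (y : Eu) : rquot_corner (to_rquot e (val y)) = y.
Proof. by apply: val_inj; rewrite rquot_cornerE corner_er. Qed.

Lemma rquot_corner_surj : surj rquot_corner.
Proof. by move=> y; exists (to_rquot e (val (y : Eu))); apply: rquot_corner_to. Qed.

Lemma restr_rquot_corner_projective :
  projective (restr rquot_corner (Eu^c)^o : lmodType (rquot e)^c).
Proof.
have lin_g : linear (fun x : ((rquot e)^c)^o =>
    rquot_corner x : restr rquot_corner (Eu^c)^o).
  by move=> a x y; rewrite raddfD; congr (_ + _); apply: (rmorphM rquot_corner).
have [g gE] := linear_ex lin_g.
have [||h [gK hK]] := @iso_inv _ _ _ g.
- by move=> x y; rewrite !gE => xy; rewrite -(rquot_cornerK x) xy rquot_cornerK.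
- by move=> y; have [x xE] := rquot_corner_surj y; exists x; rewrite gE.
exact: projective_retract hK (@regular_projective _).
Qed.

(** [R u = u R u] is the regular module of the corner at [u]. *)
Lemma Re_idempotent_projective : projective (Re ideal_uu).
Proof.
have corner_val (x : Re ideal_uu) : (val x : R) \in corner_pred u.
  by rewrite unfold_in -mulrA Re_e -[X in u * X]Re_e mulrA ideal_ubu Re_e.
have lin_f : linear (fun x : Re ideal_uu => (Sub (val x : R) (corner_val x) : Eu) : (Eu^c)^o).
  by move=> a x y; apply: val_inj.
have [f fE] := linear_ex lin_f.
have val_Re (y : Eu) : (val y : (R^c)^o) \in @trunc_pred R u (R^c)^o.
  by rewrite unfold_in -[_ *: _]/((val y : R) * u) corner_er.
have lin_g : linear (fun y : (Eu^c)^o => Sub (val (y : Eu) : (R^c)^o) (val_Re y) : Re ideal_uu).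
  by move=> a x y; apply: val_inj.
have [g gE] := linear_ex lin_g.
apply: (@projective_retract _ _ _ f g); last exact: regular_projective.
by move=> x; rewrite gE fE; apply: val_inj.
Qed.

Lemma rquot_inclE (S : lmodType (rquot e)^c) (a : R) (s : S) :
  (a : R^c) *: (s : rquot_incl S) = (to_rquot e a : (rquot e)^c) *: s.
Proof. by []. Qed.

(** [u] maps to 1 in the quotient, so it acts as the identity on [S] and truncating by [u] loses
    nothing. *)
Lemma restr_trunc_iso (S : lmodType (rquot e)^c) :
  exists2 f : {linear restr rquot_corner (trunc (rquot_incl S) ideal_uu) -> S},
    injective f & surj f.
Proof.
have lin_f : linear (fun x : restr rquot_corner (trunc (rquot_incl S) ideal_uu) =>
    val (x : trunc (rquot_incl S) ideal_uu) : S).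
  move=> a x y; congr (_ + _); apply: etrans (rquot_inclE _ _) _.
  exact: (congr1 (fun b : (rquot e)^c => b *: (_ : S)) (rquot_cornerK a)).
have [f fE] := linear_ex lin_f; exists f => [x y|s]; first by rewrite !fE => /val_inj.
have us : (s : rquot_incl S) \in @trunc_pred R u (rquot_incl S).
  apply/eqP; apply: etrans (rquot_inclE u s) _.
  exact: etrans (congr1 (fun b : (rquot e)^c => b *: s) u1) (scale1r s).
by exists (Sub (s : rquot_incl S) us : trunc (rquot_incl S) ideal_uu); rewrite fE.
Qed.

End IdempotentIdeal.

Section Inequalities.
Variables (K : fieldType) (L : falgType K) (e : L) (he : e * e = e) (k : nat).
Local Notation E := (corner he).

Let noethL := @noetherian_alg K L.
Let noethE := @noetherian_corner K L e he.
Let noethQ := @noetherian_rquot K L e.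

Lemma ddell_corner_le p l D : pd_le p (Re he) -> Ll he = Some l ->
  ddell_alg k L = Some D ->
  (ddell_alg k E <= Some (p + l * D.+1 - 1)%N)%enat.
Proof.
move=> pdRe LlE DE; apply: ddell_alg_le noethE _ => T Tsimp.
have [|n nE le_nl] := esup_ub LlE (v := comp_length (tens T)); first by exists T.
have [f f_inj f_surj] := to_trunc_tens_iso T.
have n_gt0 : (0 < n)%N.
  rewrite lt0n; apply/eqP => n0; move: nE; rewrite n0 => /comp_length0 T0.
  have [[x /eqP x_neq0] _] := Tsimp; case: x_neq0; have [y <-] := f_surj x.
  by rewrite (_ : y = 0) ?linear0 //; apply: val_inj; apply: T0.
have [T_fg dT] := comp_length_ddell_le noethL
  (fun S => ddell_alg_simple noethL DE) nE n_gt0.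
have := fun_ddell_le (F := trunc_functor (Re_fingen he)) noethL noethE pdRe T_fg dT.
move=> /(ddell_le_iso noethE f_inj f_surj (trunc_fingen (Re_fingen he) T_fg)).
apply: (ddell_le_leq noethE (simple_fingen Tsimp)).
(* Positivity is what allows the truncated [- 1] to be moved out of the sum with [p]. *)
have n1 : (0 < n * D.+1)%N by rewrite muln_gt0 n_gt0.
by rewrite -subn1 addnBA // leq_sub2r // leq_add2l leq_mul2r le_nl orbT.
Qed.

(** Truncation by [u] and restriction along the ring isomorphism both send the regular module to a
    projective one, so [p = 0] for each and the level does not grow. *)
Lemma ddell_rquot_le D : projective (rquot_left e) -> ddell_alg k L = Some D ->
  (ddell_alg k (rquot e) <= Some D)%enat.
Proof.
move=> /ideal_idempotent[u [Iu u1]] DE; apply: ddell_alg_le noethQ _ => S Ssimp.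
have iSsimp : simple_mod (rquot_incl S).
  exact/(restr_simple (@to_rquotc_surj _ e)).
have dS := ddell_alg_simple noethL DE iSsimp.
have iS_fg := simple_fingen iSsimp.
have := fun_ddell_le (F := trunc_functor (Re_fingen (ideal_uu Iu u1))) noethL
  (@noetherian_corner K L u (ideal_uu Iu u1))
  (proj2 (pd_leP0 _) (@Re_idempotent_projective _ _ _ Iu u1))
  iS_fg dS.
have tS_fg := trunc_fingen (Re_fingen (ideal_uu Iu u1)) iS_fg.
move=> /(fun_ddell_le (F := restr_functor (@rquot_corner_surj _ _ _ Iu u1))
  (@noetherian_corner K L u (ideal_uu Iu u1)) noethQ
  (proj2 (pd_leP0 _) (@restr_rquot_corner_projective _ _ _ Iu u1)) tS_fg).
have [f f_inj f_surj] := restr_trunc_iso Iu u1 S.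
apply: (ddell_le_iso noethQ f_inj f_surj).
exact: (restr_fingen (@rquot_corner_surj _ _ _ Iu u1)).
Qed.

Section Lower.
Hypothesis Re_proj : projective (Re he).

Let homF := hom_functor Re_proj (fun V => hom_Re_fingen Re_proj).

(** A vanishing cokernel is kept apart: the unit is then an isomorphism and the [+ 1] of the
    subobject inequality is avoided, which the bound in (c) cannot afford when L_r is 0. *)
Lemma adj_unit_ddell_le p m (S : lmodType L^c) :
  pd_le p (Re_dual he) -> ddell_alg k E = Some m -> simple_mod S ->
  (exists x : trunc S he, x != 0) ->
  ((forall y : Y' he S, y = 0) -> ddell_le (p + m) k S) /\
  (forall c, ddell_le c k (Y' he S) -> ddell_le (c + (p + m)).+1 k S).
Proof.
move=> pdRe mE Ssimp nzS.
have Se_simp := trunc_simple Ssimp nzS.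
have Se_fg := simple_fingen Se_simp.
have rSe_fg := hom_Re_fingen Re_proj Se_fg.
have dr := fun_ddell_le (F := homF) noethE noethL pdRe Se_fg
  (ddell_alg_simple noethE mE Se_simp).
have unit_inj := adj_unit_inj Ssimp nzS.
split=> [Y0|c dY]; last first.
  have [g fg _] := coker_exact (f := adj_unit he (M := S) : {linear _ -> _}) unit_inj.
  have ex : short_exact S (Hom_Re (trunc S he)) (Y' he S) by exists (adj_unit he (M := S)), g.
  exact (ddell_le_sub noethL rSe_fg ex dr dY).
have unit_surj : surj (adj_unit he (M := S)).
  move=> y; have /to_coker_eq[z zE] : to_coker (adj_unit he (M := S)) y = to_coker _ 0.
    by rewrite [LHS]Y0 [RHS]Y0.
  by exists z; rewrite zE subr0.
have [h [hK gK]] := iso_inv (f := adj_unit he (M := S) : {linear _ -> _}) unit_inj unit_surj.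
apply: (ddell_le_iso noethL (h := h) (can_inj gK)) dr => // x.
by exists (adj_unit he x); rewrite hK.
Qed.

End Lower.

Lemma annihilated_simple (S : lmodType L^c) : simple_mod S ->
  ~ (exists x : trunc S he, x != 0) ->
  exists2 S' : lmodType (rquot e)^c, simple_mod S' &
    exists2 f : {linear rquot_incl S' -> S}, injective f & surj f.
Proof.
move=> Ssimp nS; have S0 (x : trunc S he) : x = 0.
  by apply/eqP; apply: contra_notT nS => x_neq0; exists x.
have annS := annih_of_trunc0 S0; have [f f_inj f_surj] := annih_iso annS.
exists (annih_mod annS); last by exists f.
apply/(restr_simple (@to_rquotc_surj _ e)).
have [g [fK gK]] := iso_inv f_inj f_surj.
apply: (simple_iso (f := g)) Ssimp; first exact: can_inj gK.
by move=> x; exists (f x); rewrite fK.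
Qed.

Let inclF := restr_functor (@to_rquotc_surj _ e).

Lemma Lr_length l (S : lmodType L^c) : Lr he = Some l -> simple_mod S ->
  exists2 n, comp_length (Y'_quot he S) = Some n & (n <= l)%N.
Proof. by move=> LrE Ssimp; apply: (esup_ub LrE); exists S. Qed.

Lemma ddell_le_glue p1 p2 l D m : projective (Re he) ->
  pd_le p1 (rquot_right e) -> pd_le p2 (Re_dual he) -> Lr he = Some l ->
  ddell_alg k (rquot e) = Some D -> ddell_alg k E = Some m ->
  (ddell_alg k L <= Some (maxn (p1 + D) (p1 + p2 + m + l * D.+1)))%enat.
Proof.
move=> Re_proj pd1 pd2 LrE DE mE; apply: ddell_alg_le noethL _ => S Ssimp.
have S_fg := simple_fingen Ssimp.
have [nz|z] := pselect (exists x : trunc S he, x != 0); last first.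
  have [S' S'simp [f f_inj f_surj]] := annihilated_simple Ssimp z.
  have := fun_ddell_le (F := inclF) noethQ noethL pd1 (simple_fingen S'simp)
    (ddell_alg_simple noethQ DE S'simp).
  have iS'_fg := restr_fingen (@to_rquotc_surj _ e) (simple_fingen S'simp).
  move=> /(ddell_le_iso noethL f_inj f_surj iS'_fg).
  exact/(ddell_le_leq noethL S_fg)/leq_maxl.
have [Y0 YS] := adj_unit_ddell_le Re_proj pd2 mE Ssimp nz.
have [n nE le_nl] := Lr_length LrE Ssimp.
have [n0|n_gt0] := posnP n.
  have := Y0 (comp_length0 (etrans nE (congr1 Some n0))).
  apply: (ddell_le_leq noethL S_fg); rewrite leq_max; apply/orP; right.
  by lia.
have [Y_fg dY] := comp_length_ddell_le noethQ (fun X => ddell_alg_simple noethQ DE) nE n_gt0.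
have := fun_ddell_le (F := inclF) noethQ noethL pd1 Y_fg dY.
have [f f_inj f_surj] := Y'_quot_iso he S.
have iY_fg := restr_fingen (@to_rquotc_surj _ e) Y_fg.
move=> /(ddell_le_iso noethL f_inj f_surj iY_fg) /YS.
apply: (ddell_le_leq noethL S_fg); rewrite leq_max; apply/orP; right.
(* The cokernel has level at most [p1 + (n * D.+1 - 1)]; the subobject inequality adds [p2 + m] and
   the missing 1. *)
have n1 : (0 < n * D.+1)%N by rewrite muln_gt0 n_gt0.
have le_nlD : (n * D.+1 <= l * D.+1)%N by rewrite leq_mul2r le_nl orbT.
by lia.
Qed.

(** * Simple modules over the quotient of projective dimension at most one *)

Section SimplesOfSmallDimension.
Hypothesis pd_simple :
  (esup (fun v => exists2 S : lmodType (rquot e)^c,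
     simple_mod S & v = pd (rquot_incl S)) <= 1%N)%enat.

(** Devissage: the bound on projective dimension is stable under extensions. *)
Lemma pd_rquot_incl (N : lmodType (rquot e)^c) : fingen N -> pd_le 1 (rquot_incl N).
Proof.
apply: (finite_length_ind (rquot_fin e)
  (Pr := fun N : lmodType (rquot e)^c => pd_le 1 (rquot_incl N))).
- move=> X X0; apply: (pd_le_leq noethL _ (leq0n 1)); first exact: zero_fingen.
  exact/pd_leP0/zero_projective.
- move=> X Xsimp; apply: (pd_leP noethL); last first.
    by move/esup_le: pd_simple; apply; exists X.
  exact/simple_fingen/(restr_simple (@to_rquotc_surj _ e)).
move=> A B C A_fg C_fg /(fun_short_exact inclF).
by apply: (pd_le_ext noethL); apply: (restr_fingen (@to_rquotc_surj _ e)).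
Qed.

Lemma pd_annihilated (M : lmodType L^c) : fingen M ->
  (forall (a : L) (y : M), a \in ideal_pred e -> (a : L^c) *: y = 0) -> pd_le 1 M.
Proof.
move=> M_fg annM; have [f f_inj f_surj] := annih_iso annM.
have [g [fK gK]] := iso_inv f_inj f_surj.
apply: (pd_le_sretract noethL M_fg (sretract_split gK)); apply: pd_rquot_incl.
apply: (@restr_fingen_inv L^c (rquot e)^c (to_rquotc e) (annih_mod annM)).
apply: (fingen_surj (f := g)) M_fg.
by move=> x; exists (f x); rewrite fK.
Qed.

(* [LeL] is the first syzygy of the quotient, hence projective as a right
   module; a dual basis for the generators [v i * e] restricts to [Le]. *)
Lemma Re_projective : projective (Re he).
Proof.
have [n [v spanL]] := basis_span L.
have lin_pi : linear (fun x : (L^c)^o => to_rquot e x : rquot_right e).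
  by move=> a x y; rewrite raddfD; congr (_ + _); exact (@to_rquotM L e (x : L) (a : L)).
have [p pE] := linear_ex lin_pi.
have p_surj : surj p.
  by move=> x; exists (of_rquot x); rewrite pE; apply: of_rquotK.
have pK x : p x = 0 <-> x \in ideal_pred e.
  rewrite pE -[0 in X in X <-> _](raddf0 (to_rquot e)).
  by split=> [/to_rquot_eq|?]; [rewrite subr0 | apply/to_rquot_eq; rewrite subr0].
have kE := ker_exact p_surj; have [kinj _ kerE] := kE.
have pker : syzygy1 (rquot_right e) (kermod p).
  exists (L^c)^o; split; [exact: regular_fingen|exact: regular_projective|].
  by exists (ker_val p), p.
have P_proj : projective (kermod p).
  apply: pd_le_syzygy (is_syzygy1 pker).
  exact: (pd_rquot_incl (@regular_fingen (rquot e)^c)).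
have ideal_ve i : v i * e \in ideal_pred e.
  by apply/ideal_predP; exists [:: (v i, 1)]; rewrite big_seq1 mulr1.
have [w wE] := choice (fun i => (kerE (v i * e)).1 ((pK _).2 (ideal_ve i))).
have [a aE] : exists a : 'I_n -> {linear kermod p -> (L^c)^o},
    forall x, x = \sum_i (a i x : L^c) *: w i.
  apply: projective_dual_basis P_proj _ => x.
  have /pK/ideal_predP[s sE] := ker_valP x.
  (* Expanding the left factors over the basis [v] moves the scalars into the right factors, so the
     [v i * e] generate the ideal on the right. *)
  suff [c cE] : exists c : 'I_n -> L, \sum_(q <- s) q.1 * e * q.2 = \sum_i v i * e * c i.
    exists c; apply: kinj; rewrite [LHS]sE cE linear_sum; apply: eq_bigr => i _.
    by rewrite linearZ /= wE.
  elim: s {sE} => [|[b1 b2] s [c cE]].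
    by exists (fun=> 0); rewrite big_nil big1 // => i _; rewrite mulr0.
  have [d dE] := spanL b1; exists (fun i => d i *: b2 + c i).
  rewrite big_cons cE dE /= !mulr_suml -big_split; apply: eq_bigr => i _ /=.
  by rewrite mulrDr -!scalerAr -!scalerAl.
have ideal_Re (x : Re he) : p (val x) = 0.
  apply/pK/ideal_predP; exists [:: (val x, 1)].
  by rewrite big_seq1 mulr1 Re_e.
have [j jE] := choice (fun x : Re he => (kerE (val x)).1 (ideal_Re x)).
have jZ (c : E) x y : j ((c : E^c) *: x + y) = ((val c : L) : L^c) *: j x + j y.
  by apply: kinj; rewrite linearP !jE.
(* Linearity transports [x = x e] to the coefficients. A further factor [e] on the left puts them in
   [E], and [v i * e] absorbs that factor. *)
have aj i x : (a i (j x) : L) * e = a i (j x).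
  rewrite -[LHS]/((e : L^c) *: (a i (j x))) -linearZ; congr (a i _).
  by apply: kinj; rewrite linearZ /= jE; apply: (truncE x).
have lin_b i : linear (fun x : Re he => corner_of he (a i (j x)) : (E^c)^o).
  move=> c x y; rewrite jZ linearP.
  exact (corner_of_linear c (a i (j x)) (a i (j y))).
have [b bE] := choice (fun i => linear_ex (lin_b i)).
apply: (@dual_basis_projective _ (Re he) n (fun i => Re_elt he (v i)) b) => x.
apply: val_inj; rewrite (raddf_sum (val : {additive Re he -> _})) -jE {1}(aE (j x)).
rewrite linear_sum; apply: eq_bigr => i _; rewrite linearZ /= wE bE.
rewrite -[LHS]/(v i * e * (a i (j x) : L)).
rewrite -[RHS]/(v i * e * (e * (a i (j x) : L) * e)).
by rewrite -(mulrA e (a i (j x) : L)) aj !mulrA -(mulrA (v i) e e) he.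
Qed.

Let homF := hom_functor Re_projective (fun V => hom_Re_fingen Re_projective).

(** Kernel and cokernel are modules over the quotient, of projective dimension at most 1. The image,
    a quotient of the projective [M] by the kernel, has dimension at most 2, and [N] is an extension
    of the cokernel by the image. *)
Lemma pd_annihilated_ker_coker (M N : lmodType L^c) (f : {linear M -> N}) :
  fingen M -> projective M -> fingen N ->
  (forall x, f x = 0 -> (e : L^c) *: x = 0) ->
  (forall (a : L) (y : coker f), a \in ideal_pred e -> (a : L^c) *: y = 0) ->
  pd_le 2 N.
Proof.
move=> M_fg M_proj N_fg ker_f coker_f.
have [g gE] := linear_ex (@to_coker_linear _ _ _ f).
have g_surj : surj g by move=> y; exists (of_coker y); rewrite gE of_cokerK.
have [iinj _ iE] := ker_exact g_surj.
have im_ex : short_exact (kermod g) N (coker f).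
  by exists (ker_val g), g; apply: ker_exact.
have gK y : g y = 0 <-> exists x, f x = y.
  rewrite -[0](linear0 g) !gE; split=> [/to_coker_eq|[x fx]].
    by rewrite subr0.
  by apply/to_coker_eq; exists x; rewrite subr0.
have [h hE] : exists h : {linear M -> kermod g}, forall x, ker_val g (h x) = f x.
  by apply: lift_inj => // x; apply/iE/gK; exists x.
have h_surj : surj h.
  move=> y; have /gK[x xE] : g (ker_val g y) = 0 by apply: ker_valP.
  by exists x; apply: iinj; rewrite hE.
have ker_ex : short_exact (kermod h) M (kermod g).
  by exists (ker_val h), h; apply: ker_exact.
have [ker_fg im_fg] := short_exact_fingen noethL ker_ex M_fg.
have pd_ker : pd_le 1 (kermod h).
  apply: pd_annihilated ker_fg (annih_of_trunc0 (he := he) _) => x.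
  apply: val_inj; apply: etrans (esym (truncE x)) _; apply: submod_val_inj.
  by apply: ker_f; rewrite -hE ker_valP linear0.
have pd_im : pd_le 2 (kermod g).
  apply: (pd_le_quot noethL M_fg ker_ex pd_ker).
  apply: (pd_le_leq noethL M_fg (leq0n 1)).
  exact/pd_leP0.
have coker_fg : fingen (coker f) by apply: fingen_surj g_surj N_fg.
apply: (pd_le_ext noethL im_fg coker_fg im_ex pd_im).
by apply: (pd_leS noethL coker_fg); apply: pd_annihilated.
Qed.

(* The unit [L -> Hom_E(Le, Le)] has kernel and cokernel annihilated by [LeL],
   and [E] is a direct summand of [Le]. *)
Lemma pd_Re_dual : pd_le 2 (Re_dual he).
Proof.
have pd_hom : pd_le 2 (Hom_Re (Re he) : lmodType L^c).
  apply: (@pd_annihilated_ker_coker (L^c)^o (Hom_Re (Re he)) (adj_unit he (M := (L^c)^o))).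
  - exact: regular_fingen.
  - exact: regular_projective.
  - exact: hom_Re_fingen Re_projective (Re_fingen he).
  - move=> x x0; have {}x0 : ((1 * e : L) : L^c) *: x = 0.
      exact: (congr1 (fun f : Hom_Re (Re he) => val (hom_app f (Re_elt he 1))) x0).
    by rewrite mul1r in x0.
  - exact: (@Y'_annih _ _ _ (L^c)^o).
(* The splitting consists of the inclusion of [e L e] in [L e] and of left multiplication by [e]. *)
have val_Re (y : E) : (val y : (L^c)^o) \in @trunc_pred L e (L^c)^o.
  by rewrite unfold_in -[_ *: _]/((val y : L) * e) corner_er.
have lin_f : linear (fun y : (E^c)^o => Sub (val (y : E) : (L^c)^o) (val_Re y) : Re he).
  by move=> a x y; apply: val_inj.
have lin_r : linear (fun x : Re he => corner_of he (val x) : (E^c)^o).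
  by move=> c x y; exact (corner_of_linear c (val x) (val y)).
have [f fE] := linear_ex lin_f; have [r rE] := linear_ex lin_r.
have fK : cancel f r by move=> y; rewrite rE fE; apply: val_inj; apply: cornerE.
have dual_fg : fingen (Re_dual he).
  exact: hom_Re_fingen Re_projective (@regular_fingen _).
exact (pd_le_sretract noethL dual_fg (sretract_split (fun_split (F := homF) fK)) pd_hom).
Qed.

Lemma ddell_le_small l m : Lr he = Some l -> ddell_alg k E = Some m ->
  (ddell_alg k L <= Some (m + 2 * l + 3)%N)%enat.
Proof.
move=> LrE mE; apply: ddell_alg_le noethL _ => S Ssimp.
have S_fg := simple_fingen Ssimp.
have [nz|z] := pselect (exists x : trunc S he, x != 0); last first.
  have [S' S'simp [f f_inj f_surj]] := annihilated_simple Ssimp z.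
  have [g [fK gK]] := iso_inv f_inj f_surj.
  have pdS : pd_le 1 S.
    apply: (pd_le_sretract noethL S_fg (sretract_split gK)).
    exact/pd_rquot_incl/simple_fingen.
  apply: (ddell_le_leq noethL S_fg) (pd_le_ddell_le noethL k S_fg pdS).
  by rewrite addnS.
have [Y0 YS] := adj_unit_ddell_le Re_projective pd_Re_dual mE Ssimp nz.
have [n nE le_nl] := Lr_length LrE Ssimp.
have [n0|n_gt0] := posnP n.
  have := Y0 (comp_length0 (etrans nE (congr1 Some n0))).
  apply: (ddell_le_leq noethL S_fg).
  by lia.
have Y_fg : fingen (Y' he S).
  have [g gE] := linear_ex (@to_coker_linear _ _ _ (adj_unit he (M := S))).
  apply: (fingen_surj (f := g)); first by move=> y; exists (of_coker y); rewrite gE of_cokerK.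
  exact: hom_Re_fingen Re_projective (simple_fingen (trunc_simple Ssimp nz)).
have pdY : pd_le 1 (Y' he S) by apply: pd_annihilated Y_fg _ => a y; apply: Y'_annih.
(* This gives the level [(1 + (2 + m)).+1 = m + 4], and [l >= n >= 1] puts it below
   [m + 2 * l + 3]. *)
have := YS 1%N (pd_le_ddell_le noethL k Y_fg pdY).
by apply: (ddell_le_leq noethL S_fg); lia.
Qed.

End SimplesOfSmallDimension.
End Inequalities.

Theorem corollary5p5 (K : closedFieldType) (L : falgType K)
    (e : L) (he : e * e = e) (k : nat) (hk : (1 <= k)%N) :
  [/\ (* (a) *)
      pd (Re he) <> oo ->
      (ddell_alg k (corner he) <=
         pd (Re he) + Ll he * (ddell_alg k L + 1%N) - 1%N)%enat,
      (* (b) *)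
      projective (rquot_left e) ->
      (ddell_alg k (rquot e) <= ddell_alg k L)%enat,
      (* (c) *)
      projective (Re he) -> pd (rquot_right e) <> oo -> pd (Re_dual he) <> oo ->
      (ddell_alg k L <=
         emax (pd (rquot_right e) + ddell_alg k (rquot e))
              (pd (rquot_right e) + pd (Re_dual he) + ddell_alg k (corner he)
                 + Lr he * (ddell_alg k (rquot e) + 1%N)))%enat
    & (* (d) *)
      (esup (fun v => exists2 S : lmodType (rquot e)^c,
               simple_mod S & v = pd (rquot_incl S)) <= 1%N)%enat ->
      (ddell_alg k (corner he) <= Ll he * (ddell_alg k L + 1%N) - 1%N)%enat /\
      (ddell_alg k L <= ddell_alg k (corner he) + 2%N * Lr he + 3%N)%enat].
Proof.
have noethL := @noetherian_alg K L; have noethE := @noetherian_corner K L e he.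
have pd_self (R : pzRingType) (X : lmodType R) p : noetherian R -> pd X = Some p -> pd_le p X.
  by move=> noethR pX; apply: (pd_leP noethR (pd_fingen pX)); rewrite pX /=.
split=> [|rquot_proj|Re_proj|pd_simple].
- case pRe: (pd (Re he)) => [p|] // _.
  (* An infinite operand makes the whole right-hand side [oo]; only finite values remain to be
     treated, here and in the other parts. *)
  case LlE: (Ll he) => [l|]; last by case: ddell_alg.
  case DE: (ddell_alg k L) => [D|]; last by case: ddell_alg.
  by have := ddell_corner_le (pd_self _ _ _ noethE pRe) LlE DE; rewrite /= addn1.
- case DE: (ddell_alg k L) => [D|]; last by case: ddell_alg.
  exact: ddell_rquot_le rquot_proj DE.
- case p1E: (pd (rquot_right e)) => [p1|] // _.
  case p2E: (pd (Re_dual he)) => [p2|] // _.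
  case DE: (ddell_alg k (rquot e)) => [D|]; last by case: ddell_alg.
  case mE: (ddell_alg k (corner he)) => [m|]; last by case: ddell_alg.
  case LrE: (Lr he) => [l|]; last by case: ddell_alg.
  have := ddell_le_glue Re_proj (pd_self _ _ _ noethL p1E) (pd_self _ _ _ noethL p2E)
    LrE DE mE.
  by rewrite /= addn1.
have Re_proj := Re_projective (he := he) pd_simple.
split.
  case LlE: (Ll he) => [l|]; last by case: ddell_alg.
  case DE: (ddell_alg k L) => [D|]; last by case: ddell_alg.
  (* The bound of (a) with [p = 0], as [Re] is projective here. *)
  by have := ddell_corner_le (proj2 (pd_leP0 _) Re_proj) LlE DE; rewrite /= addn1 add0n.
case mE: (ddell_alg k (corner he)) => [m|]; last by case: ddell_alg.
case LrE: (Lr he) => [l|]; last by case: ddell_alg.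
exact: (ddell_le_small pd_simple LrE mE).
Qed.
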